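(* Let $\Omega\subset\mathbb R^3$ be a bounded Lipschitz domain with connected complement, $\Gamma$ an open subset of $\partial\Omega$, $k\in\mathbb R_+$, and let $v,w\in H^1(\Omega)$ be a pair of conductive transmission eigenfunctions associated with $k$, i.e. a nontrivial pair satisfying $$\Delta w+k^2 q w=0\ \text{ in }\Omega,\qquad \Delta v+k^2 v=0\ \text{ in }\Omega,\qquad w=v,\ \ \partial_\nu w=\partial_\nu v+\eta v\ \text{ on }\Gamma .$$ Assume that $\mathbf 0\in\Gamma\subset\partial\Omega$ and that $\Omega$ contains a conic corner $\Omega\cap B_h=\mathcal C\cap B_h=\mathcal C^h$, where $\mathcal C$ is a strictly convex conic cone with apex $\mathbf 0$ and opening angle $2\theta_0$, $\theta_0\in(0,\pi/2)$, such that $v\in C^\alpha(\overline{\mathcal C^h})$, $q\in H^2(\overline{\mathcal C^h})$ and $\eta\in C^\alpha(\overline{\Gamma_h})$ for some $0<\alpha<1$. If $\eta(\mathbf 0)\neq0$, where $\mathbf 0$ is the apex of $\mathcal C^h$, then $v(\mathbf 0)=0$.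
   Context: $q=1+V$ with $V\in L^\infty(\Omega)$ complex-valued; $\eta\in L^\infty(\partial\Omega)$ is complex-valued; $\nu$ is the exterior unit normal to $\partial\Omega$. $B_h$ is the open ball of radius $h>0$ centered at the origin. The conic cone with apex $\mathbf 0$, axis $\mathbf v_0=(0,0,1)^\top$ and half-opening $\theta_0$ is $\mathcal C=\{\mathbf y\in\mathbb R^3\setminus\{\mathbf 0\}: 0\le\angle(\mathbf y,\mathbf v_0)<\theta_0\}$; $\mathcal C^h=\mathcal C\cap B_h$ and $\Gamma_h=\partial\mathcal C\cap B_h$. *)

(* Defs.v *)
From HB Require Import structures.
From mathcomp Require Import all_boot all_order all_algebra.
From mathcomp Require Import all_classical all_reals all_analysis.
From mathcomp Require Import complex.
Set Implicit Arguments.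
Unset Strict Implicit.
Unset Printing Implicit Defensive.
Import Order.TTheory GRing.Theory Num.Theory numFieldNormedType.Exports.
Local Open Scope classical_set_scope.
Local Open Scope ring_scope.

(* [measurableTypeR R] is [R] itself with the Borel sigma-algebra on which
   [lebesgue_measure] is defined. The library norm of a product is the sup norm;
   everything metric below uses the Euclidean norm [enorm] instead. *)
Notation R3 R := (measurableTypeR R * measurableTypeR R * measurableTypeR R)%type.

Section Euclidean.
Context {R : realType}.
Implicit Types (x y : R3 R) (A : set (R3 R)) (r d : R).

Definition dot x y : R := x.1.1 * y.1.1 + x.1.2 * y.1.2 + x.2 * y.2.

Definition enorm x : R := Num.sqrt (dot x x).

Definition unitvec (i : 'I_3) : R3 R :=
  (((i == 0)%:R, (i == 1)%:R), (i == 2)%:R).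

Definition angle x y : R := acos (dot x y / (enorm x * enorm y)).

Definition eball r : set (R3 R) := [set x | enorm x < r].

Definition boundary A : set (R3 R) := closure A `\` interior A.

Definition volume : {measure set (R3 R) -> \bar R} :=
  ((@lebesgue_measure R \x @lebesgue_measure R) \x @lebesgue_measure R)%E.

Definition diam_le A d := forall x y, A x -> A y -> enorm (x - y) <= d.

(* Two-dimensional Hausdorff measure, normalised by the area pi/4 of the disc of
   diameter 1; on the boundary of a Lipschitz domain it is the surface measure. *)
Definition hausdorff2_delta (delta : R) A : \bar R :=
  ereal_inf [set s : \bar R | exists (U : nat -> set (R3 R)) (d : nat -> R),
    [/\ A `<=` \bigcup_n U n,
        forall n, 0 <= d n <= delta,
        forall n, diam_le (U n) (d n) &
        s = (\sum_(0 <= n <oo) (pi / 4 * d n ^+ 2)%:E)%E]].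

Definition hausdorff2 A : \bar R :=
  ereal_sup [set hausdorff2_delta delta A | delta in [set delta : R | 0 < delta]].

Definition cone (theta0 : R) : set (R3 R) :=
  [set y | y != 0 /\ 0 <= angle y (0, 0, 1) < theta0].

Definition lipschitz_boundary (Omega : set (R3 R)) :=
  forall x0, boundary Omega x0 ->
  exists (e : 'I_3 -> R3 R) (g : R * R -> R) (k r : R),
    [/\ forall i j, dot (e i) (e j) = (i == j)%:R,
        k.-lipschitz g,
        0 < r &
        forall x, enorm (x - x0) < r ->
          (Omega x <->
           g (dot (x - x0) (e 0), dot (x - x0) (e 1)) < dot (x - x0) (e 2))].

Definition bounded_lipschitz_domain (Omega : set (R3 R)) :=
  [/\ open Omega, connected Omega, Omega !=set0,
      bounded_set Omega &
      lipschitz_boundary Omega].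

End Euclidean.

Section ComplexFunctions.
Context {R : realType}.
Implicit Types (u f g : R3 R -> R[i]) (A : set (R3 R))
  (mu : set (R3 R) -> \bar R).

Definition cintegral mu A f : R[i] :=
  Complex (fine (\int[mu]_(x in A) (complex.Re (f x))%:E)%E)
          (fine (\int[mu]_(x in A) (complex.Im (f x))%:E)%E).

Definition cmeasurable A u :=
  measurable_fun A (fun x => complex.Re (u x) : R) /\
  measurable_fun A (fun x => complex.Im (u x) : R).

Definition sqnorm mu A u : \bar R := (\int[mu]_(x in A) (Normc.normc (u x) ^+ 2)%:E)%E.

Definition L2 mu A u := cmeasurable A u /\ (sqnorm mu A u < +oo)%E.

Definition Linf mu A u := cmeasurable A u /\
  exists M : R, {ae mu, forall x, A x -> Normc.normc (u x) <= M}.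

Definition holder (alpha : R) A u := exists M : R,
  forall x y, A x -> A y -> Normc.normc (u x - u y) <= M * enorm (x - y) `^ alpha.

End ComplexFunctions.

Section WeakDerivatives.
Context {R : realType}.
Implicit Types (phi : R3 R -> R) (u f g : R3 R -> R[i]) (U : set (R3 R))
  (du : 'I_3 -> R3 R -> R[i]).

Definition partial (i : 'I_3) phi : R3 R -> R := fun x => 'D_(unitvec i) phi x.

Definition cpartial (i : 'I_3) u : R3 R -> R[i] := fun x =>
  Complex (partial i (fun y => complex.Re (u y)) x)
          (partial i (fun y => complex.Im (u y)) x).

Definition laplacian phi : R3 R -> R :=
  fun x => \sum_(i < 3) partial i (partial i phi) x.

(* C^infinity: all iterated partial derivatives exist and are continuous. *)
Definition smooth phi := forall s : seq 'I_3,
  let psi := foldr partial phi s in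
  continuous psi /\ forall (i : 'I_3) x, derivable psi x (unitvec i).

Definition csmooth u :=
  smooth (fun x => complex.Re (u x)) /\ smooth (fun x => complex.Im (u x)).

Definition supp phi : set (R3 R) := closure [set x | phi x != 0].

(* Real-valued test functions suffice: all pairings below are C-bilinear. *)
Definition test_function U phi :=
  [/\ smooth phi, compact (supp phi) & supp phi `<=` U].

Definition weak_partial U (i : 'I_3) u f := forall phi, test_function U phi ->
  cintegral volume U (fun x => u x * (partial i phi x)%:C%C) =
  - cintegral volume U (fun x => f x * (phi x)%:C%C).

(* u is in H^1(U), with weak gradient du. *)
Definition H1_gradient U u du := L2 volume U u /\
  forall i, L2 volume U (du i) /\ weak_partial U i u (du i).

Definition H1 U u := exists du, H1_gradient U u du.

Definition H2 U u := exists2 du, H1_gradient U u du & forall i, H1 U (du i).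

(* The Laplacian of u in the sense of distributions on U is f. *)
Definition weak_laplacian U u f := forall phi, test_function U phi ->
  cintegral volume U (fun x => u x * (laplacian phi x)%:C%C) =
  cintegral volume U (fun x => f x * (phi x)%:C%C).

(* g is the trace on the boundary of Omega of u in H^1(Omega): the trace operator
   is the continuous extension of the restriction of smooth functions. *)
Definition is_trace (Omega : set (R3 R)) u g :=
  L2 hausdorff2 (boundary Omega) g /\
  exists du (un : nat -> R3 R -> R[i]),
  [/\ H1_gradient Omega u du,
      forall n, csmooth (un n),
      sqnorm volume Omega (fun x => un n x - u x) @[n --> \oo] --> 0%E,
      forall i, sqnorm volume Omega (fun x => cpartial i (un n) x - du i x)
                  @[n --> \oo] --> 0%E &
      sqnorm hausdorff2 (boundary Omega) (fun x => un n x - g x)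
                  @[n --> \oo] --> 0%E].

(* The exterior normal derivative of u in H^1(Omega) with weak gradient du and
   weak Laplacian f in L^2(Omega), as an element of H^(-1/2)(boundary Omega)
   applied to the trace of phi; the formula is Green's first identity. *)
Definition normal_derivative (Omega : set (R3 R)) du f phi : R[i] :=
  cintegral volume Omega (fun x =>
    \sum_(i < 3) du i x * (partial i phi x)%:C%C + f x * (phi x)%:C%C).

(* Test functions whose traces have compact support in the relatively open
   subset Gamma of the boundary. *)
Definition boundary_test_function (Omega Gamma : set (R3 R)) phi :=
  [/\ smooth phi, compact (supp phi) & supp phi `&` boundary Omega `<=` Gamma].

Definition conductive_transmission_eigenfunctions
    (Omega Gamma : set (R3 R)) (k : R) (q eta v w : R3 R -> R[i]) :=
  let lap_w x := - (k ^+ 2)%:C%C * q x * w x in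
  let lap_v x := - (k ^+ 2)%:C%C * v x in
  [/\ ~ {ae volume, forall x, Omega x -> v x = 0 /\ w x = 0},
      weak_laplacian Omega w lap_w,
      weak_laplacian Omega v lap_v &
      exists dv dw tv tw,
      [/\ H1_gradient Omega v dv /\ H1_gradient Omega w dw,
          is_trace Omega v tv /\ is_trace Omega w tw,
          {ae hausdorff2, forall x, Gamma x -> tw x = tv x} &
          forall phi, boundary_test_function Omega Gamma phi ->
            normal_derivative Omega dw lap_w phi =
            normal_derivative Omega dv lap_v phi +
            cintegral hausdorff2 Gamma (fun x => eta x * tv x * (phi x)%:C%C)]].

End WeakDerivatives.

(* Main.v *)
Require Import Defs.
From HB Require Import structures.
From mathcomp Require Import all_boot all_order all_algebra.
From mathcomp Require Import all_classical all_reals all_analysis.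
From mathcomp Require Import complex ring lra measurable_realfun.
Set Implicit Arguments.
Unset Strict Implicit.
Unset Printing Implicit Defensive.
Import Order.TTheory GRing.Theory Num.Theory numFieldNormedType.Exports.
Local Open Scope classical_set_scope.
Local Open Scope ring_scope.

(* With m = cot theta0 the cone is x3 > m |(x1, x2)|. Suppose eta(0) v(0) <> 0 and test
   the transmission condition on the normal derivatives with a cutoff times
   psi_e = - d_3 (1 / |x - p_e|), where the pole p_e = (0, 0, -e) lies outside the cone:
   psi_e is harmonic and nonnegative on the cone. Since u = w - v has zero trace near the
   apex, integrating by parts once more leaves only volume terms, in which either the
   cutoff is differentiated, far from the apex, or psi_e is multiplied by
   lap u = O(1 + |u|); Hardy's inequality along vertical lines bounds these uniformly
   in e. The boundary term is close to eta(0) v(0) times the surface integral of psi_e,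
   which is at least c ln (1 / e) because psi_e is of order (|(x1, x2)| + e)^-2 on the
   boundary of the cone. Letting e tend to 0 gives a contradiction.

   The surface measure is the Hausdorff measure; on the graph x3 = m |(x1, x2)| it is
   only compared, up to constants, with planar Lebesgue measure. *)

(** * Hausdorff measure *)

(** The difference [u] is only of class H^1: nothing pointwise is known about [w], and normal
    derivatives exist only as functionals. The test function must be singular enough for the
    boundary term to diverge, yet mild enough for the volume terms to stay bounded. The kernel, of
    order |x|^-2, sits at the threshold: over a surface its integral diverges, but only
    logarithmically, while over the volume it is integrable even against [u]. Indeed, with b = (x3 +
    e)^(-1/2) it is at most b^4 on the cone, and |u| b^4 is split into u^2 b^3 and b^5: the second
    is integrable because horizontal slices of the cone have area O(x3^2), the first is what Hardy's
    inequality controls. The poles stay off the cone so that each test function is smooth, as the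
    weak formulation requires.

    Two links between weak and pointwise notions are needed. The trace of [v] is an L^2 limit, and
    its closeness to v(0) near the apex has to be derived from the continuity of [v] inside. The
    vanishing trace of [u] enters only through Hardy's inequality, which serves twice: for the
    singular weight, and to make the boundary layer of a cutoff negligible. *)

Section enorm_facts.
Context {R : realType}.
Implicit Types x y : R3 R.

Lemma dotxx_ge0 x : 0 <= dot x x.
Proof. by rewrite /dot -!expr2 !addr_ge0 ?sqr_ge0. Qed.

Lemma enorm_sqr x : enorm x ^+ 2 = x.1.1 ^+ 2 + x.1.2 ^+ 2 + x.2 ^+ 2.
Proof. by rewrite /enorm sqr_sqrtr ?dotxx_ge0. Qed.

Lemma enorm_ge0 x : 0 <= enorm x. Proof. exact: sqrtr_ge0. Qed.

Lemma enorm0 : enorm (0 : R3 R) = 0.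
Proof. by rewrite /enorm /dot /= !mul0r !addr0 sqrtr0. Qed.

Lemma enorm_le x (c : R) : 0 <= c ->
  x.1.1 ^+ 2 + x.1.2 ^+ 2 + x.2 ^+ 2 <= c ^+ 2 -> enorm x <= c.
Proof. by move=> c0 h; rewrite -(@ler_pXn2r R 2) ?nnegrE ?enorm_ge0 // enorm_sqr. Qed.

Lemma coord1_le_enorm x : `|x.1.1| <= enorm x.
Proof.
rewrite -(@ler_pXn2r R 2) ?nnegrE ?enorm_ge0 // enorm_sqr real_normK ?num_real //.
by rewrite -addrA lerDl addr_ge0 ?sqr_ge0.
Qed.

Lemma coord2_le_enorm x : `|x.1.2| <= enorm x.
Proof.
rewrite -(@ler_pXn2r R 2) ?nnegrE ?enorm_ge0 // enorm_sqr real_normK ?num_real //.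
by rewrite addrAC lerDr addr_ge0 ?sqr_ge0.
Qed.

Lemma coord3_le_enorm x : `|x.2| <= enorm x.
Proof.
rewrite -(@ler_pXn2r R 2) ?nnegrE ?enorm_ge0 // enorm_sqr real_normK ?num_real //.
by rewrite lerDr addr_ge0 ?sqr_ge0.
Qed.

Lemma enorm_le_sum x : enorm x <= `|x.1.1| + `|x.1.2| + `|x.2|.
Proof.
apply: enorm_le; first by rewrite !addr_ge0.
rewrite -(real_normK (num_real x.1.1)) -(real_normK (num_real x.1.2)).
rewrite -(real_normK (num_real x.2)).
have := normr_ge0 x.1.1; have := normr_ge0 x.1.2; have := normr_ge0 x.2.
by set a := `|x.1.1|; set b := `|x.1.2|; set c := `|x.2| => ? ? ?; nra.
Qed.

End enorm_facts.

Section hausdorff_outer.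
Context {R : realType}.
Implicit Types (A B X : set (R3 R)) (delta : R).
Local Open Scope ereal_scope.

(** In the discrete sigma-algebra every set is measurable, so [mu_ext], which covers by measurable
    sets, becomes an infimum over all covers, and [hausdorff2_delta] inherits the properties of an
    outer measure. *)
Let Tall := g_sigma_algebraType [set: set (R3 R)].

Let gdiam delta A := [set d : R | (0 <= d <= delta)%R /\ diam_le A d].

(** Each covering set is charged for its least admissible diameter; a set too large for the scale
    [delta] costs +oo, which excludes it from covers of finite cost. *)
Let gauge delta (A : set Tall) : \bar R :=
  if `[< gdiam delta A !=set0 >] then (pi / 4 * inf (gdiam delta A) ^+ 2)%:E else +oo.

Let gauge_ge0 delta A : 0 <= gauge delta A.
Proof.
rewrite /gauge; case: asboolP => // _.
by rewrite lee_fin mulr_ge0 ?sqr_ge0 // divr_ge0 ?pi_ge0.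
Qed.

Let inf_gdiam delta A : gdiam delta A !=set0 -> gdiam delta A (inf (gdiam delta A)).
Proof.
move=> g0.
have hl : has_lbound (gdiam delta A) by exists 0%R => d [/andP[]].
split.
  apply/andP; split; first by apply: lb_le_inf => // d [/andP[]].
  case: g0 => d /[dup] gd [/andP[_ dd] _]; apply: le_trans dd.
  exact: ge_inf.
move=> x y Ax Ay; apply: lb_le_inf => // d [_]; exact.
Qed.

Let gauge0 delta : (0 < delta)%R -> gauge delta set0 = 0.
Proof.
move=> d0; rewrite /gauge.
have g0 : gdiam delta set0 0%R by split => //; rewrite lexx ltW.
have [h|] := asboolP; last by case; exists 0%R.
have /andP[i0 _] := (inf_gdiam h).1.
suff -> : inf (gdiam delta set0) = 0%R by rewrite expr0n/= mulr0.
apply/eqP; rewrite eq_le i0 andbT; apply: ge_inf => //.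
by exists 0%R => d [/andP[]].
Qed.

(** A cover with prescribed diameters never costs less than with the least ones, and a cover
    containing a set of infinite cost cannot lower the infimum. *)
Let hausdorff2_deltaE delta : hausdorff2_delta delta = mu_ext (gauge delta).
Proof.
apply/funext => A; apply/eqP; rewrite eq_le; apply/andP; split.
- apply: le_ereal_inf_tmp => _ [F [_ AF] <-].
  have [[n nF]|/forallNP F0] := pselect (exists n, ~ (gdiam delta (F n) !=set0)).
    rewrite (eseries_pinfty _ _ (_ : gauge delta (F n) = +oo)) ?leey //.
    + by move=> k _; rewrite gt_eqF// (lt_le_trans _ (gauge_ge0 _ _)).
    + by rewrite /gauge; case: asboolP.
  apply: ereal_inf_lbound; exists F, (fun n => inf (gdiam delta (F n))).
  have F1 n : gdiam delta (F n) !=set0 by move/contrapT : (F0 n).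
  split=> //.
  + by move=> n; exact: (inf_gdiam (F1 n)).1.
  + by move=> n; exact: (inf_gdiam (F1 n)).2.
  + by apply: eq_eseriesr => n _; rewrite /gauge; case: asboolP.
- apply: le_ereal_inf_tmp => _ [U [d [AU d0 dU ->]]].
  apply: ge_ereal_inf; exists (\sum_(k <oo) gauge delta (U k)).
    by exists U => //; split => // i; exact: sub_sigma_algebra.
  apply: lee_nneseries => // n _.
  have gn : gdiam delta (U n) (d n) by split.
  rewrite /gauge; case: asboolP => [h|[]]; last by exists (d n).
  rewrite lee_fin ler_wpM2l ?divr_ge0 ?pi_ge0 //.
  have /andP[i0 _] := (inf_gdiam h).1.
  rewrite ler_pXn2r ?nnegrE //; last by case/andP: (d0 n).
  by apply: ge_inf => //; exists 0%R => e [/andP[]].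
Qed.

Lemma hausdorff2_delta_ge0 delta A : 0 <= hausdorff2_delta delta A.
Proof. by rewrite hausdorff2_deltaE; apply: mu_ext_ge0. Qed.

Lemma hausdorff2_delta_anti delta delta' A : (delta <= delta')%R ->
  hausdorff2_delta delta' A <= hausdorff2_delta delta A.
Proof.
move=> dd; apply: ereal_inf_le_tmp => _ [U [d [AU d0 dU ->]]].
exists U, d; split => // n; have /andP[-> h] := d0 n; exact: le_trans dd.
Qed.

Lemma hausdorff2_ge delta A : (0 < delta)%R ->
  hausdorff2_delta delta A <= hausdorff2 A.
Proof. by move=> d0; apply: ereal_sup_ubound; exists delta. Qed.

Lemma hausdorff2_le A (x : \bar R) :
  (forall delta, (0 < delta)%R -> hausdorff2_delta delta A <= x) ->
  hausdorff2 A <= x.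
Proof. by move=> h; apply: ge_ereal_sup => _ [delta d0 <-]; exact: h. Qed.

Lemma hausdorff2_set0 : hausdorff2 (set0 : set (R3 R)) = 0.
Proof.
apply/eqP; rewrite eq_le; apply/andP; split.
  apply: hausdorff2_le => delta d0.
  by rewrite hausdorff2_deltaE mu_ext0 // gauge0.
exact: le_trans (hausdorff2_delta_ge0 _ _) (hausdorff2_ge _ ltr01).
Qed.

Lemma hausdorff2_ge0 A : 0 <= hausdorff2 A.
Proof. exact: le_trans (hausdorff2_delta_ge0 _ _) (hausdorff2_ge _ ltr01). Qed.

Lemma le_hausdorff2 : {homo @hausdorff2 R : A B / A `<=` B >-> A <= B}.
Proof.
move=> A B AB; apply: hausdorff2_le => delta d0.
apply: le_trans (hausdorff2_ge B d0).
by rewrite hausdorff2_deltaE; apply: le_mu_ext.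
Qed.

Lemma hausdorff2_sigma_subadditive : sigma_subadditive (@hausdorff2 R).
Proof.
move=> F; apply: hausdorff2_le => delta d0.
apply: (@le_trans _ _ (\sum_(i <oo) hausdorff2_delta delta (F i))).
  by rewrite hausdorff2_deltaE; exact: mu_ext_sigma_subadditive.
by apply: lee_nneseries => [n _ _|n _]; [exact: hausdorff2_delta_ge0|exact: hausdorff2_ge].
Qed.

HB.instance Definition _ := isOuterMeasure.Build R (R3 R) (@hausdorff2 R)
  hausdorff2_set0 hausdorff2_ge0 le_hausdorff2 hausdorff2_sigma_subadditive.

End hausdorff_outer.

Section hausdorff_measure.
Context {R : realType}.
Implicit Types (A B X : set (R3 R)) (delta : R).
Local Open Scope ereal_scope.

(** A covering set of diameter at most [delta] < b - a cannot meet both [A] and [B], as [f] is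
    1-Lipschitz. Hence every cover of the union splits into a cover of each, with no diameter
    charged twice. *)
Lemma hausdorff2_delta_separated delta A B (f : R3 R -> R) (a b : R) :
  (delta < b - a)%R -> (0 <= delta)%R ->
  (forall x y, f x - f y <= enorm (x - y))%R ->
  (forall x, A x -> f x <= a)%R -> (forall x, B x -> b <= f x)%R ->
  hausdorff2_delta delta A + hausdorff2_delta delta B <=
  hausdorff2_delta delta (A `|` B).
Proof.
move=> dab delta0 lipf fA fB.
apply: le_ereal_inf_tmp => _ [U [d [ABU d0 dU ->]]].
pose restr C n := if `[< U n `&` C !=set0 >] then U n else set0.
pose dr C n := (if `[< U n `&` C !=set0 >] then d n else 0)%R.
have dr0 C n : (0 <= dr C n)%R by rewrite /dr; case: ifP => // _; case/andP: (d0 n).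
have s0 (e : R) : 0 <= (pi / 4 * e ^+ 2)%:E.
  by rewrite lee_fin mulr_ge0 ?sqr_ge0 // divr_ge0 ?pi_ge0.
have cov C : C `<=` \bigcup_n U n ->
    hausdorff2_delta delta C <= \sum_(0 <= n <oo) (pi / 4 * dr C n ^+ 2)%:E.
  move=> CU; apply: ereal_inf_lbound; exists (restr C), (dr C); split => //.
  - move=> x Cx; have [n _ Unx] := CU x Cx; exists n => //.
    by rewrite /restr; case: asboolP => // -[]; exists x.
  - by move=> n; rewrite /dr; case: ifP => _ //; rewrite lexx.
  - by move=> n; rewrite /restr /dr; case: ifP => _ //.
apply: (@le_trans _ _ (\sum_(0 <= n <oo) (pi / 4 * dr A n ^+ 2)%:E +
                       \sum_(0 <= n <oo) (pi / 4 * dr B n ^+ 2)%:E)).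
  by apply: leeD; apply: cov => x ?; apply: ABU; [left|right].
rewrite -nneseriesD //; apply: lee_nneseries => [n _ _|n _]; first exact: adde_ge0.
rewrite -EFinD lee_fin -mulrDr ler_wpM2l ?divr_ge0 ?pi_ge0 // /dr.
case: asboolP => [[x [Ux Ax]]|_]; case: asboolP => [[y [Uy By]]|_];
  rewrite ?expr0n/= ?addr0 ?add0r ?sqr_ge0 //.
have h1 := lipf y x; have h2 := dU n y x Uy Ux; have h3 := fA _ Ax.
have h4 := fB _ By; have /andP[_ h5] := d0 n; lra.
Qed.

Lemma hausdorff2_separated A B (f : R3 R -> R) (a b : R) : (a < b)%R ->
  (forall x y, f x - f y <= enorm (x - y))%R ->
  (forall x, A x -> f x <= a)%R -> (forall x, B x -> b <= f x)%R ->
  hausdorff2 A + hausdorff2 B <= hausdorff2 (A `|` B).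
Proof.
move=> ab lipf fA fB.
have HU0 := hausdorff2_ge0 (A `|` B).
have HB : hausdorff2 B <= hausdorff2 (A `|` B) by apply: le_hausdorff2; right.
have HA : hausdorff2 A <= hausdorff2 (A `|` B) by apply: le_hausdorff2; left.
have [Hoo|] := eqVneq (hausdorff2 (A `|` B)) +oo; first by rewrite Hoo leey.
move=> /eqP Hfin.
have finAB : hausdorff2 (A `|` B) \is a fin_num by rewrite ge0_fin_numE // ltey; apply/eqP.
have finB : hausdorff2 B \is a fin_num.
  by rewrite ge0_fin_numE ?hausdorff2_ge0 // (le_lt_trans HB) // ltey; apply/eqP.
rewrite -leeBrDr //; apply: hausdorff2_le => d1 d10.
have finA1 : hausdorff2_delta d1 A \is a fin_num.
  rewrite ge0_fin_numE ?hausdorff2_delta_ge0 //.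
  by apply: le_lt_trans (hausdorff2_ge A d10) _; rewrite (le_lt_trans HA) // ltey; apply/eqP.
rewrite leeBrDr // addeC -leeBrDr //; apply: hausdorff2_le => d2 d20.
rewrite leeBrDr //.
(* One scale below [d1], [d2] and the gap: the premeasure grows as the scale shrinks, so both
   summands are bounded by their values at scale [d]. *)
pose d := Num.min (Num.min d1 d2) ((b - a) / 2)%R.
have d0 : (0 < d)%R by rewrite !lt_min d10 d20 /= divr_gt0 ?subr_gt0.
have dlt : (d < b - a)%R.
  have : (d <= (b - a) / 2)%R by rewrite /d ge_min lexx orbT.
  by move: ab; lra.
apply: le_trans (hausdorff2_ge _ d0); rewrite addeC.
apply: le_trans (hausdorff2_delta_separated dlt (ltW d0) lipf fA fB).
by apply: leeD; apply: hausdorff2_delta_anti; rewrite /d !ge_min lexx ?orbT.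
Qed.

(* Caratheodory's argument: among the shells [a + 1/(n+2) <= f < a + 1/(n+1)] those of
   equal parity are at positive distance from each other, so that their measures add
   up and the series of all of them converges. *)
Lemma caratheodory_sublevel (f : R3 R -> R) (a : R) :
  (forall x y, f x - f y <= enorm (x - y))%R ->
  (@hausdorff2 R).-caratheodory [set x | (f x <= a)%R].
Proof.
move=> lipf; apply: le_caratheodory_measurable => X.
change (hausdorff2 (X `&` [set x | (f x <= a)%R]) + hausdorff2 (X `&` ~` [set x | (f x <= a)%R]) <= hausdorff2 X).
have HX0 := hausdorff2_ge0 X.
have [Hoo|Hfin] := eqVneq (hausdorff2 X) +oo; first by rewrite Hoo leey.
have finX : hausdorff2 X \is a fin_num by rewrite ge0_fin_numE // ltey.
have finS Y : Y `<=` X -> hausdorff2 Y \is a fin_num.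
  move=> YX; rewrite ge0_fin_numE ?hausdorff2_ge0 //.
  by rewrite (le_lt_trans (le_hausdorff2 YX)) // ltey.
pose e n : R := (n.+1%:R^-1)%R.
have e_lt m n : (m < n)%N -> (e n < e m)%R.
  by move=> mn; rewrite /e ltf_pV2 ?posrE ?ltr0n // ltr_nat.
have e_le m n : (m <= n)%N -> (e n <= e m)%R.
  by rewrite leq_eqVlt => /orP[/eqP->//|/e_lt/ltW].
pose Xn n := X `&` [set x | (a + e n <= f x)%R].
pose Rn n := X `&` [set x | (a + e n.+1 <= f x < a + e n)%R].
(* [b] is the parity. Two consecutive shells of equal parity are separated by the shell of the other
   parity between them, so the induction adds one of them at a time. *)
have sumR b n : \sum_(k < n) hausdorff2 (Rn (k.*2 + b).+1) <=
    hausdorff2 (Xn (n.*2 + b)%N).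
  elim: n => [|n IH]; first by rewrite big_ord0 hausdorff2_ge0.
  rewrite big_ord_recr /=; apply: le_trans (leeD IH (lexx _)) _.
  rewrite addeC.
  apply: (le_trans (@hausdorff2_separated _ _ f (a + e (n.*2 + b).+1)
    (a + e (n.*2 + b)%N) _ lipf _ _)).
  - by rewrite ltrD2l e_lt.
  - by move=> x [_ /andP[_ /ltW]].
  - by move=> x [_].
  apply: le_hausdorff2 => x [[Xx /andP[+ _]]|[Xx +]].
    by split => //=; rewrite doubleS.
  move=> /= h; split => //=; apply: le_trans h; rewrite lerD2l e_le //.
  by rewrite doubleS !addSn ltnW // ltnW.
have XnX n : hausdorff2 (Xn n) <= hausdorff2 X by apply: le_hausdorff2 => x [].
have sum2 n : \sum_(k < n) hausdorff2 (Rn k.+1) <= hausdorff2 X + hausdorff2 X.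
  apply: (@le_trans _ _ (\sum_(k < n.*2) hausdorff2 (Rn k.+1))).
    apply: (lee_sum_nneg_ord (fun k => hausdorff2 (Rn k.+1)) xpredT).
    - by move=> *; exact: hausdorff2_ge0.
    - by rewrite -addnn leq_addr.
  have -> : \sum_(k < n.*2) hausdorff2 (Rn k.+1) =
     \sum_(k < n) hausdorff2 (Rn (k.*2 + 0).+1) +
     \sum_(k < n) hausdorff2 (Rn (k.*2 + 1).+1).
    elim: n => [|n IH]; first by rewrite !big_ord0 adde0.
    rewrite doubleS !big_ord_recr /= IH addn0 addn1.
    by rewrite addeACA !addeA.
  by apply: leeD; apply: le_trans (sumR _ _) (XnX _).
have ser : \sum_(0 <= k <oo) hausdorff2 (Rn k.+1) < +oo.
  apply: (@le_lt_trans _ _ (hausdorff2 X + hausdorff2 X)); last first.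
    by rewrite -ge0_fin_numE ?adde_ge0 // fin_numD finX.
  apply: lime_le; first by apply: is_cvg_nneseries => *; exact: hausdorff2_ge0.
  by apply: nearW => n; rewrite big_mkord.
have tail := nneseries_tail_cvg ser (fun k _ => hausdorff2_ge0 _).
(* [Xn N.+1] lies at distance at least [e N.+1] from the sublevel set; what remains of [X] above the
   level [a] is a union of shells, whose total measure is bounded by the tail of a convergent
   series. *)
have key N : hausdorff2 (X `&` [set x | (f x <= a)%R]) +
    hausdorff2 (X `&` ~` [set x | (f x <= a)%R]) <=
    hausdorff2 X + \sum_(N <= k <oo) hausdorff2 (Rn k.+1).
  have le1 : hausdorff2 (X `&` ~` [set x | (f x <= a)%R]) <=
      hausdorff2 (Xn N.+1) + \sum_(N <= k <oo) hausdorff2 (Rn k.+1).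
    apply: (@le_trans _ _ (hausdorff2 (Xn N.+1 `|` \bigcup_k Rn (N + k).+1))).
      apply: le_hausdorff2 => x [Xx /= /negP]; rewrite -ltNge => afx.
      have [h|h] := leP (a + e N.+1)%R (f x); first by left.
      right; have : exists k, (a + e (N + k).+2 <= f x)%R.
        exists (Num.trunc (f x - a)^-1).
        rewrite -lerBrDl /e invf_ple ?posrE ?subr_gt0 ?ltr0n //.
        apply: le_trans (ltW (truncnS_gt _)) _.
        by rewrite ler_nat ltnS !leqW // leq_addl.
      move=> /ex_minnP [k hk hmin]; exists k => //; split => //=; rewrite hk /=.
      case: k hk hmin => [|k] hk hmin; first by rewrite addn0.
      rewrite ltNge; apply/negP; rewrite addnS => /hmin; by rewrite ltnn.
    apply: le_trans (outer_measureU2 _ _ _) _; apply: leeD => //.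
    apply: le_trans (hausdorff2_sigma_subadditive _) _.
    rewrite -(nneseries_addn) //=; first by under eq_eseriesr do rewrite addnC.
    by move=> *; exact: hausdorff2_ge0.
  apply: le_trans (leeD (lexx _) le1) _; rewrite addeA leeD2r //.
  apply: (le_trans (@hausdorff2_separated _ _ f a (a + e N.+1) _ lipf _ _)).
  - by rewrite ltrDl /e invr_gt0 ltr0n.
  - by move=> x [].
  - by move=> x [].
  by apply: le_hausdorff2 => x [[]|[]].
have cvgN : hausdorff2 X + \sum_(N <= k <oo) hausdorff2 (Rn k.+1) @[N --> \oo] -->
    hausdorff2 X.
  rewrite -[X in _ --> X]adde0; apply: cvgeD => //; last exact: cvg_cst.
  by rewrite fin_num_adde_defl.
by apply: (cvge_to_ge cvgN); apply: nearW => N; exact: key.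
Qed.

(** The identity from the Caratheodory sigma-algebra to the Borel one: it is measurable as soon as
    its three coordinates are, and these are 1-Lipschitz, so that [caratheodory_sublevel]
    applies. *)
Let id_cara (x : caratheodory_type (@hausdorff2 R)) : R3 R := x.

Let coord_cara (f : R3 R -> R) : (forall x y, f x - f y <= enorm (x - y))%R ->
  measurable_fun [set: caratheodory_type (@hausdorff2 R)]
    ((fun x => f x) : _ -> measurableTypeR R).
Proof.
move=> lipf; apply: (measurability _ (RGenOInfty.measurableE R)) => //.
move=> _ [_ [a ->] <-]; rewrite setTI.
suff -> : [eta f] @^-1` `]a, +oo[%classic = ~` [set x | (f x <= a)%R].
  apply: measurableC; exact: caratheodory_sublevel.
by apply/seteqP; split => x /=; rewrite in_itv /= andbT ltNge => /negP.
Qed.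

Let measurable_id_cara : measurable_fun setT id_cara.
Proof.
apply/measurable_fun_pairP; split; first (apply/measurable_fun_pairP; split).
- apply: (@coord_cara (fun x => x.1.1)) => x y.
  by apply: le_trans (coord1_le_enorm _); exact: ler_norm.
- apply: (@coord_cara (fun x => x.1.2)) => x y.
  by apply: le_trans (coord2_le_enorm _); exact: ler_norm.
- apply: (@coord_cara (fun x => x.2)) => x y.
  by apply: le_trans (coord3_le_enorm _); exact: ler_norm.
Qed.

Lemma measurable_caratheodory A : measurable A -> (@hausdorff2 R).-caratheodory A.
Proof. by move=> /(measurable_id_cara measurableT); rewrite setTI. Qed.

Lemma hausdorff2_semi_sigma_additive :
  semi_sigma_additive (@hausdorff2 R : set (R3 R) -> \bar R).
Proof.
move=> F mF tF mbF.
apply: (@caratheodory_measure_sigma_additive _ _ (@hausdorff2 R)) => //.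
- by move=> n; exact: measurable_caratheodory.
- exact: measurable_caratheodory.
Qed.

HB.instance Definition _ := isMeasure.Build _ (R3 R) R (@hausdorff2 R)
  hausdorff2_set0 hausdorff2_ge0 hausdorff2_semi_sigma_additive.

End hausdorff_measure.

(** * Planar Lebesgue measure and graphs *)

Notation R2 R := (measurableTypeR R * measurableTypeR R)%type.

Section translation.
Context {R : realType}.
Local Open Scope ereal_scope.
Local Notation lambda := (@lebesgue_measure R).

Definition area : set (R2 R) -> \bar R := lambda \x lambda.
HB.instance Definition _ := Measure.on area.

Lemma area_X (A B : set (measurableTypeR R)) : measurable A -> measurable B ->
  area (A `*` B) = lambda A * lambda B.
Proof. by move=> mA mB; exact: product_measure1E. Qed.

Let area_sigma_finite : sigma_finite setT area.
Proof.
have [F TF Foo] := sigma_finiteT lambda.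
have /sigma_finiteP[G [TG ndG Goo]] := sigma_finiteT lambda.
exists (fun n => G n `*` G n).
 rewrite -setXTT TG predeqE => -[x y]; split.
    move=> [/= [n _ Fnx] [k _ Gky]]; exists (maxn n k) => //; split.
    - by move: x Fnx; exact/subsetPset/ndG/leq_maxl.
    - by move: y Gky; exact/subsetPset/ndG/leq_maxr.
  by move=> [n _ []/= ? ?]; split; exists n.
move=> k; have [? ?] := Goo k.
split; first exact: measurableX.
by rewrite area_X// lte_mul_pinfty// ge0_fin_numE.
Qed.

HB.instance Definition _ := Measure_isSigmaFinite.Build _ _ _ area
  area_sigma_finite.

Lemma measurable_addr (t : measurableTypeR R) :
  measurable_fun [set: measurableTypeR R] (fun x => (x + t)%R : measurableTypeR R).
Proof. by apply: measurable_funD => //; exact: measurable_cst. Qed.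

Lemma lebesgue_measure_shift (t : R) (A : set (measurableTypeR R)) : measurable A ->
  lambda ((fun x => (x + t)%R) @^-1` A) = lambda A.
Proof.
move=> mA; have mt := measurable_addr t.
pose mu' : {measure set (measurableTypeR R) -> \bar R} :=
  pushforward lambda (fun x : measurableTypeR R => (x + t)%R : measurableTypeR R).
apply/esym; apply: (@lebesgue_measure_unique _ (mu' mt)) => //.
move=> _ [[a b] _ <-]; rewrite /mu' /= /pushforward.
have -> : (fun x : R => x + t)%R @^-1` `]a, b] = `](a - t)%R, (b - t)%R]%classic.
  by apply/seteqP; split => x /=; rewrite !in_itv /= ltrBlDr lerBrDr.
rewrite !lebesgue_measure_itv /= !lte_fin ltrD2r.
by case: ifP => // _; rewrite -!EFinB; congr (_%:E); ring.
Qed.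

Lemma measurable_shift (t : R2 R) :
  measurable_fun [set: R2 R] (fun x => (x + t)%R : R2 R).
Proof.
apply/measurable_fun_pairP; split.
- exact: (measurable_funD measurable_fst (measurable_cst _)).

- exact: (measurable_funD measurable_snd (measurable_cst _)).
Qed.

Lemma area_shift (t : R2 R) (A : set (R2 R)) : measurable A ->
  area ((fun x => (x + t)%R) @^-1` A) = area A.
Proof.
move=> mA; have mt := measurable_shift t.
pose mu' : {measure set (R2 R) -> \bar R} :=
  pushforward area (fun x : R2 R => (x + t)%R : R2 R).
apply/esym; apply: (@product_measure_unique _ _ _ _ _ lambda lambda (mu' mt)) => //.
move=> B C mB mC; rewrite /mu' /= /pushforward.
rewrite -(lebesgue_measure_shift t.1 mB) -(lebesgue_measure_shift t.2 mC).
rewrite -product_measure1E //.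
  by rewrite -[X in measurable X]setTI; exact: measurable_addr.
by rewrite -[X in measurable X]setTI; exact: measurable_addr.
Qed.

(** Fubini for nu x area. For y in the unit square Q = I x I, the fibre {x : x + y in A} has measure
    nu A; for y in A, the fibre {x : y - x in Q} is a translate of -Q = J x J. The two sets [E1] and
    [E2] made of these fibres have the same measure, because their sections over x differ by the
    translation by x. *)
Lemma translation_invariant_area (nu : {sigma_finite_measure set (R2 R) -> \bar R}) :
  (forall t (A : set (R2 R)), measurable A -> nu ((fun x => (x + t)%R) @^-1` A) = nu A) ->
  forall (A : set (R2 R)), measurable A -> nu A = nu ((`[(-1)%R, 0%R] : set (measurableTypeR R)) `*` `[(-1)%R, 0%R])%classic * area A.
Proof.
move=> nuT A mA.
pose I : set (measurableTypeR R) := `[0%R, 1%R]%classic.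
pose J : set (measurableTypeR R) := `[(-1)%R, 0%R]%classic.
have mQ : measurable (I `*` I) by apply: measurableX; exact: measurable_itv.
have mQ' : measurable (J `*` J) by apply: measurableX; exact: measurable_itv.
have flip (a b : R) : (-1 <= a - b <= 0)%R = (0 <= b - a <= 1)%R.
  by rewrite -(opprB b a) lerN2 oppr_le0 andbC.
have areaI : area (I `*` I) = 1.
  rewrite area_X ?lebesgue_measure_itv /=; try exact: measurable_itv.
  by rewrite lte01 sube0 !mule1.
pose T4 := (R2 R * R2 R)%type.
have mc11 : measurable_fun [set: T4] (fun z => z.1.1) by exact: measurableT_comp.
have mc12 : measurable_fun [set: T4] (fun z => z.1.2) by exact: measurableT_comp.
have mc21 : measurable_fun [set: T4] (fun z => z.2.1) by exact: measurableT_comp.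
have mc22 : measurable_fun [set: T4] (fun z => z.2.2) by exact: measurableT_comp.
have madd : measurable_fun [set: T4] (fun z => (z.1 + z.2)%R : R2 R).
  apply/measurable_fun_pairP; split.
  - exact: (measurable_funD mc11 mc21).
  - exact: (measurable_funD mc12 mc22).
have msub : measurable_fun [set: T4] (fun z => (z.2 - z.1)%R : R2 R).
  apply/measurable_fun_pairP; split.
  - exact: (measurable_funB mc21 mc11).
  - exact: (measurable_funB mc22 mc12).
pose E1 : set T4 := [set z | A (z.1 + z.2)%R /\ (I `*` I) z.2].
pose E2 : set T4 := [set z | A z.2 /\ (I `*` I) (z.2 - z.1)%R].
have mE1 : measurable E1.
  apply: measurableI; first by rewrite -[X in measurable X]setTI; exact: madd.
  by rewrite -[X in measurable X]setTI; exact: measurable_snd.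
have mE2 : measurable E2.
  apply: measurableI; first by rewrite -[X in measurable X]setTI; exact: measurable_snd.
  by rewrite -[X in measurable X]setTI; exact: msub.
have fub (E : set T4) : measurable E ->
    \int[nu]_x area (xsection E x) = \int[area]_y nu (ysection E y).
  move=> mE; have := @indic_fubini_tonelli _ _ _ _ _ nu area E mE.
  by rewrite indic_fubini_tonelli_FE // indic_fubini_tonelli_GE.
have e1 : \int[area]_y nu (ysection E1 y) = nu A.
  rewrite (eq_integral (fun y => nu A * (\1_(I `*` I) y)%:E)).
    rewrite ge0_integralZl //; last first.
    - by apply/measurable_EFinP; exact: measurable_indic.
    by rewrite (integral_indic _ _ mQ) // setIT -[RHS]mule1 -areaI.
  move=> y _; rewrite indicE; have [yI|yI] := boolP (y \in I `*` I).
    rewrite mule1 -(nuT y A mA); congr (nu _).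
    apply/seteqP; split => x /=; rewrite /ysection /= inE; first by case.
    by move=> ?; split => //; exact: set_mem.
  rewrite mule0; apply/eqP; rewrite -[X in _ == X](measure0 nu); apply/eqP; congr (nu _).
  apply/seteqP; split => x //=; rewrite /ysection /= inE => -[_ /=] h.
  by move/negP: yI; apply; rewrite inE.
have e2 : \int[area]_y nu (ysection E2 y) = nu (J `*` J) * area A.
  rewrite (eq_integral (fun y => nu (J `*` J) * (\1_A y)%:E)).
    rewrite ge0_integralZl //; last first.
    - by apply/measurable_EFinP; exact: measurable_indic.
    rewrite (integral_indic _ _ mA) // setIT; congr (_ * _).
  move=> y _; rewrite indicE; have [yA|yA] := boolP (y \in A).
    rewrite mule1 -(nuT (- y)%R _ mQ'); congr (nu _).
    have xy1 (x : R2 R) : (x - y)%R.1 = (x.1 - y.1)%R by [].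
    have xy2 (x : R2 R) : (x - y)%R.2 = (x.2 - y.2)%R by [].
    have yx1 (x : R2 R) : (y - x)%R.1 = (y.1 - x.1)%R by [].
    have yx2 (x : R2 R) : (y - x)%R.2 = (y.2 - x.2)%R by [].
    apply/seteqP; split => x /=;
      rewrite /ysection /= inE /E2 /setX /I /J /= !in_itv /= ?xy1 ?xy2 ?yx1 ?yx2.
      by move=> [_ [? ?]]; rewrite !flip.
    by rewrite !flip => -[? ?]; split; first exact: set_mem.
  rewrite mule0; apply/eqP; rewrite -[X in _ == X](measure0 nu); apply/eqP; congr (nu _).
  apply/seteqP; split => x //=; rewrite /ysection /= inE => -[h _] /=.
  by move/negP: yA; apply; rewrite inE.
rewrite -[LHS]e1 -[RHS]e2 -(fub _ mE1) -(fub _ mE2); apply: eq_integral => x _.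
have mx2 : measurable (xsection E2 x) by exact: measurable_xsection.
rewrite -(area_shift x mx2); congr (area _).
apply/seteqP; split => y /=; rewrite /xsection /= !inE /E1 /E2 /= !addrK (addrC x y).
  by [].
by [].
Qed.

End translation.

Section lipschitz_image.
Context {R : realType}.
Implicit Types (A S : set (R3 R)) (g : R3 R -> R3 R).

(** A cover at scale [delta / K], cut down to [S] where [g] is Lipschitz, is mapped to a cover of
    the image at scale [delta]; every squared diameter is multiplied by K^2. *)
Lemma hausdorff2_lipschitz g S (K : R) : 0 < K ->
  (forall x y, S x -> S y -> enorm (g x - g y) <= K * enorm (x - y)) ->
  (hausdorff2 (g @` S) <= (K ^+ 2)%:E * hausdorff2 S)%E.
Proof.
move=> K0 lipg; apply: hausdorff2_le => delta delta0.
have dK0 : 0 < delta / K by rewrite divr_gt0.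
have K20 : 0 < K ^+ 2 by rewrite exprn_gt0.
apply: (@le_trans _ _ ((K ^+ 2)%:E * hausdorff2_delta (delta / K) S)%E); last first.
  by rewrite lee_pmul2l //; exact: hausdorff2_ge.
rewrite -ereal_inf_pZl //; apply: le_ereal_inf_tmp => _ [_ [U [d [SU d0 dU ->]]] <-].
apply: ge_ereal_inf; exists (\sum_(0 <= n <oo) (pi / 4 * (K * d n) ^+ 2)%:E)%E.
  exists (fun n => g @` (U n `&` S)), (fun n => K * d n); split => //.
  - move=> _ [x Sx <-]; have [n _ Ux] := SU x Sx; exists n => //; exists x => //.
  - move=> n; have /andP[h1 h2] := d0 n; rewrite mulr_ge0 ?(ltW K0) //=.
    by rewrite mulrC -ler_pdivlMr.
  - move=> n _ _ [x [Ux Sx] <-] [y [Uy Sy] <-]; apply: le_trans (lipg _ _ Sx Sy) _.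
    by rewrite ler_pM2l //; exact: dU.
rewrite -nneseriesZl; last first.
  by move=> n _; rewrite lee_fin mulr_ge0 ?sqr_ge0 // divr_ge0 ?pi_ge0.
apply: lee_nneseries => [n _ _|n _].
  by rewrite lee_fin mulr_ge0 ?sqr_ge0 // divr_ge0 ?pi_ge0.
by rewrite -EFinM lee_fin exprMn mulrCA.
Qed.

Lemma hausdorff2_shift (t : R3 R) A :
  hausdorff2 ((fun x => x + t) @` A) = hausdorff2 A.
Proof.
have le (s : R3 R) (B : set (R3 R)) :
    (hausdorff2 ((fun x => (x + s)%R) @` B) <= hausdorff2 B)%E.
  rewrite -[leRHS]mul1e -[X in (X%:E * _)%E](expr1n R 2).
  apply: hausdorff2_lipschitz => // x y _ _; rewrite mul1r.
  by rewrite opprD addrACA subrr addr0.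
apply/eqP; rewrite eq_le le /=.
have {1}-> : A = (fun x => x - t) @` ((fun x => x + t) @` A); last exact: le.
rewrite image_comp (_ : _ \o _ = id) ?image_id //.
by apply/funext => x /=; rewrite addrK.
Qed.

End lipschitz_image.

Section graph_measure.
Context {R : realType}.
Variables (rho : R2 R -> measurableTypeR R) (mrho : measurable_fun setT rho).
Local Open Scope ereal_scope.

Definition graph : set (R3 R) := [set x | x.2 = rho x.1].

Lemma measurable_graph : measurable graph.
Proof.
have mf : measurable_fun [set: R3 R] (fun x => (x.2 - rho x.1)%R : measurableTypeR R).
  apply: measurable_funB; first exact: measurable_snd.
  by apply: (measurableT_comp mrho); exact: measurable_fst.
have -> : graph = [set: R3 R] `&` (fun x => (x.2 - rho x.1)%R) @^-1` [set 0%R].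
  apply/seteqP; split => x /=; rewrite /graph /=.
    by move=> ->; split => //; rewrite subrr.
  by move=> [_ /eqP]; rewrite subr_eq0 => /eqP.
by apply: mf => //; exact: measurable_set1.
Qed.

(** Surface measure of the graph seen on the base plane: the Hausdorff measure restricted to the
    graph and pushed forward by the projection. The proof argument carries the measurability on
    which the measure instance rests. *)
Definition graph_measure (_ : measurable_fun setT rho) (A : set (R2 R)) : \bar R :=
  hausdorff2 (graph `&` fst @^-1` A).

Let mu := graph_measure mrho.

Let mu0 : mu set0 = 0.
Proof. by rewrite /mu /graph_measure preimage_set0 setI0 hausdorff2_set0. Qed.

Let mu_ge0 A : 0 <= mu A. Proof. exact: hausdorff2_ge0. Qed.

Lemma measurable_graph_fst (A : set (R2 R)) : measurable A ->
  measurable (graph `&` fst @^-1` A).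
Proof.
move=> mA; apply: measurableI; first exact: measurable_graph.
by rewrite -[X in measurable X]setTI; exact: measurable_fst.
Qed.

Let mu_sigma_additive : semi_sigma_additive mu.
Proof.
move=> F mF tF mUF; rewrite /mu /graph_measure.
rewrite preimage_bigcup setI_bigcupr.
apply: (@hausdorff2_semi_sigma_additive R).
- by move=> n; exact: measurable_graph_fst.
- apply/trivIsetP => i j _ _ ij; rewrite setIACA setIid -preimage_setI.
  by move/trivIsetP : tF => /(_ i j) ->//; rewrite preimage_set0 setI0.
- rewrite -setI_bigcupr -preimage_bigcup; exact: measurable_graph_fst.
Qed.

HB.instance Definition _ := isMeasure.Build _ _ _ mu mu0 mu_ge0 mu_sigma_additive.

End graph_measure.

Section flat.
Context {R : realType}.

(** The Hausdorff measure of a horizontal plane, the intermediary between graphs and [area]. Finding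
    the factor between it and [area] would take the isodiametric inequality, whereas the positivity
    and finiteness of that factor follow from crude covers. *)
Definition flat : set (R2 R) -> \bar R :=
  @graph_measure R (fun=> 0) (measurable_cst (0 : measurableTypeR R)).
HB.instance Definition _ := Measure.on flat.

Let sq (a b s : R) : set (R2 R) := (`[a, a + s[%classic : set R) `*` `[b, b + s[%classic.

Let measurable_sq a b s : measurable (sq a b s).
Proof. by apply: measurableX; exact: measurable_itv. Qed.

(** A grid of N^2 squares of side s / N, each of diameter at most 2 s / N <= delta, costs N^2 (pi /
    4) (2 s / N)^2 = pi s^2 at every scale. *)
Lemma flat_sq_lty (a b s : R) : 0 < s -> (flat (sq a b s) < +oo)%E.
Proof.
move=> s0; apply: (@le_lt_trans _ _ (pi * s ^+ 2)%:E); last exact: ltry.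
apply: hausdorff2_le => delta delta0.
pose N := (Num.trunc (2 * s / delta)).+1.
have N0 : 0 < N%:R :> R by rewrite ltr0n.
pose e : R := s / N%:R.
have e0 : 0 < e by rewrite divr_gt0.
have Ne : N%:R * e = s by rewrite /e mulrC divfK // gt_eqF.
have ed : 2 * e <= delta.
  rewrite /e mulrA ler_pdivrMr // [leRHS]mulrC -ler_pdivrMr //.
  exact: ltW (truncnS_gt _).
pose V (n : nat) : set (R3 R) := [set x |
  [/\ a + (n %/ N)%:R * e <= x.1.1 <= a + (n %/ N).+1%:R * e,
      b + (n %% N)%:R * e <= x.1.2 <= b + (n %% N).+1%:R * e & x.2 = 0]].
pose U n := if (n < N * N)%N then V n else set0.
pose d (n : nat) : R := if (n < N * N)%N then 2 * e else 0.
apply: ge_ereal_inf; exists (\sum_(0 <= n <oo) (pi / 4 * d n ^+ 2)%:E)%E.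
  exists U, d; split => //.
  - move=> x [x0 [/= xa xb]].
    have key c (y : R) : `[c, c + s[%classic y ->
        exists2 i, (i < N)%N & c + i%:R * e <= y <= c + i.+1%:R * e.
      rewrite /= in_itv /= => /andP[cy yc].
      have y0 : 0 <= (y - c) / e by rewrite divr_ge0 ?subr_ge0 // ltW.
      exists (Num.trunc ((y - c) / e)).
        rewrite truncn_lt_nat // ltr_pdivrMr // Ne; lra.
      have /andP[h1 h2] := truncn_itv y0.
      move: h1 h2; rewrite ler_pdivlMr // ltr_pdivrMr //.
      by move=> h1 h2; apply/andP; split; lra.
    have [i iN hi] := key _ _ xa; have [j jN hj] := key _ _ xb.
    have lt : (i * N + j < N * N)%N.
      by rewrite -ltn_divLR // divnMDl // divn_small // addn0.
    exists (i * N + j)%N => //; rewrite /U lt /V /=.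
    by rewrite divnMDl // divn_small // addn0 modnMDl modn_small.
  - by move=> n; rewrite /d; case: ifP => _; rewrite ?lexx ?ed /= ?mulr_ge0 // ltW.
  - move=> n x y; rewrite /U /d; case: ifP => // _.
    move=> [/andP[a1 a2] /andP[a3 a4] a5] [/andP[b1 b2] /andP[b3 b4] b5].
    apply: le_trans (enorm_le_sum _) _.
    have -> : (x - y).2 = x.2 - y.2 by [].
    have -> : (x - y).1.1 = x.1.1 - y.1.1 by [].
    have -> : (x - y).1.2 = x.1.2 - y.1.2 by [].
    rewrite a5 b5 subrr normr0 addr0.
    have h1 : `|x.1.1 - y.1.1| <= e.
      by rewrite ler_norml; apply/andP; split; move: a1 a2 b1 b2; rewrite -natr1; lra.
    have h2 : `|x.1.2 - y.1.2| <= e.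
      by rewrite ler_norml; apply/andP; split; move: a3 a4 b3 b4; rewrite -natr1; lra.
    lra.
have p0 n : (0 <= (pi / 4 * d n ^+ 2)%:E :> \bar R)%E.
  by rewrite lee_fin mulr_ge0 ?sqr_ge0 // divr_ge0 ?pi_ge0.
rewrite (nneseries_split 0%N (N * N)%N) // add0n [X in (_ + X)%E]eseries0 ?adde0; last first.
  by move=> n nN _; rewrite /d ltnNge nN /= expr0n /= mulr0.
rewrite big_mkord (eq_bigr (fun=> (pi * e ^+ 2)%:E)); last first.
  by move=> n _; rewrite /d ltn_ord; congr (_%:E); field.
rewrite sumEFin sumr_const card_ord lee_fin -mulr_natl natrM -Ne.
by rewrite le_eqVlt; apply/orP; left; apply/eqP; ring.
Qed.

Lemma flat_shift (t : R2 R) (A : set (R2 R)) :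
  flat ((fun x => x + t)%R @^-1` A) = flat A.
Proof.
rewrite /flat /graph_measure -[RHS](hausdorff2_shift (- ((t, 0) : R3 R))); congr hausdorff2.
apply/seteqP; split => x /=; rewrite /graph /=.
  move=> [x0 Ax]; exists (x + (t, 0)); last by rewrite addrK.
  split; last exact: Ax.
  by have -> : (x + (t, 0))%R.2 = x.2 + 0 by []; rewrite x0 addr0.
move=> [y [y0 Ay] <-]; split.
  by have -> : (y - (t, 0))%R.2 = y.2 - 0 by []; rewrite y0 subr0.
by have -> : (y - (t, 0))%R.1 = y.1 - t by []; rewrite subrK.
Qed.

Let flat_sigma_finite : sigma_finite setT flat.
Proof.
exists (fun n => sq (- n.+1%:R) (- n.+1%:R) (2 * n.+1%:R)).
  rewrite predeqE => -[x y]; split => // _.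
  pose n := Num.trunc (`|x| + `|y|).
  have h : `|x| + `|y| < n.+1%:R by exact: truncnS_gt.
  have xle := ler_norm x; have yle := ler_norm y.
  have xge : - `|x| <= x by rewrite lerNl ler_normr lexx orbT.
  have yge : - `|y| <= y by rewrite lerNl ler_normr lexx orbT.
  have x0 := normr_ge0 x; have y0 := normr_ge0 y.
  by exists n => //; split; rewrite /= in_itv /=; apply/andP; split; lra.
move=> n; split; first exact: measurable_sq.
by apply: flat_sq_lty; rewrite mulr_gt0 ?ltr0n.
Qed.

HB.instance Definition _ := Measure_isSigmaFinite.Build _ _ _ flat
  flat_sigma_finite.

Let J : set (measurableTypeR R) := `[(-1)%R, 0%R]%classic.

(** A set of diameter d projects into a square of side 2 d centred at the projection of any of its
    points. The areas of these squares add up to at least 1, and (pi / 4) d^2 = (pi / 16) (4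
    d^2). *)
Lemma flat_square_gt0 : (0 < flat (J `*` J))%E.
Proof.
apply: (@lt_le_trans _ _ (pi / 16)%:E); first by rewrite lte_fin divr_gt0 ?pi_gt0.
apply: le_trans (hausdorff2_ge _ ltr01).
apply: le_ereal_inf_tmp => _ [U [d [JU d0 dU ->]]].
pose W n (p : R3 R) : set (R2 R) :=
  (`[p.1.1 - d n, p.1.1 + d n]%classic : set R) `*` `[p.1.2 - d n, p.1.2 + d n]%classic.
pose V n := if pselect (U n !=set0) is left h then W n (projT1 (cid h)) else set0.
have mW n p : measurable (W n p) by apply: measurableX; exact: measurable_itv.
have mV n : measurable (V n) by rewrite /V; case: pselect.
have JV : J `*` J `<=` \bigcup_n V n.
  move=> p Jp; have [|n _ Unp] := JU ((p, 0) : R3 R); first by split.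
  exists n => //; rewrite /V; case: pselect => [h|[]]; last by exists (p, 0).
  case: (cid h) => z Uz /=.
  have := dU n _ _ Unp Uz => dle.
  have := le_trans (coord1_le_enorm _) dle; have := le_trans (coord2_le_enorm _) dle.
  have -> : (((p, 0) : R3 R) - z).1.1 = p.1 - z.1.1 by [].
  have -> : (((p, 0) : R3 R) - z).1.2 = p.2 - z.1.2 by [].
  rewrite !ler_norml => /andP[h1 h2] /andP[h3 h4].
  by split; rewrite /= in_itv /=; apply/andP; split; lra.
have areaV n : (area (V n) <= (4 * d n ^+ 2)%:E)%E.
  have /andP[dn0 _] := d0 n.
  rewrite /V; case: pselect => [h|_]; last by rewrite measure0 lee_fin mulr_ge0 ?sqr_ge0.
  move: (projT1 (cid h)) => p; rewrite /W area_X; try exact: measurable_itv.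
  rewrite !lebesgue_measure_itv /= !lte_fin !ltrD2l.
  case: ifP => _; last by rewrite mule0 lee_fin mulr_ge0 ?sqr_ge0.
  change (((p.1.1 + d n - (p.1.1 - d n)) * (p.1.2 + d n - (p.1.2 - d n)))%:E <= (4 * d n ^+ 2)%:E)%E.
  rewrite lee_fin le_eqVlt; apply/orP; left; apply/eqP; ring.
have mJ : measurable (J `*` J) by apply: measurableX; exact: measurable_itv.
have areaJ : area (J `*` J) = 1%E.
  rewrite area_X; try exact: measurable_itv.
  rewrite !lebesgue_measure_itv /= lte_fin ltrN10.
  change (((0 - -1) * (0 - -1) : R)%:E = 1%:E)%E.
  by rewrite sub0r opprK mul1r.
have h1 : (1 <= \sum_(0 <= n <oo) area (V n))%E.
  by rewrite -areaJ; exact: (measure_sigma_subadditive area mV mJ JV).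
have h2 : (1%:E <= \sum_(0 <= n <oo) (4 * d n ^+ 2)%:E)%E.
  by apply: le_trans h1 _; apply: lee_nneseries => n _.
have -> : (\sum_(0 <= n <oo) (pi / 4 * d n ^+ 2)%:E =
    (pi / 16)%:E * \sum_(0 <= n <oo) (4 * d n ^+ 2)%:E)%E.
  rewrite -nneseriesZl; last by move=> n _; rewrite lee_fin mulr_ge0 ?sqr_ge0.
  by apply: eq_eseriesr => n _; rewrite -EFinM; congr (_%:E); field.
rewrite -[leLHS]mule1 lee_pmul2l // lte_fin divr_gt0 // pi_gt0 //.
Qed.

(* [flat] is translation invariant and finite and positive on squares. *)
Lemma flat_area : exists2 c : R, 0 < c &
  forall A : set (R2 R), measurable A -> flat A = (c%:E * area A)%E.
Proof.
have ltJ : (flat (J `*` J) < +oo)%E.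
  apply: le_lt_trans (@flat_sq_lty (-1) (-1) 2 _); last by [].
  apply: le_measure; rewrite ?inE; [|exact: measurable_sq|].
    by apply: measurableX; exact: measurable_itv.
  move=> x []; rewrite /J /= !in_itv /= => /andP[? ?] /andP[? ?].
  by split; rewrite /= in_itv /=; apply/andP; split; lra.
have finJ : flat (J `*` J) \is a fin_num by rewrite ge0_fin_numE.
exists (fine (flat (J `*` J))).
  by rewrite fine_gt0 // flat_square_gt0.
move=> A mA; rewrite fineK //.
by apply: translation_invariant_area => // t B _; exact: flat_shift.
Qed.

End flat.

Section graph_comparison.
Context {R : realType}.
Variables (rho : R2 R -> measurableTypeR R) (mrho : measurable_fun setT rho).

(** Vertical projection is 1-Lipschitz. *)
Lemma flat_le_graph (A : set (R2 R)) : (flat A <= graph_measure mrho A)%E.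
Proof.
rewrite /flat {1}/graph_measure.
pose g (x : R3 R) : R3 R := (x.1, 0).
rewrite (_ : _ `&` _ = g @` (graph rho `&` fst @^-1` A)); last first.
  apply/seteqP; split => x /=; rewrite /graph /=.
    by move=> [x0 Ax]; exists (x.1, rho x.1) => //; rewrite /g -x0; case: x {x0 Ax}.
  by move=> [y [_ Ay] <-].
rewrite -[leRHS]mul1e -[X in (X%:E * _)%E](expr1n R 2).
apply: hausdorff2_lipschitz => // x y _ _; rewrite mul1r; apply: enorm_le; first exact: enorm_ge0.
rewrite enorm_sqr.
have -> : (g x - g y).2 = 0 - 0 by [].
have -> : (g x - g y).1.1 = (x - y).1.1 by [].
have -> : (g x - g y).1.2 = (x - y).1.2 by [].
by rewrite subrr expr0n /= lerD2l sqr_ge0.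
Qed.

(** The lift of the plane to the graph is Lipschitz with constant sqrt (1 + L^2), which enters
    squared. *)
Lemma graph_le_flat (L : R) (A : set (R2 R)) :
  (forall a b : R2 R, (rho a - rho b) ^+ 2 <=
     L ^+ 2 * ((a.1 - b.1) ^+ 2 + (a.2 - b.2) ^+ 2)) ->
  (graph_measure mrho A <= (1 + L ^+ 2)%:E * flat A)%E.
Proof.
move=> lip.
pose g (x : R3 R) : R3 R := (x.1, rho x.1).
rewrite /flat {1}/graph_measure.
have -> : graph rho `&` fst @^-1` A = g @` (graph (fun=> 0) `&` fst @^-1` A).
  apply/seteqP; split => x /=; rewrite /graph /=.
    by move=> [x0 Ax]; exists (x.1, 0) => //; rewrite /g -x0; case: x {x0 Ax}.
  by move=> [y [_ Ay] <-].
have K0 : 0 < 1 + L ^+ 2 by rewrite ltr_pwDl ?sqr_ge0.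
have -> : 1 + L ^+ 2 = Num.sqrt (1 + L ^+ 2) ^+ 2 by rewrite sqr_sqrtr // ltW.
apply: hausdorff2_lipschitz; first by rewrite sqrtr_gt0.
move=> x y x0 y0; apply: enorm_le; first by rewrite mulr_ge0 ?enorm_ge0 ?sqrtr_ge0.
rewrite exprMn sqr_sqrtr ?(ltW K0) // !enorm_sqr.
have -> : (g x - g y).2 = rho x.1 - rho y.1 by [].
have -> : (g x - g y).1.1 = x.1.1 - y.1.1 by [].
have -> : (g x - g y).1.2 = x.1.2 - y.1.2 by [].
have := lip x.1 y.1; have := sqr_ge0 (x - y).2; have := sqr_ge0 L.
move: ((rho _ - _) ^+ 2) ((x - y).2 ^+ 2) ((_ - y.1.1) ^+ 2) ((_ - y.1.2) ^+ 2) => u s p q.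
nra.
Qed.

End graph_comparison.

(** * Estimates along vertical lines *)

Section borel.
Context {R : realType}.

Let box (q : rat * rat * rat * nat) : set (R3 R) :=
  ball (ratr q.1.1.1 : R) (q.2.+1%:R^-1) `*` ball (ratr q.1.1.2 : R) (q.2.+1%:R^-1)
    `*` ball (ratr q.1.2 : R) (q.2.+1%:R^-1).

Let measurable_box q : measurable (box q).
Proof. by apply: measurableX; [apply: measurableX|]; exact: measurable_ball. Qed.

(** The sigma-algebra is a product one, not defined from open sets. Cubes with rational centres and
    radii 1 / (n + 1) bridge the two: an open set is the union of those it contains, and [unpickle]
    enumerates them. *)
Lemma open_measurable3 (U : set (R3 R)) : open U -> measurable U.
Proof.
move=> oU.
pose F n := if @unpickle (rat * rat * rat * nat)%type n is Some q then
  if `[< box q `<=` U >] then box q else set0 else set0.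
have -> : U = \bigcup_n F n.
  apply/seteqP; split => x.
    move=> Ux; have /nbhs_ballP[e /= e0 eU] : nbhs x U by apply: open_nbhs_nbhs.
    have [n ne] : exists n, n.+1%:R^-1 < e / 2.
      exists (Num.trunc (2 / e)); by rewrite invf_plt ?posrE ?divr_gt0 ?ltr0n // invf_div truncnS_gt.
    have n0 : 0 < n.+1%:R^-1 :> R by rewrite invr_gt0 ltr0n.
    pose r : R := n.+1%:R^-1.
    have {}ne : r < e / 2 by [].
    have {}n0 : 0 < r by [].
    have dense (y : R) : exists q : rat, `|ratr q - y| < r.
      have yy : y - r < y + r by lra.
      have [q] := rat_in_itvoo yy.
      rewrite in_itv /= => /andP[h1 h2]; exists q.
      by rewrite ltr_norml; apply/andP; split; lra.
    have [q1 h1] := dense x.1.1; have [q2 h2] := dense x.1.2.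
    have [q3 h3] := dense x.2.
    have [k kE] : exists k, unpickle k = Some (q1, q2, q3, n).
      by exists (pickle (q1, q2, q3, n)); exact: pickleK.
    exists k; [exact: I|]; rewrite /F kE.
    case: asboolP => [_|]; first by rewrite /box /ball /=.
    move=> []; move=> y [[/= b1 b2] b3]; apply: eU.
    have half (a b c : R) : `|a - b| < r -> ball a r c -> ball b e c.
      rewrite /ball /= => ab ac.
      rewrite (_ : b - c = (b - a) + (a - c)); last by ring.
      by apply: le_lt_trans (ler_normD _ _) _; rewrite distrC in ab; lra.
    split; first split.
    - exact: half h1 b1.
    - exact: half h2 b2.
    - exact: half h3 b3.
  move=> [n _]; rewrite /F; case: unpickle => // q.
  by case: asboolP => // qU; exact: qU.
apply: bigcup_measurable => n _; rewrite /F; case: unpickle => // q.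
by case: ifP => // _; exact: measurable_box.
Qed.

Lemma closed_measurable3 (U : set (R3 R)) : closed U -> measurable U.
Proof. by move/closed_openC/open_measurable3/measurableC; rewrite setCK. Qed.

Lemma continuous_measurable3 (f : R3 R -> measurableTypeR R) : continuous f ->
  measurable_fun setT f.
Proof.
move=> /continuousP cf; apply: (measurability _ (RGenOpens.measurableE R)).
move=> _ [_ [a [b ->] <-]]; rewrite setTI; apply: open_measurable3.
by apply: cf; exact: interval_open.
Qed.

Lemma continuous_measurable1 (f : R -> measurableTypeR R) : continuous f ->
  measurable_fun [set: measurableTypeR R] f.
Proof. exact: continuous_measurable_fun. Qed.

End borel.

Section fubini.
Context {R : realType}.
Local Notation lambda := (@lebesgue_measure R).
Local Open Scope ereal_scope.

Lemma volume_fubini (f : R3 R -> \bar R) : measurable_fun setT f ->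
  (forall x, 0 <= f x) ->
  \int[volume]_x f x = \int[area]_a \int[lambda]_s f (a, s).
Proof. by move=> mf f0; exact: (@fubini_tonelli1 _ _ _ _ _ area lambda f mf f0). Qed.

Lemma volume_fubini_fiber (A : set (R2 R)) (B : R2 R -> set (measurableTypeR R))
    (f : R3 R -> \bar R) :
  measurable A -> measurable [set x : R3 R | A x.1 /\ B x.1 x.2] ->
  measurable_fun [set x : R3 R | A x.1 /\ B x.1 x.2] f ->
  (forall x, A x.1 -> B x.1 x.2 -> 0 <= f x) ->
  \int[volume]_(x in [set x | A x.1 /\ B x.1 x.2]) f x =
  \int[area]_(a in A) \int[lambda]_(s in B a) f (a, s).
Proof.
move=> mA mAB mf f0; rewrite integral_mkcond volume_fubini.
- rewrite [RHS]integral_mkcond; apply: eq_integral => a _; rewrite patchE.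
  case: ifPn => aA; last first.
    rewrite integral0_eq // => s _; rewrite patchE ifF //.
    by apply/negbTE; apply: contra aA; rewrite !inE => -[].
  rewrite [RHS]integral_mkcond; apply: eq_integral => s _; rewrite !patchE.
  have [sB|sB] := boolP (s \in B a).
    by rewrite ifT // inE; split => /=; exact: set_mem.
  rewrite ifF //; apply/negbTE; apply: contra sB; rewrite !inE => -[] //.
- exact/(measurable_restrictT _ mAB).
- move=> x; rewrite patchE; case: ifPn => // /set_mem[? ?]; exact: f0.
Qed.

(** Both sides become integrals over the plane: the surface measure is restricted to the graph and
    pushed forward by the projection, and a larger measure gives a larger integral. *)
Lemma area_le_graph_integral (c : R) (rho : R2 R -> measurableTypeR R)
    (mrho : measurable_fun setT rho) (A : set (R2 R)) (h : R2 R -> \bar R) :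
  (0 <= c)%R -> (forall S, measurable S -> c%:E * area S <= graph_measure mrho S) ->
  measurable A -> measurable_fun setT h -> (forall a, 0 <= h a) ->
  c%:E * \int[area]_(a in A) h a <=
  \int[hausdorff2]_(x in graph rho `&` fst @^-1` A) h x.1.
Proof.
move=> c0 le_c mA mh h0.
have mG := measurable_graph mrho.
have mfst : measurable_fun [set: R3 R] (fst : R3 R -> R2 R) by exact: measurable_fst.
have mA1 : measurable (fst @^-1` A : set (R3 R)).
  by rewrite -[X in measurable X]setTI; exact: mfst.
have mhA : measurable_fun A h by exact: measurable_funTS.
pose k : {nonneg R} := NngNum c0.
pose nu : {measure set (R2 R) -> \bar R} := mscale k area.
pose mH : {measure set (R3 R) -> \bar R} := mrestr hausdorff2 mG.
pose mu : {measure set (R2 R) -> \bar R} := pushforward mH (fst : R3 R -> R2 R).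
have -> : c%:E * \int[area]_(a in A) h a = \int[nu]_(a in A) h a.
  by rewrite ge0_integral_mscale.
apply: (@le_trans _ _ (\int[mu mfst]_(a in A) h a)).
  apply: ge0_le_measure_integral => // S mS.
  by rewrite /nu /mscale /= (le_trans (le_c _ mS)) // /graph_measure /pushforward /mH /mrestr setIC.
have mhf : measurable_fun [set: R3 R] (h \o fst) by exact: measurableT_comp.
rewrite (ge0_integral_pushforward mfst mH mA mhA (fun a _ => h0 a)).
have mHN : mH (~` graph rho) = 0.
  by rewrite /mH /= /mrestr setICl; exact: hausdorff2_set0.
rewrite (ge0_negligible_integral (measurableC mG) mA1 (measurable_funTS mhf)
  (fun x _ => h0 x.1) mHN).
rewrite setDE setCK [X in \int[mH]_(_ in X) _]setIC.
apply: ge0_le_measure_integral.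
- by move=> S mS; apply: le_hausdorff2; exact: subIsetl.
- exact: measurableI.
- by move=> x; exact: h0.
- exact: mhf.
Qed.

End fubini.

Section interval.
Context {R : realType}.

Lemma integral_itv_oo_cst (c a b : R) : a < b ->
  (\int[@lebesgue_measure R]_(t in `]a, b[) c%:E = (c * (b - a))%:E)%E.
Proof.
move=> ab; rewrite integral_cst //; transitivity (c%:E * (b - a)%:E)%E => //.
congr (_ * _)%E; transitivity (@lebesgue_measure R `]a, b[%classic) => //.
by rewrite lebesgue_measure_itv /= lte_fin ab -EFinB.
Qed.

End interval.

Section increment.
Context {R : realType}.
Local Notation lambda := (@lebesgue_measure R).

(* With [c] the mean slope of [f] on [r, s], expanding [0 <= (f' - c)^2] and
   integrating avoids Cauchy-Schwarz. *)
Lemma sq_increment_le (f f' : R -> R) (r s : R) : r < s ->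
  continuous f' -> (forall t, is_derive t (1 : R) f (f' t)) ->
  (((f s - f r) ^+ 2)%:E <=
   (s - r)%:E * \int[lambda]_(t in `[r, s]) (f' t ^+ 2)%:E)%E.
Proof.
move=> rs cf' df.
have sr0 : 0 < s - r by rewrite subr_gt0.
pose c := (f s - f r) / (s - r).
(* [g] is the tangent bound 2 c f' - c^2 <= f'^2; its primitive [G] grows by c^2 (s - r) on
   [r, s]. *)
pose g t := c *+ 2 * f' t - c ^+ 2.
pose G t := c *+ 2 * f t - c ^+ 2 * t.
have dG t : is_derive t (1 : R) G (g t).
  have dft := df t; rewrite /G /g; apply: is_deriveB.
  by apply: is_derive_eq; rewrite /GRing.scale /= mulr1.
have cg : continuous g.
  move=> t; apply: cvgB; last exact: cvg_cst.
  by apply: cvgM; [exact: cvg_cst|exact: cf'].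
have cG : continuous G.
  by move=> t; apply: differentiable_continuous; apply/derivable1_diffP; case: (dG t).
have intg : (\int[lambda]_(t in `[r, s]) (g t)%:E = (G s)%:E - (G r)%:E)%E.
  apply: continuous_FTC2 => //.
  - exact: continuous_subspaceT.
  - split.
    + by move=> t _; case: (dG t).
    + by apply: cvg_at_right_filter; exact: cG.
    + by apply: cvg_at_left_filter; exact: cG.
  - by move=> t _; rewrite derive1E; have [_ ->] := dG t.
have -> : ((f s - f r) ^+ 2)%:E = ((s - r)%:E * ((G s)%:E - (G r)%:E))%E.
  rewrite -EFinB -EFinM /G; congr (_%:E).
  have -> : f s - f r = c * (s - r) by rewrite /c divfK // gt_eqF.
  have -> : c *+ 2 * f s - c ^+ 2 * s - (c *+ 2 * f r - c ^+ 2 * r) =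
     c *+ 2 * (f s - f r) - c ^+ 2 * (s - r) by ring.
  have -> : f s - f r = c * (s - r) by rewrite /c divfK // gt_eqF.
  ring.
rewrite -intg lee_pmul2l ?lte_fin //.
have cont_int (h : R -> R) : continuous h ->
    lambda.-integrable `[r, s] (fun t => (h t)%:E).
  move=> ch; apply: continuous_compact_integrable; first exact: segment_compact.
  exact: continuous_subspaceT.
apply: le_integral; first exact: measurable_itv.
- exact: cont_int.
- apply: cont_int => t; rewrite (_ : (fun u => f' u ^+ 2) = (fun u => f' u * f' u)).
    by apply: cvgM; exact: cf'.
  by apply/funext => u; rewrite expr2.
move=> t _; rewrite lee_fin /g -subr_ge0.
have -> : f' t ^+ 2 - (c *+ 2 * f' t - c ^+ 2) = (f' t - c) ^+ 2 by ring.
exact: sqr_ge0.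
Qed.

End increment.

Section vertical.
Context {R : realType}.
Local Notation lambda := (@lebesgue_measure R).
Local Open Scope ereal_scope.
Variables (rho : R2 R -> measurableTypeR R) (mrho : measurable_fun setT rho).
Hypothesis rho_ge0 : forall a, (0 <= rho a)%R.

Definition base (tau : R) : set (R2 R) := [set a | (rho a < tau)%R].
Definition above (tau : R) : set (R3 R) := [set x | (rho x.1 < x.2 < tau)%R].

Lemma measurable_base tau : measurable (base tau).
Proof.
rewrite -[X in measurable X]setTI.
rewrite (_ : base tau = rho @^-1` `]-oo, tau[%classic); last first.
  by apply/seteqP; split => a /=; rewrite in_itv.
exact: mrho.
Qed.

Lemma measurable_gap : measurable_fun [set: R3 R] (fun x => (x.2 - rho x.1)%R : measurableTypeR R).
Proof.
apply: measurable_funB; first exact: measurable_snd.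
by apply: (measurableT_comp mrho); exact: measurable_fst.
Qed.

Lemma measurable_above tau : measurable (above tau).
Proof.
rewrite (_ : above tau = (setT `&` (fun x : R3 R => (x.2 - rho x.1)%R) @^-1` `]0%R, +oo[%classic) `&`
   (setT `&` (snd : R3 R -> measurableTypeR R) @^-1` `]-oo, tau[%classic)).
  apply: measurableI; first exact: measurable_gap.
  exact: measurable_snd.
apply/seteqP; split => x; rewrite /above /= !in_itv /= andbT subr_gt0.
  by move=> /andP[-> ->].
by move=> [[_ ->] [_ ->]].
Qed.

Lemma aboveE tau :
  above tau = [set x | base tau x.1 /\ (`]rho x.1, tau[%classic : set R) x.2].
Proof.
apply/seteqP; split => x; rewrite /above /base /= in_itv /=; last by case.
by move=> h; split => //; case/andP: h; exact: lt_trans.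
Qed.

Lemma above_fubini tau (f : R3 R -> \bar R) : measurable_fun (above tau) f ->
  (forall x, above tau x -> 0 <= f x) ->
  \int[volume]_(x in above tau) f x =
  \int[area]_(a in base tau) \int[lambda]_(s in `]rho a, tau[) f (a, s).
Proof.
move=> mf f0; rewrite {1}aboveE.
apply: (volume_fubini_fiber (B := fun a => `]rho a, tau[%classic : set (measurableTypeR R))).
- exact: measurable_base.
- by rewrite -aboveE; exact: measurable_above.
- by rewrite -aboveE.
- by move=> x h1 h2; apply: f0; rewrite aboveE.
Qed.

Lemma measurable_above_integral tau (f : R3 R -> \bar R) :
  measurable_fun (above tau) f -> (forall x, above tau x -> 0 <= f x) ->
  measurable_fun (base tau) (fun a => \int[lambda]_(s in `]rho a, tau[) f (a, s)).
Proof.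
move=> mf f0.
have m1 : measurable_fun setT (f \_ (above tau)).
  exact/(measurable_restrictT _ (measurable_above tau)).
have f1 x : 0 <= (f \_ (above tau)) x.
  by rewrite patchE; case: ifPn => // /set_mem; exact: f0.
apply/(measurable_fun_eqP (fun a => \int[lambda]_s (f \_ (above tau)) (a, s))); last first.
  apply: measurable_funTS.
  exact: (@measurable_fun_fubini_tonelli_F _ _ _ _ _ lambda _ m1 f1).
move=> a /set_mem ab; rewrite [RHS]integral_mkcond; apply: eq_integral => s _.
by rewrite !patchE; congr (if _ then _ else _).
Qed.

Variables (f f3 : R3 R -> R).
Hypothesis cf : continuous f.
Hypothesis cf3 : continuous f3.
Hypothesis df : forall (a : R2 R) (s : R), is_derive s (1%R : R) (fun t => f (a, t)) (f3 (a, s)).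

Let mf : measurable_fun [set: R3 R] (f : _ -> measurableTypeR R).
Proof. exact: continuous_measurable3. Qed.

Let mf3 : measurable_fun [set: R3 R] (f3 : _ -> measurableTypeR R).
Proof. exact: continuous_measurable3. Qed.

Let energy tau a := \int[lambda]_(t in `]rho a, tau[) (f3 (a, t) ^+ 2)%:E.

Let m_slice (g : R3 R -> R) a : measurable_fun [set: R3 R] (g : _ -> measurableTypeR R) ->
  measurable_fun [set: measurableTypeR R] (fun t => g (a, t) : measurableTypeR R).
Proof. by move=> mg; apply: measurableT_comp. Qed.

Lemma continuous_slice (a : R2 R) : continuous (fun t : R => (a, t) : R3 R).
Proof.
move=> t; apply/cvg_ballP => e e0; near=> u; split; first exact: ballxx.
by rewrite /=; near: u; apply/nbhs_ballP; exists e.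
Unshelve. all: by end_near. Qed.

Lemma vertical_increment tau a s : (rho a < s)%R -> (s < tau)%R ->
  ((f (a, s) - f (a, rho a)) ^+ 2)%:E <= (s - rho a)%:E * energy tau a.
Proof.
move=> as_ st.
have cfa : continuous (fun t => f3 (a, t)).
  by move=> t; apply: (@continuous_comp _ _ _ (fun t : R => (a, t) : R3 R) f3);
    [exact: continuous_slice|exact: cf3].
apply: le_trans (sq_increment_le as_ cfa (df a)) _.
rewrite lee_pmul2l ?lte_fin ?subr_gt0 //.
have m2 : measurable_fun [set: measurableTypeR R] (fun t => (f3 (a, t) ^+ 2)%:E).
  by apply/measurable_EFinP; apply: measurable_funX; exact: (m_slice a mf3).
rewrite -integral_itv_obnd_cbnd; last exact: measurable_funTS.
apply: ge0_subset_integral => //.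
- exact: measurable_funTS.
- by move=> t _; rewrite lee_fin sqr_ge0.
- by move=> t /=; rewrite !in_itv /= => /andP[-> h]; exact: le_lt_trans st.
Qed.

Lemma measurable_graph_point : measurable_fun [set: R2 R] (fun a => (a, rho a) : R3 R).
Proof. by apply: measurable_fun_pair => //; exact: measurable_id. Qed.

(** On each vertical line, f(a, t)^2 is at most 2 f(a, rho a)^2 plus 2 (t - rho a) times the energy
    of the line, by [vertical_increment]. After multiplication by [W] and integration, the bound [B]
    is spent only on the boundary values, while the energy is weighted by the bound [M] on the first
    moment of [W]. *)
Lemma hardy_smooth (tau B M : R) (W : R3 R -> R) :
  (0 < tau)%R -> (0 <= M)%R ->
  measurable_fun [set: R3 R] (W : _ -> measurableTypeR R) ->
  (forall x, 0 <= W x <= B)%R ->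
  (forall a, base tau a ->
     \int[lambda]_(t in `]rho a, tau[) ((t - rho a) * W (a, t))%:E <= M%:E) ->
  \int[volume]_(x in above tau) (f x ^+ 2 * W x)%:E <=
  (2 * B * tau)%:E * \int[area]_(a in base tau) (f (a, rho a) ^+ 2)%:E +
  (2 * M)%:E * \int[volume]_(x in above tau) (f3 x ^+ 2)%:E.
Proof.
move=> tau0 M0 mW WB WM.
have B0 : (0 <= B)%R by have /andP[h1 h2] := WB 0%R; exact: le_trans h2.
have W0 x : (0 <= W x)%R by have /andP[] := WB x.
have mY := measurable_above tau; have mD := measurable_base tau.
have m1 : measurable_fun [set: R3 R] (fun x => (f x ^+ 2 * W x)%:E).
  by apply/measurable_EFinP; apply: measurable_funM => //; exact: measurable_funX.
have m2 : measurable_fun [set: R3 R] (fun x => (f3 x ^+ 2)%:E).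
  by apply/measurable_EFinP; exact: measurable_funX.
have m3 : measurable_fun [set: R2 R] (fun a => (f (a, rho a) ^+ 2)%:E).
  apply/measurable_EFinP; apply: measurable_funX.
  exact: (measurableT_comp mf measurable_graph_point).
rewrite above_fubini; first last.
- by move=> x _; rewrite lee_fin mulr_ge0 ?sqr_ge0.
- exact: measurable_funTS.
rewrite above_fubini; first last.
- by move=> x _; rewrite lee_fin sqr_ge0.
- exact: measurable_funTS.
have m4 : measurable_fun (base tau) (energy tau).
  apply: (@measurable_above_integral tau (fun x => (f3 x ^+ 2)%:E)).
    exact: measurable_funTS.
  by move=> x _; rewrite lee_fin sqr_ge0.
have e0 a : 0 <= energy tau a.
  by apply: integral_ge0 => t _; rewrite lee_fin sqr_ge0.
have f0 a : 0 <= (f (a, rho a) ^+ 2)%:E by rewrite lee_fin sqr_ge0.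
rewrite -ge0_integralZl //; first last.
- by rewrite lee_fin !mulr_ge0 // ltW.
- exact: measurable_funTS.
rewrite -ge0_integralZl //; last by rewrite lee_fin mulr_ge0.
rewrite -ge0_integralD //; first last.
- exact: measurable_funeM.
- by move=> a _; apply: mule_ge0; [rewrite lee_fin mulr_ge0|exact: e0].
- by apply: measurable_funeM; exact: measurable_funTS.
- by move=> a _; apply: mule_ge0; [rewrite lee_fin !mulr_ge0 // ltW|exact: f0].
apply: ge0_le_integral => //.
- move=> a _; apply: integral_ge0 => t _; rewrite lee_fin mulr_ge0 ?sqr_ge0 //.
- apply: (@measurable_above_integral tau (fun x => (f x ^+ 2 * W x)%:E)).
    exact: measurable_funTS.
  by move=> x _; rewrite lee_fin mulr_ge0 ?sqr_ge0.
- apply: emeasurable_funD; apply: measurable_funeM => //; exact: measurable_funTS.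
move=> a aD.
have mt : measurable_fun [set: measurableTypeR R] (fun t => ((t - rho a) * W (a, t))%:E).
  apply/measurable_EFinP; apply: measurable_funM; last exact: (m_slice a mW).
  by apply: measurable_funB => //; exact: measurable_cst.
have t0 t : (`]rho a, tau[%classic : set R) t -> (0 <= t - rho a)%R.
  by rewrite /= in_itv /= subr_ge0 => /andP[/ltW].
apply: (@le_trans _ _ (\int[lambda]_(t in `]rho a, tau[)
   ((2 * B * f (a, rho a) ^+ 2)%:E + (2%:E * energy tau a) * ((t - rho a) * W (a, t))%:E))).
  apply: ge0_le_integral => //.
  - by move=> t _; rewrite lee_fin mulr_ge0 ?sqr_ge0.
  - apply: measurable_funTS; apply/measurable_EFinP; apply: measurable_funM.
      by apply: measurable_funX; exact: (m_slice a mf).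
    exact: (m_slice a mW).
  - apply: emeasurable_funD => //; apply: measurable_funeM; exact: measurable_funTS.
  move=> t /= tI; move: (tI); rewrite in_itv /= => /andP[rt tt].
  have h := vertical_increment rt tt.
  have h2 : (((f (a, t) - f (a, rho a)) ^+ 2) * W (a, t))%:E <=
      energy tau a * ((t - rho a) * W (a, t))%:E.
    rewrite EFinM [X in _ <= _ * X]EFinM muleA (muleC (energy _ _)).
    by apply: lee_pmul => //; rewrite lee_fin ?sqr_ge0.
  apply: (@le_trans _ _ ((2 * B * f (a, rho a) ^+ 2)%:E +
     2%:E * (((f (a, t) - f (a, rho a)) ^+ 2) * W (a, t))%:E)).
    rewrite -EFinM -EFinD lee_fin.
    have /andP[w0 wB] := WB (a, t).
    move: (f (a, t)) (f (a, rho a)) (W (a, t)) w0 wB => u v w w0 wB.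
    apply: (@le_trans _ _ ((2 * v ^+ 2 + 2 * (u - v) ^+ 2) * w)%R).
      rewrite ler_wpM2r //; have := sqr_ge0 (u - v *+ 2)%R; nra.
    rewrite mulrDl -mulrA lerD //; last by rewrite -mulrA.
    rewrite -[leRHS]mulrA ler_pM2l // mulrC ler_wpM2r ?sqr_ge0 //.
  by rewrite -muleA leeD2l // lee_pmul2l ?lte_fin.
rewrite ge0_integralD //; first last.
- apply: measurable_funeM; exact: measurable_funTS.
- by move=> t tI; rewrite mule_ge0 ?mule_ge0 // lee_fin mulr_ge0 ?t0.
- by move=> t _; rewrite lee_fin mulr_ge0 ?sqr_ge0 // mulr_ge0.
apply: leeD.
  rewrite (integral_itv_oo_cst _ aD) -EFinM lee_fin.
  by rewrite mulrAC ler_wpM2r ?sqr_ge0 // ler_wpM2l ?mulr_ge0 // gerBl.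
rewrite ge0_integralZl //; first last.
- by rewrite mule_ge0.
- by move=> t tI; rewrite lee_fin mulr_ge0 ?t0.
- exact: measurable_funTS.
rewrite (EFinM 2 M) -!muleA [X in _ <= 2%:E * X]muleC.
apply: lee_pmul => //; first by rewrite mule_ge0 // integral_ge0 // => t tI; rewrite lee_fin mulr_ge0 ?t0.
by apply: lee_pmul => //; [rewrite integral_ge0 // => t tI; rewrite lee_fin mulr_ge0 ?t0|exact: WM].
by move=> a _; exact: e0.
Qed.

End vertical.

Section comparison.
Context d (T : measurableType d) (R : realType) (mu : {measure set T -> \bar R}).
Implicit Types (D : set T) (p q r s : T -> R).
Local Open Scope ereal_scope.

(** No integrability is assumed: the integrals may be infinite, and nonnegativity makes the
    right-hand side additive. *)
Lemma le_integral2 D p q r (b c : R) : measurable D ->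
  (0 <= b)%R -> (0 <= c)%R ->
  measurable_fun D p -> measurable_fun D q -> measurable_fun D r ->
  (forall x, D x -> 0 <= p x)%R -> (forall x, D x -> 0 <= q x)%R ->
  (forall x, D x -> 0 <= r x)%R ->
  (forall x, D x -> p x <= b * q x + c * r x)%R ->
  \int[mu]_(x in D) (p x)%:E <=
  b%:E * \int[mu]_(x in D) (q x)%:E + c%:E * \int[mu]_(x in D) (r x)%:E.
Proof.
move=> mD b0 c0 mp mq mr p0 q0 r0 pqr.
have mbq : measurable_fun D (fun x => b%:E * (q x)%:E).
  by apply: measurable_funeM; exact/measurable_EFinP.
have mcr : measurable_fun D (fun x => c%:E * (r x)%:E).
  by apply: measurable_funeM; exact/measurable_EFinP.
have q1 x : D x -> 0 <= (q x)%:E by move=> Dx; rewrite lee_fin q0.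
have r1 x : D x -> 0 <= (r x)%:E by move=> Dx; rewrite lee_fin r0.
have bq0 x : D x -> 0 <= b%:E * (q x)%:E.
  by move=> Dx; apply: mule_ge0; [rewrite lee_fin|exact: q1].
have cr0 x : D x -> 0 <= c%:E * (r x)%:E.
  by move=> Dx; apply: mule_ge0; [rewrite lee_fin|exact: r1].
rewrite -(ge0_integralZl mu mD _ q1 (_ : 0 <= b%:E)) ?lee_fin //; last exact/measurable_EFinP.
rewrite -(ge0_integralZl mu mD _ r1 (_ : 0 <= c%:E)) ?lee_fin //; last exact/measurable_EFinP.
rewrite -(ge0_integralD mu mD bq0 mbq cr0 mcr).
apply: (ge0_le_integral mu mD).
- by move=> x Dx; rewrite lee_fin p0.
- exact/measurable_EFinP.
- exact: emeasurable_funD.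
- by move=> x Dx; rewrite -!EFinM -EFinD lee_fin pqr.
Qed.

Lemma le_integral1 D p q (b : R) : measurable D -> (0 <= b)%R ->
  measurable_fun D p -> measurable_fun D q ->
  (forall x, D x -> 0 <= p x)%R -> (forall x, D x -> 0 <= q x)%R ->
  (forall x, D x -> p x <= b * q x)%R ->
  \int[mu]_(x in D) (p x)%:E <= b%:E * \int[mu]_(x in D) (q x)%:E.
Proof.
move=> mD b0 mp mq p0 q0 pq.
have := @le_integral2 D p q (cst 0%R) b 0%R mD b0 (lexx _) mp mq (measurable_cst _) p0 q0.
rewrite mul0e adde0; apply => // x Dx; rewrite mul0r addr0; exact: pq.
Qed.

End comparison.

(** * Hardy's inequality and boundary values for limits of smooth functions *)

Section limits.
Context {R : realType}.
Local Notation lambda := (@lebesgue_measure R).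
Local Open Scope ereal_scope.
Variables (rho : R2 R -> measurableTypeR R) (mrho : measurable_fun setT rho).
Hypothesis rho_ge0 : forall a, (0 <= rho a)%R.
Variables (tau : R) (f f3 : nat -> R3 R -> R) (u d3 : R3 R -> R) (gamma : R2 R -> R).
Hypothesis tau0 : (0 < tau)%R.
Hypothesis cf : forall n, continuous (f n).
Hypothesis cf3 : forall n, continuous (f3 n).
Hypothesis df : forall n (a : R2 R) (s : R),
  is_derive s (1%R : R) (fun t => f n (a, t)) (f3 n (a, s)).
Hypothesis mu : measurable_fun (above rho tau) (u : _ -> measurableTypeR R).
Hypothesis md3 : measurable_fun (above rho tau) (d3 : _ -> measurableTypeR R).
Hypothesis mgamma : measurable_fun (base rho tau) (gamma : _ -> measurableTypeR R).
Hypothesis fu : \int[volume]_(x in above rho tau) ((f n x - u x) ^+ 2)%:E @[n --> \oo] --> 0.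
Hypothesis f3d3 : \int[volume]_(x in above rho tau) ((f3 n x - d3 x) ^+ 2)%:E @[n --> \oo] --> 0.
Hypothesis fgamma : \int[area]_(a in base rho tau) ((f n (a, rho a) - gamma a) ^+ 2)%:E
   @[n --> \oo] --> 0.

Let mY : measurable (above rho tau). Proof. exact: measurable_above. Qed.
Let mD : measurable (base rho tau). Proof. exact: measurable_base. Qed.

Let sq_split (x y : R) : (x ^+ 2 <= 2 * y ^+ 2 + 2 * (y - x) ^+ 2)%R.
Proof. by have := sqr_ge0 (2 * y - x)%R; nra. Qed.

Let mf n : measurable_fun (above rho tau) (f n : _ -> measurableTypeR R).
Proof. by apply: measurable_funTS; exact: continuous_measurable3. Qed.
Let mf3 n : measurable_fun (above rho tau) (f3 n : _ -> measurableTypeR R).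
Proof. by apply: measurable_funTS; exact: continuous_measurable3. Qed.
Let mfr n : measurable_fun setT (fun a => f n (a, rho a) : measurableTypeR R).
Proof.
have mfn : measurable_fun [set: R3 R] (f n : _ -> measurableTypeR R).
  exact: continuous_measurable3.
exact: (measurableT_comp mfn (measurable_graph_point mrho)).
Qed.

Let energy_le n : \int[volume]_(x in above rho tau) (f3 n x ^+ 2)%:E <=
  2%:E * \int[volume]_(x in above rho tau) (d3 x ^+ 2)%:E +
  2%:E * \int[volume]_(x in above rho tau) ((f3 n x - d3 x) ^+ 2)%:E.
Proof.
apply: le_integral2 => //; try by move=> *; exact: sqr_ge0.
- apply: measurable_funX; exact: mf3.
- exact: measurable_funX.
- apply: measurable_funX; apply: measurable_funB => //; exact: mf3.
- by move=> x _; have := sqr_ge0 (2 * d3 x - f3 n x)%R; nra.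
Qed.

(** When [u] is approximated by [f n], the bound [B] on the weight multiplies only quantities that
    tend to 0. The final constant is thus free of [B], which allows weights that blow up with a
    parameter. The factor 8 is 2 * 2 * 2: one 2 from splitting u^2, one from [hardy_smooth], one
    from [energy_le]. *)
Lemma hardy_limit (B M : R) (W : R3 R -> R) :
  (forall a, gamma a = 0)%R -> (0 <= M)%R ->
  measurable_fun [set: R3 R] (W : _ -> measurableTypeR R) ->
  (forall x, 0 <= W x <= B)%R ->
  (forall a, base rho tau a ->
     \int[lambda]_(t in `]rho a, tau[) ((t - rho a) * W (a, t))%:E <= M%:E) ->
  \int[volume]_(x in above rho tau) (u x ^+ 2 * W x)%:E <=
  (8 * M)%:E * \int[volume]_(x in above rho tau) (d3 x ^+ 2)%:E.
Proof.
move=> gamma0 M0 mW WB WM.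
have B0 : (0 <= B)%R by have /andP[h1 h2] := WB 0%R; exact: le_trans h2.
have W0 x : (0 <= W x)%R by have /andP[] := WB x.
have WB' x : (W x <= B)%R by have /andP[] := WB x.
have mWY : measurable_fun (above rho tau) (W : _ -> measurableTypeR R).
  exact: measurable_funTS.
set E := \int[volume]_(x in above rho tau) (d3 x ^+ 2)%:E.
pose e n := \int[volume]_(x in above rho tau) ((f n x - u x) ^+ 2)%:E.
pose e3 n := \int[volume]_(x in above rho tau) ((f3 n x - d3 x) ^+ 2)%:E.
pose eg n := \int[area]_(a in base rho tau) ((f n (a, rho a) - gamma a) ^+ 2)%:E.
have e0 n : 0 <= e n by apply: integral_ge0 => *; rewrite lee_fin sqr_ge0.
have e30 n : 0 <= e3 n by apply: integral_ge0 => *; rewrite lee_fin sqr_ge0.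
have eg0 n : 0 <= eg n by apply: integral_ge0 => *; rewrite lee_fin sqr_ge0.
have E0 : 0 <= E by apply: integral_ge0 => *; rewrite lee_fin sqr_ge0.
have key n : \int[volume]_(x in above rho tau) (u x ^+ 2 * W x)%:E <=
   (8 * M)%:E * E + ((4 * B * tau)%:E * eg n + (8 * M)%:E * e3 n + (2 * B)%:E * e n).
  have h1 : \int[volume]_(x in above rho tau) (u x ^+ 2 * W x)%:E <=
      2%:E * \int[volume]_(x in above rho tau) (f n x ^+ 2 * W x)%:E + (2 * B)%:E * e n.
    apply: le_integral2 => //.
    - by rewrite mulr_ge0.
    - by apply: measurable_funM => //; exact: measurable_funX.
    - by apply: measurable_funM => //; apply: measurable_funX; exact: mf.
    - by apply: measurable_funX; apply: measurable_funB => //; exact: mf.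
    - by move=> x _; rewrite mulr_ge0 ?sqr_ge0.
    - by move=> x _; rewrite mulr_ge0 ?sqr_ge0.
    - by move=> x _; rewrite sqr_ge0.
    move=> x _; apply: (@le_trans _ _ ((2 * f n x ^+ 2 + 2 * (f n x - u x) ^+ 2) * W x)%R).
      by rewrite ler_wpM2r.
    rewrite mulrDl -[X in (X + _ <= _)%R]mulrA lerD2l mulrAC.
    by rewrite ler_wpM2r ?sqr_ge0 // ler_pM2l.
  have h2 := hardy_smooth mrho rho_ge0 (@cf n) (@cf3 n) (@df n) tau0 M0 mW WB WM.
  have h3 := energy_le n; rewrite -/E -/(e3 n) in h3.
  have egE : \int[area]_(a in base rho tau) (f n (a, rho a) ^+ 2)%:E = eg n.
    by apply: eq_integral => a _; rewrite gamma0 subr0.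
  rewrite egE in h2.
  have h4 : 2%:E * \int[volume]_(x in above rho tau) (f n x ^+ 2 * W x)%:E <=
      (4 * B * tau)%:E * eg n + (8 * M)%:E * E + (8 * M)%:E * e3 n.
    apply: (@le_trans _ _ (2%:E * ((2 * B * tau)%:E * eg n + (2 * M)%:E * (2%:E * E + 2%:E * e3 n)))).
      rewrite lee_pmul2l // ?lte_fin //; apply: le_trans h2 _; apply: leeD => //.
      by apply: lee_wpmul2l => //; rewrite lee_fin mulr_ge0.
    have q1 : 0 <= (2 * B * tau)%:E * eg n.
      by apply: mule_ge0 => //; rewrite lee_fin !mulr_ge0 // ltW.
    have q2 : 0 <= 2%:E * E by apply: mule_ge0.
    have q3 : 0 <= 2%:E * e3 n by apply: mule_ge0.
    have q4 : 0 <= (2 * M)%:E by rewrite lee_fin mulr_ge0.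
    rewrite (ge0_muleDr _ q1 (mule_ge0 q4 (adde_ge0 q2 q3))) (ge0_muleDr _ q2 q3).
    rewrite (ge0_muleDr _ (mule_ge0 q4 q2) (mule_ge0 q4 q3)).
    rewrite !muleA -!EFinM addeA le_eqVlt; apply/orP; left; apply/eqP.
    by congr (_%:E * _ + _%:E * _ + _%:E * _); ring.
  apply: le_trans h1 _; apply: le_trans (leeD h4 (lexx _)) _.
  by rewrite (addeC ((4 * B * tau)%:E * _)) !addeA.
have lim0 : (8 * M)%:E * E + ((4 * B * tau)%:E * eg n + (8 * M)%:E * e3 n + (2 * B)%:E * e n)
   @[n --> \oo] --> (8 * M)%:E * E.
  rewrite -[X in _ --> X]adde0; apply: cvgeD.
  - by rewrite fin_num_adde_defl.
  - exact: cvg_cst.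
  have z : 0 = (4 * B * tau)%:E * 0 + (8 * M)%:E * 0 + (2 * B)%:E * 0 :> \bar R.
    by rewrite !mule0 !adde0.
  rewrite [X in _ --> X]z; apply: cvgeD; first by rewrite !mule0.
    by apply: cvgeD; [rewrite !mule0|exact: cvgeZl|exact: cvgeZl].
  exact: cvgeZl.
by apply: (cvge_to_ge lim0); apply: nearW => n; exact: key.
Qed.

Let slice_above (g : R3 R -> R) (a : R2 R) :
  measurable_fun (above rho tau) (g : _ -> measurableTypeR R) ->
  measurable_fun (`]rho a, tau[%classic : set (measurableTypeR R))
    (fun t => g (a, t) : measurableTypeR R).
Proof.
move=> mg.
have m1 : measurable_fun [set: R3 R] (g \_ (above rho tau) : _ -> measurableTypeR R).
  exact/(measurable_restrictT _ mY).
apply/(measurable_fun_eqP (fun t => (g \_ (above rho tau)) (a, t))).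
  by move=> t tI; rewrite patchE ifT.
apply: measurable_funTS.
exact: (measurableT_comp m1 (measurable_fun_pair (measurable_cst a) (@measurable_id _ _ _))).
Qed.

(** With [h] the excess of |gamma - a0| over [kappa], every point of the solid above [a] gives h a
    <= |gamma a - u|. Integrated over a vertical segment of length [T] and in the limit, this bounds
    the integral of h^2 by 6 T times the energy, and [T] is arbitrarily small. The gap between
    [sigma] and [tau] leaves room for the segment. *)
Lemma trace_limit (a0 kappa sigma : R) : (sigma < tau)%R -> (0 <= kappa)%R ->
  (forall x, above rho tau x -> `|u x - a0| <= kappa)%R ->
  \int[volume]_(x in above rho tau) (d3 x ^+ 2)%:E < +oo ->
  area (base rho sigma `&` [set a | (kappa < `|gamma a - a0|)%R]) = 0.
Proof.
move=> st kappa0 ukappa Elty.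
pose h a := Num.max (`|gamma a - a0| - kappa)%R 0%R.
have h0 a : (0 <= h a)%R by rewrite le_max lexx orbT.
have bst : base rho sigma `<=` base rho tau.
  by move=> a; rewrite /base /=; move/lt_trans; apply.
have mS := measurable_base mrho sigma.
have mg0 : measurable_fun (base rho tau) (fun a => `|gamma a - a0|%R : measurableTypeR R).
  apply: (measurableT_comp (@normr_measurable R setT)).
  by apply: measurable_funB => //; exact: measurable_cst.
have mh : measurable_fun (base rho tau) (h : _ -> measurableTypeR R).
  apply: (measurable_maxr (f := fun a => (`|gamma a - a0| - kappa)%R)); last exact: measurable_cst.
  by apply: measurable_funB => //; exact: measurable_cst.
have mhS : measurable_fun (base rho sigma) (h : _ -> measurableTypeR R).
  exact: measurable_funS mh.
set E := \int[volume]_(x in above rho tau) (d3 x ^+ 2)%:E in Elty *.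
have E0 : 0 <= E by apply: integral_ge0 => *; rewrite lee_fin sqr_ge0.
pose e n := \int[volume]_(x in above rho tau) ((f n x - u x) ^+ 2)%:E.
pose e3 n := \int[volume]_(x in above rho tau) ((f3 n x - d3 x) ^+ 2)%:E.
pose eg n := \int[area]_(a in base rho tau) ((f n (a, rho a) - gamma a) ^+ 2)%:E.
have e0 n : 0 <= e n by apply: integral_ge0 => *; rewrite lee_fin sqr_ge0.
have e30 n : 0 <= e3 n by apply: integral_ge0 => *; rewrite lee_fin sqr_ge0.
have eg0 n : 0 <= eg n by apply: integral_ge0 => *; rewrite lee_fin sqr_ge0.
set H := \int[area]_(a in base rho sigma) (h a ^+ 2)%:E.
have H0 : 0 <= H by apply: integral_ge0 => *; rewrite lee_fin sqr_ge0.
(* gamma a - u(a, t) is split into the error of the approximate trace, the increment of [f n] along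
   the segment and the error of [f n] at (a, t); hence the factors 3. *)
have fiber n T a : (0 < T)%R -> (sigma + T <= tau)%R -> base rho sigma a ->
    (T * h a ^+ 2)%:E <= (3 * T)%:E * ((f n (a, rho a) - gamma a) ^+ 2)%:E +
      (3 * T ^+ 2)%:E * \int[lambda]_(t in `]rho a, tau[) (f3 n (a, t) ^+ 2)%:E +
      3%:E * \int[lambda]_(t in `]rho a, tau[) ((f n (a, t) - u (a, t)) ^+ 2)%:E.
  move=> T0 sT aS.
  set En := \int[lambda]_(t in _) _; set Fn := \int[lambda]_(t in _) _.
  set c := ((f n (a, rho a) - gamma a) ^+ 2)%R.
  have c0 : (0 <= c)%R by exact: sqr_ge0.
  have En0 : 0 <= En by apply: integral_ge0 => *; rewrite lee_fin sqr_ge0.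
  have Fn0 : 0 <= Fn by apply: integral_ge0 => *; rewrite lee_fin sqr_ge0.
  have aT : (rho a < rho a + T)%R by rewrite ltrDl.
  have aTt : (rho a + T <= tau)%R by apply: le_trans sT; rewrite lerD2r ltW.
  pose I : set (measurableTypeR R) := `]rho a, (rho a + T)%R[%classic.
  have II : I `<=` `]rho a, tau[%classic.
    by move=> t; rewrite /I /= !in_itv /= => /andP[-> /lt_le_trans]; apply.
  have mF : measurable_fun (`]rho a, tau[%classic : set (measurableTypeR R))
      (fun t => ((f n (a, t) - u (a, t)) ^+ 2)%:E).
    apply/measurable_EFinP; apply: (@slice_above (fun x => (f n x - u x) ^+ 2)%R).
    by apply: measurable_funX; apply: measurable_funB => //; exact: mf.
  have mI : measurable I by exact: measurable_itv.
  have mFI : measurable_fun I (fun t => ((f n (a, t) - u (a, t)) ^+ 2)%:E).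
    exact: measurable_funS mF.
  have Ecst : 0 <= 3%:E * (c%:E + T%:E * En).
    by apply: mule_ge0 => //; apply: adde_ge0; rewrite ?lee_fin //; apply: mule_ge0; rewrite ?lee_fin // ltW.
  have intcst (y : \bar R) : \int[lambda]_(t in I) y = y * T%:E.
    rewrite integral_cst //; congr (_ * _); transitivity (lambda I) => //.
    by rewrite lebesgue_measure_itv /= lte_fin aT -EFinB addrC addKr.
  apply: (@le_trans _ _ (\int[lambda]_(t in I)
     (3%:E * (c%:E + T%:E * En) + 3%:E * ((f n (a, t) - u (a, t)) ^+ 2)%:E))).
    rewrite mulrC EFinM -(intcst (h a ^+ 2)%:E).
    apply: (ge0_le_integral lambda mI).
    - by move=> t _; rewrite lee_fin sqr_ge0.
    - exact: measurable_cst.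
    - by apply: emeasurable_funD; [exact: measurable_cst|exact: measurable_funeM].
    move=> t It; move: (It); rewrite /I /= in_itv /= => /andP[rt tT].
    have tt : (t < tau)%R by exact: lt_le_trans aTt.
    have inc := vertical_increment (@cf3 n) (@df n) rt tt.
    have inc' : ((f n (a, t) - f n (a, rho a)) ^+ 2)%:E <= T%:E * En.
      apply: le_trans inc _; apply: lee_wpmul2r => //.
      by rewrite lee_fin lerBlDl ltW.
    apply: (@le_trans _ _ (3%:E * (c%:E + ((f n (a, t) - f n (a, rho a)) ^+ 2)%:E) +
       3%:E * ((f n (a, t) - u (a, t)) ^+ 2)%:E)); last first.
      by apply: leeD => //; apply: lee_wpmul2l => //; exact: leeD.
    rewrite -!EFinM -!EFinD lee_fin.
    have hu : (h a <= `|gamma a - u (a, t)|)%R.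
      rewrite ge_max normr_ge0 andbT.
      have Yt : above rho tau (a, t) by rewrite /above /= rt.
      have := ukappa _ Yt; have := ler_normD (gamma a - u (a, t))%R (u (a, t) - a0)%R.
      by rewrite addrA subrK; lra.
    apply: (@le_trans _ _ (`|gamma a - u (a, t)| ^+ 2)%R).
      by rewrite ler_pXn2r ?nnegrE.
    rewrite real_normK ?num_real // /c.
    move: (f n (a, t)) (f n (a, rho a)) (gamma a) (u (a, t)) => p q r v.
    have s1 := sqr_ge0 ((q - r) - (p - q))%R; have s2 := sqr_ge0 ((q - r) + (p - v))%R.
    have s3 := sqr_ge0 ((p - q) + (p - v))%R.
    have s4 := sqr_ge0 ((q - r) + (p - q) + (p - v))%R.
    nra.
  rewrite (ge0_integralD lambda mI); last 4 first.
  - by [].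
  - exact: measurable_cst.
  - by move=> t _; apply: mule_ge0 => //; rewrite lee_fin sqr_ge0.
  - exact: measurable_funeM.
  apply: leeD.
    rewrite intcst muleC (ge0_muleDr (3%:E) (_ : 0 <= c%:E) (_ : 0 <= T%:E * En)); last 2 first.
    - by rewrite lee_fin.
    - by apply: mule_ge0; rewrite ?lee_fin // ltW.
    rewrite ge0_muleDr; last 2 first.
    - by rewrite -EFinM lee_fin mulr_ge0.
    - by apply: mule_ge0 => //; apply: mule_ge0; rewrite ?lee_fin // ltW.
    rewrite !muleA -!EFinM le_eqVlt; apply/orP; left; apply/eqP.
    by congr (_%:E + _%:E * _); ring.
  rewrite (ge0_integralZl lambda mI) //; last by move=> t _; rewrite lee_fin sqr_ge0.
  rewrite lee_pmul2l ?lte_fin //.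
  apply: (ge0_subset_integral lambda mI (measurable_itv `]rho a, tau[) mF) => //.
  by move=> t _; rewrite lee_fin sqr_ge0.
have level n T : (0 < T)%R -> (sigma + T <= tau)%R ->
    T%:E * H <= (6 * T ^+ 2)%:E * E + ((3 * T)%:E * eg n + (6 * T ^+ 2)%:E * e3 n + 3%:E * e n).
  move=> T0 sT.
  pose En a := \int[lambda]_(t in `]rho a, tau[) (f3 n (a, t) ^+ 2)%:E.
  pose Fn a := \int[lambda]_(t in `]rho a, tau[) ((f n (a, t) - u (a, t)) ^+ 2)%:E.
  pose Gn a := ((f n (a, rho a) - gamma a) ^+ 2)%:E.
  have En0 a : 0 <= En a by apply: integral_ge0 => *; rewrite lee_fin sqr_ge0.
  have Fn0 a : 0 <= Fn a by apply: integral_ge0 => *; rewrite lee_fin sqr_ge0.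
  have Gn0 a : 0 <= Gn a by rewrite lee_fin sqr_ge0.
  have m3 : measurable_fun (above rho tau) (fun x => (f3 n x ^+ 2)%:E).
    by apply/measurable_EFinP; apply: measurable_funX; exact: mf3.
  have mu2 : measurable_fun (above rho tau) (fun x => ((f n x - u x) ^+ 2)%:E).
    by apply/measurable_EFinP; apply: measurable_funX; apply: measurable_funB => //; exact: mf.
  have mEn : measurable_fun (base rho tau) En.
    apply: (@measurable_above_integral _ _ mrho tau (fun x => (f3 n x ^+ 2)%:E)) => //.
    by move=> x _; rewrite lee_fin sqr_ge0.
  have mFn : measurable_fun (base rho tau) Fn.
    apply: (@measurable_above_integral _ _ mrho tau (fun x => ((f n x - u x) ^+ 2)%:E)) => //.
    by move=> x _; rewrite lee_fin sqr_ge0.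
  have mGn : measurable_fun (base rho tau) Gn.
    apply/measurable_EFinP; apply: measurable_funX; apply: measurable_funB => //.
    by apply: measurable_funTS; exact: mfr.
  have c1 : 0 <= (3 * T)%:E by rewrite lee_fin mulr_ge0 // ltW.
  have c2 : 0 <= (3 * T ^+ 2)%:E by rewrite lee_fin mulr_ge0 // sqr_ge0.
  have c3 : 0 <= 3%:E :> \bar R by [].
  have eEn : \int[area]_(a in base rho tau) En a = \int[volume]_(x in above rho tau) (f3 n x ^+ 2)%:E.
    by rewrite (above_fubini mrho) // => x _; rewrite lee_fin sqr_ge0.
  have eFn : \int[area]_(a in base rho tau) Fn a = e n.
    by rewrite /e (above_fubini mrho) // => x _; rewrite lee_fin sqr_ge0.
  apply: (@le_trans _ _ (\int[area]_(a in base rho tau)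
    ((3 * T)%:E * Gn a + (3 * T ^+ 2)%:E * En a + 3%:E * Fn a))).
    rewrite -(ge0_integralZl area mS) ?lee_fin //; last 3 first.
    - exact/measurable_EFinP/measurable_funX.
    - by move=> a _; rewrite lee_fin sqr_ge0.
    - exact: ltW.
    apply: (@le_trans _ _ (\int[area]_(a in base rho sigma)
      ((3 * T)%:E * Gn a + (3 * T ^+ 2)%:E * En a + 3%:E * Fn a))).
      apply: (ge0_le_integral area mS).
      - by move=> a _; rewrite -EFinM lee_fin mulr_ge0 ?sqr_ge0 // ltW.
      - apply: measurable_funeM; exact/measurable_EFinP/measurable_funX.
      - apply: emeasurable_funD; [apply: emeasurable_funD|]; apply: measurable_funeM;
          exact: (measurable_funS mD bst).
      - by move=> a aS; rewrite -EFinM; exact: fiber.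
    apply: ge0_subset_integral => //.
    - apply: emeasurable_funD; [apply: emeasurable_funD|]; exact: measurable_funeM.
    - by move=> a _; rewrite !adde_ge0 // mule_ge0.
  rewrite (ge0_integralD area mD); last 4 first.
  - by move=> a _; rewrite adde_ge0 // mule_ge0.
  - by apply: emeasurable_funD; exact: measurable_funeM.
  - by move=> a _; rewrite mule_ge0.
  - exact: measurable_funeM.
  rewrite (ge0_integralD area mD); last 4 first.
  - by move=> a _; rewrite mule_ge0.
  - exact: measurable_funeM.
  - by move=> a _; rewrite mule_ge0.
  - exact: measurable_funeM.
  rewrite !(ge0_integralZl area mD) // eEn eFn -/(eg n).
  have q2 : 0 <= 2%:E * E by apply: mule_ge0.
  have q3 : 0 <= 2%:E * e3 n by apply: mule_ge0.
  apply: (@le_trans _ _ ((3 * T)%:E * eg n + (3 * T ^+ 2)%:E * (2%:E * E + 2%:E * e3 n) + 3%:E * e n)).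
    by rewrite leeD2r // leeD2l // lee_wpmul2l // energy_le.
  rewrite (ge0_muleDr _ q2 q3) !muleA -!EFinM le_eqVlt; apply/orP; left; apply/eqP.
  rewrite !addeA (addeC ((3 * T)%:E * _)).
  by congr (_%:E * _ + _ + _%:E * _ + _); ring.
have levelH T : (0 < T)%R -> (sigma + T <= tau)%R -> T%:E * H <= (6 * T ^+ 2)%:E * E.
  move=> T0 sT.
  have lim0 : (6 * T ^+ 2)%:E * E + ((3 * T)%:E * eg n + (6 * T ^+ 2)%:E * e3 n + 3%:E * e n)
      @[n --> \oo] --> (6 * T ^+ 2)%:E * E.
    rewrite -[X in _ --> X]adde0; apply: cvgeD.
    - by rewrite fin_num_adde_defl.
    - exact: cvg_cst.
    have z : 0 = (3 * T)%:E * 0 + (6 * T ^+ 2)%:E * 0 + 3%:E * 0 :> \bar R.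
      by rewrite !mule0 !adde0.
    rewrite [X in _ --> X]z; apply: cvgeD; first by rewrite !mule0.
      by apply: cvgeD; [rewrite !mule0|exact: cvgeZl|exact: cvgeZl].
    exact: cvgeZl.
  by apply: (cvge_to_ge lim0); apply: nearW => n; exact: level.
have Efin : E \is a fin_num by rewrite ge0_fin_numE.
have Heq0 : H = 0.
  have Hle T : (0 < T)%R -> (sigma + T <= tau)%R -> H <= (6 * T)%:E * E.
    move=> T0 sT; rewrite -(@lee_pmul2l _ T%:E) ?lte_fin //.
    apply: le_trans (levelH _ T0 sT) _; rewrite muleA -EFinM.
    by rewrite (_ : (6 * T ^+ 2 = T * (6 * T))%R) //; ring.
  apply/eqP; rewrite eq_le H0 andbT; apply/lee_addgt0Pr => d d0; rewrite add0e.
  pose T := Num.min (tau - sigma)%R (d / (6 * (fine E + 1)))%R.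
  have fE0 : (0 <= fine E)%R by exact: fine_ge0.
  have T0 : (0 < T)%R.
    by rewrite lt_min subr_gt0 st /= divr_gt0 // mulr_gt0 // ltr_wpDl.
  have sT : (sigma + T <= tau)%R by rewrite -lerBrDl ge_min lexx.
  apply: le_trans (Hle _ T0 sT) _; rewrite -(fineK Efin) -EFinM lee_fin.
  have Td : (T <= d / (6 * (fine E + 1)))%R by rewrite ge_min lexx orbT.
  move: Td; rewrite ler_pdivlMr; last by rewrite mulr_gt0 // ltr_wpDl.
  apply: le_trans; rewrite [leLHS](_ : _ = T * (6 * fine E))%R; last by ring.
  by rewrite ler_pM2l // ler_pM2l // lerDl.
have mh2 : measurable_fun (base rho sigma) (fun a => (h a ^+ 2)%:E).
  exact/measurable_EFinP/measurable_funX.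
have habs : \int[area]_(a in base rho sigma) `|(h a ^+ 2)%:E| = 0.
  rewrite -Heq0; apply: eq_integral => a _.
  by rewrite gee0_abs // lee_fin sqr_ge0.
have hae := (ae_eq_integral_abs area mS mh2).1 habs.
apply: measure_negligible.
  have -> : base rho sigma `&` [set a | (kappa < `|gamma a - a0|)%R] =
     base rho sigma `&` (fun a => `|gamma a - a0|%R) @^-1` `]kappa, +oo[%classic.
    by apply/seteqP; split => a [? /=]; rewrite ?in_itv /= ?andbT => ?; split => //=; rewrite in_itv /= andbT.
  by apply: (measurable_funS mD bst mg0) => //; exact: measurable_itv.
apply: negligibleS hae => a [aS /= ga] /(_ aS) /= [] /eqP.
rewrite sqrf_eq0 => /eqP ha.
have : (`|gamma a - a0| - kappa <= h a)%R by rewrite le_max lexx.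
by rewrite ha subr_le0 leNgt ga.
Qed.

End limits.

(** * Test functions *)

Section directional.
Context {R : realType}.
Implicit Types (f g : R3 R -> R) (x v : R3 R).

(** Restriction to the line through [x] in direction [v] reduces directional derivatives to one real
    variable, where the chain rule and the derivatives of inverse and square root apply. *)
Lemma is_derive_line f x v (d : R) :
  is_derive (0 : R) (1 : R) (fun t : R => f (t *: v + x)) d -> is_derive x v f d.
Proof.
move=> [dv de].
have E : (fun h : R => h^-1 *: ((f \o shift x) (h *: v) - f x)) =
         (fun h : R => h^-1 *: (((fun t : R => f (t *: v + x)) \o shift 0) (h *: (1 : R)) -
            f (0 *: v + x))).
  apply/funext => h /=; have -> : h *: (1 : R) = h by exact: mulr1.
  by rewrite addr0 scale0r add0r.
split; first by rewrite /derivable E.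
by rewrite /derive E.
Qed.

Lemma is_derive_line_inv f x v (d : R) : is_derive x v f d ->
  is_derive (0 : R) (1 : R) (fun t : R => f (t *: v + x)) d.
Proof.
move=> [dv de].
have E : (fun h : R => h^-1 *: (((fun t : R => f (t *: v + x)) \o shift 0) (h *: (1 : R)) -
            f (0 *: v + x))) = (fun h : R => h^-1 *: ((f \o shift x) (h *: v) - f x)).
  apply/funext => h /=; have -> : h *: (1 : R) = h by exact: mulr1.
  by rewrite addr0 scale0r add0r.
split; first by rewrite /derivable E.
by rewrite /derive E.
Qed.

Lemma is_derive_comp_dir (g : R -> R) f x v (dg df : R) :
  is_derive (f x) (1 : R) g dg -> is_derive x v f df ->
  is_derive x v (fun y => g (f y)) (dg * df).
Proof.
move=> hg /is_derive_line_inv hf; apply: is_derive_line.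
apply: (@is_derive1_comp _ g (fun t : R => f (t *: v + x))) => //.
by rewrite scale0r add0r.
Qed.

Lemma is_derive_mul_dir f g x v (df dg : R) :
  is_derive x v f df -> is_derive x v g dg ->
  is_derive x v (fun y => f y * g y) (f x * dg + g x * df).
Proof. by move=> hf hg; apply: is_deriveM. Qed.

Lemma is_derive_add_dir f g x v (df dg : R) :
  is_derive x v f df -> is_derive x v g dg ->
  is_derive x v (fun y => f y + g y) (df + dg).
Proof. by move=> hf hg; apply: is_deriveD. Qed.

Lemma is_derive_inv_dir f x v (df : R) : f x != 0 -> is_derive x v f df ->
  is_derive x v (fun y => (f y)^-1) (- df * (f x)^-1 * (f x)^-1).
Proof.
move=> fx0 hf.
have hg : is_derive (f x) (1 : R) (fun y : R => y^-1) (- (f x)^-1 * (f x)^-1).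
  have hid : is_derive (f x) (1 : R) (fun y : R => y) (1 : R) by exact: is_derive_id.
  apply: is_derive_eq (is_deriveV fx0 hid) _.
  by rewrite /GRing.scale /= mulr1 mulNr -expr2 exprVn.
apply: is_derive_eq (is_derive_comp_dir hg hf) _; ring.
Qed.

Lemma is_derive_sqrt_dir f x v (df : R) : 0 < f x -> is_derive x v f df ->
  is_derive x v (fun y => Num.sqrt (f y)) ((2 * Num.sqrt (f x))^-1 * df).
Proof. by move=> fx0 hf; apply: is_derive_comp_dir => //; exact: is_derive1_sqrt. Qed.

Lemma is_derive_c1 x v : is_derive x v (fun y => y.1.1 : R) v.1.1.
Proof.
apply: is_derive_line => /=.
have -> : (fun t : R => (t *: v + x).1.1) = (fun t : R => t * v.1.1 + x.1.1) by [].
by apply: is_derive_eq; rewrite /GRing.scale /= !(mulr0, mulr1, add0r, addr0).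
Qed.

Lemma is_derive_c2 x v : is_derive x v (fun y => y.1.2 : R) v.1.2.
Proof.
apply: is_derive_line => /=.
have -> : (fun t : R => (t *: v + x).1.2) = (fun t : R => t * v.1.2 + x.1.2) by [].
by apply: is_derive_eq; rewrite /GRing.scale /= !(mulr0, mulr1, add0r, addr0).
Qed.

Lemma is_derive_c3 x v : is_derive x v (fun y => y.2 : R) v.2.
Proof.
apply: is_derive_line => /=.
have -> : (fun t : R => (t *: v + x).2) = (fun t : R => t * v.2 + x.2) by [].
by apply: is_derive_eq; rewrite /GRing.scale /= !(mulr0, mulr1, add0r, addr0).
Qed.

End directional.

(** * Smooth functions built from exp(-1/t) *)

Section flat_exponential.
Context {R : realType}.
Implicit Types t : R.

(** The classical flat function exp(-1/t) together with its multiples by t^-n: derivatives of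
    members are linear combinations of members, which suits the inductive class [sm] below. *)
Definition flatexp (n : nat) t : R := if 0 < t then t^-1 ^+ n * expR (- t^-1) else 0.

Lemma flatexp_ge0 n t : 0 <= flatexp n t.
Proof.
by rewrite /flatexp; case: ifP => // t0; rewrite mulr_ge0 ?expR_ge0 // exprn_ge0 // invr_ge0 ltW.
Qed.

Lemma flatexp_gt0 n t : 0 < t -> 0 < flatexp n t.
Proof. by move=> t0; rewrite /flatexp t0 mulr_gt0 ?expR_gt0 // exprn_gt0 // invr_gt0. Qed.

Lemma flatexp_le0 n t : t <= 0 -> flatexp n t = 0.
Proof. by rewrite /flatexp leNgt => /negbTE ->. Qed.

(** From z <= exp z at z = y / (n + 1), raised to the power n; dividing by n + 1 rather than n
    covers n = 0. *)
Lemma pow_mul_expRN_le n (y : R) : 0 <= y -> y ^+ n * expR (- y) <= n.+1%:R ^+ n.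
Proof.
move=> y0.
have n0 : 0 < n.+1%:R :> R by rewrite ltr0n.
have h : (y / n.+1%:R) ^+ n <= expR y.
  apply: (@le_trans _ _ (expR (y / n.+1%:R) ^+ n)).
    rewrite lerXn2r ?nnegrE ?expR_ge0 ?divr_ge0 //.
    by apply: le_trans (expR_ge1Dx _); rewrite lerDr.
  rewrite -expRM_natl ler_expR mulrA ler_pdivrMr // mulrC ler_wpM2l //.
  by rewrite ler_nat.
rewrite expRN ler_pdivrMr ?expR_gt0 //.
by move: h; rewrite exprMn exprVn ler_pdivrMr ?exprn_gt0 // mulrC.
Qed.

Lemma flatexp_bound n t : flatexp n t <= n.+1%:R ^+ n.
Proof.
have [t0|t0] := ltP 0 t; last by rewrite flatexp_le0 ?exprn_ge0.
by rewrite /flatexp t0; apply: pow_mul_expRN_le; rewrite invr_ge0 ltW.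
Qed.

Lemma flatexp_le n t : flatexp n t <= n.+2%:R ^+ n.+1 * `|t|.
Proof.
have [t0|t0] := ltP 0 t; last by rewrite flatexp_le0 // mulr_ge0 // exprn_ge0.
have := flatexp_bound n.+1 t; rewrite /flatexp t0 gtr0_norm // exprS.
by rewrite -mulrA ler_pdivrMl // [X in _ <= X -> _]mulrC.
Qed.

(** Only t = 0 needs an argument: there the difference quotient from the right is [flatexp n.+1 h],
    which is bounded by a multiple of |h|. *)
Lemma is_derive_flatexp n t :
  is_derive t (1 : R) (flatexp n) (- n%:R * flatexp n.+1 t + flatexp n.+2 t).
Proof.
have [t0|t0|<-] := ltgtP 0 t.
- have t_neq0 : t != 0 by rewrite gt_eqF.
  apply: (@near_eq_is_derive _ _ _ (fun t : R => t^-1 ^+ n * expR (- t^-1))).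
    near=> u; rewrite /flatexp ifT //; near: u; exact: lt_nbhsr.
  have hid : is_derive t (1 : R) (fun y : R => y) (1 : R) by exact: is_derive_id.
  have hV := is_deriveV t_neq0 hid.
  have hX := is_deriveX n hV.
  have hE := is_derive1_comp (f := expR) (g := fun y : R => - y^-1)
    (is_derive_expR (- t^-1)) (is_deriveN hV).
  have -> : (fun t : R => t^-1 ^+ n * expR (- t^-1)) =
      ((fun y : R => y^-1) ^+ n : R -> R) * (expR \o (fun y : R => - y^-1)).
    by rewrite mulrfctE exprfctE.
  apply: is_derive_eq (is_deriveM hX hE) _.
  rewrite /flatexp t0 /GRing.scale /=.
  rewrite exprfctE -exprVn; move: (t^-1) (expR _) => z c.
  by case: n {hX} => [|n]; rewrite /= ?exprS ?expr0; ring.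
- rewrite !flatexp_le0 ?ltW // mulr0 addr0.
  apply: (@near_eq_is_derive _ _ _ (cst (0 : R))).
  near=> u; rewrite flatexp_le0 // ltW //; near: u; exact: lt_nbhsl.
rewrite !flatexp_le0 // mulr0 addr0.
have H : h^-1 *: ((flatexp n \o shift (0 : R)) (h *: (1 : R)) - flatexp n 0) @[h --> (0 : R)^'] --> (0 : R).
  apply/cvgrPdist_le => e e0.
  have C0 : 0 < n.+3%:R ^+ n.+2 :> R by rewrite exprn_gt0.
  near=> h; rewrite sub0r normrN /= addr0 [flatexp n 0]flatexp_le0 // subr0.
  rewrite {2}/GRing.scale /= mulr1.
  have [h0|h0] := ltP 0 h; last by rewrite (flatexp_le0 _ h0) scaler0 normr0 ltW.
  have -> : h^-1 *: flatexp n h = flatexp n.+1 h.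
    by rewrite /flatexp h0 exprS /GRing.scale /= mulrA.
  rewrite ger0_norm ?flatexp_ge0 //; apply: le_trans (flatexp_le _ _) _.
  rewrite mulrC -ler_pdivlMr //; apply: ltW.
  near: h; apply: dnbhs0_lt; rewrite divr_gt0 //.
split; first by apply/cvg_ex; exists 0.
exact: (cvg_lim _ H).
Unshelve. all: by end_near. Qed.

End flat_exponential.

Section smooth_class.
Context {R : realType}.

(* All iterated partial derivatives of a function built by these rules are again
   built by them, which is how smoothness of the test functions is checked. *)
Inductive sm : (R3 R -> R) -> Prop :=
| sm_cst (c : R) : sm (fun=> c)
| sm_c1 : sm (fun x => x.1.1)
| sm_c2 : sm (fun x => x.1.2)
| sm_c3 : sm (fun x => x.2)
| sm_add f g : sm f -> sm g -> sm (fun x => f x + g x)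
| sm_mul f g : sm f -> sm g -> sm (fun x => f x * g x)
| sm_inv f : (forall x, f x != 0) -> sm f -> sm (fun x => (f x)^-1)
| sm_sqrt f : (forall x, 0 < f x) -> sm f -> sm (fun x => Num.sqrt (f x))
| sm_flatexp n f : sm f -> sm (fun x => flatexp n (f x)).

Lemma sm_opp f : sm f -> sm (fun x => - f x).
Proof.
move=> sf; rewrite (_ : (fun x => - f x) = (fun x => (-1) * f x)).
  by apply: sm_mul => //; exact: sm_cst.
by apply/funext => x; rewrite mulN1r.
Qed.

Lemma sm_sub f g : sm f -> sm g -> sm (fun x => f x - g x).
Proof. by move=> sf sg; apply: sm_add => //; exact: sm_opp. Qed.

Lemma sm_exp f n : sm f -> sm (fun x => f x ^+ n).
Proof.
move=> sf; elim: n => [|n IH]; first exact: sm_cst.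
by rewrite (_ : (fun x => _) = (fun x => f x * f x ^+ n));
  [exact: sm_mul|apply/funext => x; rewrite exprS].
Qed.

Lemma sm_is_derive f (v : R3 R) : sm f ->
  exists2 f', sm f' & forall x, is_derive x v f (f' x).
Proof.
elim => [c||||g h sg [g' sg' dg] sh [h' sh' dh]|g h sg [g' sg' dg] sh [h' sh' dh]
  |g g0 sg [g' sg' dg]|g g0 sg [g' sg' dg]|n g sg [g' sg' dg]].
- by exists (fun=> 0); [exact: sm_cst|move=> x; exact: is_derive_cst].
- by exists (fun=> v.1.1); [exact: sm_cst|move=> x; exact: is_derive_c1].
- by exists (fun=> v.1.2); [exact: sm_cst|move=> x; exact: is_derive_c2].
- by exists (fun=> v.2); [exact: sm_cst|move=> x; exact: is_derive_c3].
- exists (fun x => g' x + h' x); first exact: sm_add.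
  by move=> x; exact: is_derive_add_dir.
- exists (fun x => g x * h' x + h x * g' x).
    by apply: sm_add; exact: sm_mul.
  by move=> x; exact: is_derive_mul_dir.
- exists (fun x => - g' x * (g x)^-1 * (g x)^-1).
    by apply: sm_mul; [apply: sm_mul; [exact: sm_opp|]|]; try exact: sm_inv.
  by move=> x; exact: is_derive_inv_dir.
- exists (fun x => (2 * Num.sqrt (g x))^-1 * g' x).
    apply: sm_mul => //; apply: sm_inv.
      by move=> x; rewrite mulf_neq0 // gt_eqF // sqrtr_gt0.
    by apply: sm_mul; [exact: sm_cst|exact: sm_sqrt].
  by move=> x; exact: is_derive_sqrt_dir.
- exists (fun x => (- n%:R * flatexp n.+1 (g x) + flatexp n.+2 (g x)) * g' x).
    apply: sm_mul => //; apply: sm_add; last exact: sm_flatexp.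
    by apply: sm_mul; [exact: sm_cst|exact: sm_flatexp].
  by move=> x; apply: is_derive_comp_dir => //; exact: is_derive_flatexp.
Qed.

Let is_derive_continuous (g : R -> R) (t d : R) : is_derive t (1 : R) g d -> {for t, continuous g}.
Proof. by move=> [dg _]; apply: differentiable_continuous; exact/derivable1_diffP. Qed.

Lemma sm_continuous f : sm f -> continuous f.
Proof.
elim => [c||||g h sg cg sh ch|g h sg cg sh ch|g g0 sg cg|g g0 sg cg|n g sg cg] x.
- exact: cvg_cst.
- by apply: continuous_comp; exact: cvg_fst.
- by apply: continuous_comp; [exact: cvg_fst|exact: cvg_snd].
- exact: cvg_snd.
- by apply: cvgD; [exact: cg|exact: ch].
- by apply: cvgM; [exact: cg|exact: ch].
- by apply: cvgV; [exact: g0|exact: cg].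
- apply: (@continuous_comp _ _ _ g Num.sqrt); first exact: cg.
  exact: sqrt_continuous.
- apply: (@continuous_comp _ _ _ g (flatexp n)); first exact: cg.
  exact: is_derive_continuous (is_derive_flatexp n (g x)).
Qed.

Lemma sm_partial f (i : 'I_3) : sm f -> sm (partial i f).
Proof.
move=> /(sm_is_derive (unitvec i)) [f' sf' df].
by rewrite (_ : partial i f = f') //; apply/funext => x; case: (df x).
Qed.

Lemma sm_derivable f (i : 'I_3) x : sm f -> is_derive x (unitvec i) f (partial i f x).
Proof.
move=> /(sm_is_derive (unitvec i)) [f' sf' df].
by have [h1 h2] := df x; split.
Qed.

Lemma sm_smooth f : sm f -> smooth f.
Proof.
move=> sf s /=.
have sfs : sm (foldr partial f s) by elim: s => [//|i s IH] /=; exact: sm_partial.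
split; first exact: sm_continuous.
by move=> i x; case: (sm_derivable i x sfs).
Qed.

End smooth_class.

Section step.
Context {R : realType}.
Implicit Types t : R.

Definition step_den t : R := flatexp 0 t + flatexp 0 (1 - t).
Definition step t : R := flatexp 0 t * (step_den t)^-1.
Definition dstep t : R :=
  (flatexp 2 t * step_den t - flatexp 0 t * (flatexp 2 t - flatexp 2 (1 - t))) *
  ((step_den t)^-1 * (step_den t)^-1).

Let dlow : R := flatexp 0 (2^-1 : R).

Let dlow_gt0 : 0 < dlow. Proof. by apply: flatexp_gt0; rewrite invr_gt0. Qed.

Let flatexp0_mono t : 2^-1 <= t -> dlow <= flatexp 0 t.
Proof.
move=> t0; have tgt0 : 0 < t by apply: lt_le_trans t0; rewrite invr_gt0.
have h0 : 0 < 2^-1 :> R by rewrite invr_gt0.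
rewrite /dlow /flatexp h0 tgt0 !expr0 !mul1r ler_expR lerN2 lef_pV2 ?posrE //.
Qed.

(** One of t and 1 - t is at least 1/2, so one summand is at least exp(-2): the denominator of
    [step] stays away from 0. *)
Lemma step_den_ge t : dlow <= step_den t.
Proof.
rewrite /step_den; have [h|h] := leP (2^-1) t.
  by apply: le_trans (flatexp0_mono h) _; rewrite lerDl flatexp_ge0.
apply: le_trans (_ : flatexp 0 (1 - t) <= _); last by rewrite lerDr flatexp_ge0.
by apply: flatexp0_mono; lra.
Qed.

Lemma step_den_gt0 t : 0 < step_den t.
Proof. exact: lt_le_trans (step_den_ge t). Qed.

Lemma step_ge0 t : 0 <= step t.
Proof. by rewrite /step mulr_ge0 ?flatexp_ge0 // invr_ge0 ltW // step_den_gt0. Qed.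

Lemma step_le1 t : step t <= 1.
Proof.
rewrite /step ler_pdivrMr ?step_den_gt0 // mul1r /step_den.
by rewrite lerDl flatexp_ge0.
Qed.

Lemma step_eq0 t : t <= 0 -> step t = 0.
Proof. by move=> t0; rewrite /step flatexp_le0 // mul0r. Qed.

Lemma step_eq1 t : 1 <= t -> step t = 1.
Proof.
move=> t1; have := step_den_gt0 t; rewrite /step /step_den.
rewrite (@flatexp_le0 _ 0 (1 - t)) ?subr_le0 // addr0 => h.
by rewrite divff // gt_eqF.
Qed.

Lemma dstep_eq1 t : 1 <= t -> dstep t = 0.
Proof.
move=> t1; rewrite /dstep /step_den !(@flatexp_le0 _ _ (1 - t)) ?subr_le0 //.
by rewrite addr0 subr0 (mulrC (flatexp 2 t)) subrr mul0r.
Qed.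

Lemma is_derive_step t : is_derive t (1 : R) step (dstep t).
Proof.
have h0 u : is_derive u (1 : R) (@flatexp R 0) (flatexp 2 u).
  by apply: is_derive_eq (is_derive_flatexp 0 u) _; rewrite oppr0 mul0r add0r.
have h1 : is_derive t (1 : R) (fun u => flatexp 0 (1 - u)) (- flatexp 2 (1 - t)).
  have hs : is_derive t (1 : R) (fun u : R => 1 - u) (- 1).
    rewrite -[X in is_derive _ _ _ X]sub0r.
    exact: (is_deriveB (is_derive_cst (1 : R) t (1 : R)) (is_derive_id t (1 : R))).
  apply: is_derive_eq (is_derive1_comp (f := flatexp 0) (g := fun u : R => 1 - u) (h0 _) hs) _.
  by rewrite mulrN1.
have hd : is_derive t (1 : R) step_den (flatexp 2 t + - flatexp 2 (1 - t)).
  exact: (is_deriveD (h0 t) h1).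
have dn0 : step_den t != 0 by rewrite gt_eqF // step_den_gt0.
apply: is_derive_eq (is_deriveM (h0 t) (is_deriveV dn0 hd)) _.
rewrite /dstep /GRing.scale /= -exprVn; move: (step_den t) dn0 => d dn0.
by move: (flatexp 2 t) (flatexp 0 t) (flatexp 2 (1 - t)) => p q r; field.
Qed.

Lemma dstep_bounded : exists2 B : R, 0 <= B & forall t, `|dstep t| <= B.
Proof.
(* [flatexp 0] is at most 1 and [flatexp 2] at most 3^2 = 9, so the numerator is at most 9 * 2 + 1 *
   18 = 36. *)
exists (36 * (dlow^-1 * dlow^-1)).
  by rewrite !mulr_ge0 // invr_ge0 ltW.
move=> t; rewrite /dstep normrM ler_pM ?normr_ge0 //.
  have b0 u : 0 <= flatexp 0 u <= (1 : R).
    by rewrite flatexp_ge0 /=; have := flatexp_bound 0 u; rewrite expr0.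
  have b2 u : 0 <= flatexp 2 u <= (9 : R).
    rewrite flatexp_ge0 /=; have := flatexp_bound 2 u.
    by rewrite (_ : 3%:R ^+ 2 = 9 :> R) //; ring.
  have /andP[p0 p1] := b0 t; have /andP[q0 q1] := b0 (1 - t).
  have /andP[r0 r1] := b2 t; have /andP[s0 s1] := b2 (1 - t).
  rewrite /step_den ler_norml; move: p0 p1 q0 q1 r0 r1 s0 s1.
  move: (flatexp 0 t) (flatexp 0 (1 - t)) (flatexp 2 t) (flatexp 2 (1 - t)) => p q r s.
  move=> *; apply/andP; split; nra.
have h : (step_den t)^-1 <= dlow^-1.
  by rewrite lef_pV2 ?posrE ?step_den_gt0 // step_den_ge.
have h0 : 0 <= (step_den t)^-1 by rewrite invr_ge0 ltW // step_den_gt0.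
by rewrite ger0_norm ?mulr_ge0 // ler_pM.
Qed.

Lemma sm_step f : sm f -> sm (fun x => step (f x)).
Proof.
move=> sf; apply: sm_mul; first exact: sm_flatexp.
apply: sm_inv; first by move=> x; rewrite gt_eqF // step_den_gt0.
apply: sm_add; apply: sm_flatexp => //.
by apply: sm_sub => //; exact: sm_cst.
Qed.

End step.

Section partials.
Context {R : realType}.
Implicit Types (f g : R3 R -> R) (x : R3 R) (i : 'I_3).

Lemma partial_eq f i x d : is_derive x (unitvec i) f d -> partial i f x = d.
Proof. by case. Qed.

Lemma partial_near f g i x : (\near x, f x = g x) -> partial i f x = partial i g x.
Proof. exact: near_eq_derive. Qed.

Lemma partialM f g i x : sm f -> sm g ->
  partial i (fun y => f y * g y) x = f x * partial i g x + g x * partial i f x.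
Proof. by move=> sf sg; apply: partial_eq; apply: is_derive_mul_dir; exact: sm_derivable. Qed.

Lemma partialD f g i x : sm f -> sm g ->
  partial i (fun y => f y + g y) x = partial i f x + partial i g x.
Proof. by move=> sf sg; apply: partial_eq; apply: is_derive_add_dir; exact: sm_derivable. Qed.

Let sum_linear3 (a b : R) (p q r : 'I_3 -> R) :
  \sum_(i < 3) (a * p i + 2 * q i + b * r i) =
  a * (\sum_(i < 3) p i) + 2 * (\sum_(i < 3) q i) + b * (\sum_(i < 3) r i).
Proof. by rewrite !big_split /= -!mulr_sumr. Qed.

Lemma laplacianM f g x : sm f -> sm g ->
  laplacian (fun y => f y * g y) x = f x * laplacian g x +
   2 * (\sum_(i < 3) partial i f x * partial i g x) + g x * laplacian f x.
Proof.
move=> sf sg; rewrite /laplacian.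
have h i : partial i (partial i (fun y => f y * g y)) x =
   f x * partial i (partial i g) x + 2 * (partial i f x * partial i g x) +
   g x * partial i (partial i f) x.
  have -> : partial i (fun y => f y * g y) =
      (fun y => f y * partial i g y + g y * partial i f y).
    by apply/funext => y; exact: partialM.
  rewrite partialD; try by apply: sm_mul => //; exact: sm_partial.
  rewrite !partialM //; try exact: sm_partial.
  move: (f x) (g x) (partial i f x) (partial i g x) => a b a1 b1.
  by move: (partial i (partial i f) x) (partial i (partial i g) x) => a2 b2; ring.
by rewrite -sum_linear3; apply: eq_bigr => i _; rewrite h.
Qed.

Lemma unitvec1 (i : 'I_3) : (unitvec i : R3 R).1.1 = (i == 0)%:R. Proof. by []. Qed.
Lemma unitvec2 (i : 'I_3) : (unitvec i : R3 R).1.2 = (i == 1)%:R. Proof. by []. Qed.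
Lemma unitvec3 (i : 'I_3) : (unitvec i : R3 R).2 = (i == 2)%:R. Proof. by []. Qed.

End partials.

Section compactness.
Context {R : realType}.

Lemma closed_box_compact (K : set (R3 R)) (c : R) : closed K ->
  (forall x, K x -> [/\ `|x.1.1| <= c, `|x.1.2| <= c & `|x.2| <= c]) -> compact K.
Proof.
move=> cK Kc.
have cb : compact ((`[- c, c]%classic : set R) `*` (`[- c, c]%classic : set R)
    `*` (`[- c, c]%classic : set R)).
  by apply: compact_setX; [apply: compact_setX|]; exact: segment_compact.
apply: (subclosed_compact cK cb) => x /Kc[h1 h2 h3].
by split; first split; rewrite /= in_itv /= -ler_norml.
Qed.

Lemma continuous_bounded_ball (f : R3 R -> R) (c : R) : continuous f ->
  exists2 B : R, 0 <= B & forall x, enorm x <= c -> `|f x| <= B.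
Proof.
move=> cf.
pose K : set (R3 R) := (`[- c, c]%classic : set R) `*` (`[- c, c]%classic : set R)
    `*` (`[- c, c]%classic : set R).
have cb : compact K.
  by apply: compact_setX; [apply: compact_setX|]; exact: segment_compact.
have cfK : compact (f @` K).
  by apply: continuous_compact => //; exact: continuous_subspaceT.
have [B [_ hB]] := compact_bounded cfK.
exists (Num.max B 0 + 1); first by rewrite addr_ge0 // le_max lexx orbT.
move=> x xc; apply: (hB (Num.max B 0 + 1)).
  by rewrite (@le_lt_trans _ _ (Num.max B 0)) ?le_max ?lexx // ltrDl.
exists x => //; rewrite /K.
split; first split; rewrite /= in_itv /= -ler_norml; apply: le_trans xc.
- exact: coord1_le_enorm.
- exact: coord2_le_enorm.
- exact: coord3_le_enorm.
Qed.

Lemma enorm_continuous : continuous (@enorm R).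
Proof.
move=> x; rewrite /enorm; apply: (@continuous_comp _ _ _ (fun x : R3 R => dot x x) Num.sqrt).
  rewrite /dot; apply: (@sm_continuous _ (fun x : R3 R => x.1.1 * x.1.1 + x.1.2 * x.1.2 + x.2 * x.2)).
  by do ?apply: sm_add; apply: sm_mul; do ?[exact: sm_c1|exact: sm_c2|exact: sm_c3].
exact: sqrt_continuous.
Qed.

Lemma enorm_closed_ball (c : R) : closed [set x : R3 R | enorm x <= c].
Proof.
rewrite (_ : [set x | _] = @enorm R @^-1` `]-oo, c]%classic).
  by apply: closed_comp; [move=> x _; exact: enorm_continuous|exact: interval_closed].
by apply/seteqP; split => x /=; rewrite in_itv.
Qed.

Lemma enorm_open_ball (c : R) : open [set x : R3 R | enorm x < c].
Proof.
rewrite (_ : [set x | _] = @enorm R @^-1` `]-oo, c[%classic).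
  by apply: open_comp; [move=> x _; exact: enorm_continuous|exact: interval_open].
by apply/seteqP; split => x /=; rewrite in_itv.
Qed.

Lemma enorm_open_outside (c : R) : open [set x : R3 R | c < enorm x].
Proof.
rewrite (_ : [set x | _] = @enorm R @^-1` `]c, +oo[%classic).
  by apply: open_comp; [move=> y _; exact: enorm_continuous|exact: interval_open].
by apply/seteqP; split => y /=; rewrite in_itv /= andbT.
Qed.

Lemma partial_outside (f : R3 R -> R) i (c : R) : (forall x, c < enorm x -> f x = 0) ->
  forall x, c < enorm x -> partial i f x = 0.
Proof.
move=> f0 x xc; rewrite (@partial_near _ _ (cst 0)).
  by apply: partial_eq; exact: is_derive_cst.
have : \near x, c < enorm x.
  by apply: open_nbhs_nbhs; split => //; exact: enorm_open_outside.
by apply: filterS => y; exact: f0.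
Qed.

Lemma supp_compact (f : R3 R -> R) (c : R) : (forall x, c < enorm x -> f x = 0) ->
  compact (supp f) /\ supp f `<=` [set x | enorm x <= c].
Proof.
move=> f0.
have sub : supp f `<=` [set x | enorm x <= c].
  have /closure_id -> : closed [set x : R3 R | enorm x <= c] by exact: enorm_closed_ball.
  apply: closureS => x /=.
  by apply: contraNle => /f0 ->; rewrite eqxx.
split => //; apply: (@closed_box_compact _ c); first exact: closed_closure.
move=> x /sub /= xc; split; apply: le_trans xc.
- exact: coord1_le_enorm.
- exact: coord2_le_enorm.
- exact: coord3_le_enorm.
Qed.

End compactness.

Lemma ord3_cases (i : 'I_3) : [\/ i = 0, i = 1 | i = 2].
Proof.
case: i => -[|[|[|//]]] i3; [apply: Or31|apply: Or32|apply: Or33]; exact: val_inj.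
Qed.

(** * The cutoff at the apex and the harmonic kernel *)

Section test_functions.
Context {R : realType}.
Implicit Types (x : R3 R) (i : 'I_3).

Definition sqn x : R := x.1.1 ^+ 2 + x.1.2 ^+ 2 + x.2 ^+ 2.

Lemma sqnE x : sqn x = enorm x ^+ 2. Proof. by rewrite enorm_sqr. Qed.

Lemma sm_sqn : sm sqn.
Proof.
by do ?apply: sm_add; apply: sm_exp; do ?[exact: sm_c1|exact: sm_c2|exact: sm_c3].
Qed.

Section cutoff.
Variable r : R.
Hypothesis r0 : 0 < r.

(** The squared norm keeps the function smooth at the origin; 3 r^2 = (2 r)^2 - r^2 makes the
    transition run from |x| = r to |x| = 2 r. *)
Definition chi x : R := 1 - step ((sqn x - r ^+ 2) / (3 * r ^+ 2)).

Let r2 : 0 < 3 * r ^+ 2. Proof. by rewrite mulr_gt0 // exprn_gt0. Qed.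

Lemma sm_chi : sm chi.
Proof.
apply: sm_sub; first exact: sm_cst.
apply: sm_step; apply: sm_mul; last exact: sm_cst.
by apply: sm_sub; [exact: sm_sqn|exact: sm_cst].
Qed.

Lemma chi_ge0 x : 0 <= chi x. Proof. by rewrite subr_ge0 step_le1. Qed.

Lemma chi_le1 x : chi x <= 1. Proof. by rewrite gerBl step_ge0. Qed.

Lemma chi_eq1 x : enorm x <= r -> chi x = 1.
Proof.
move=> xr; rewrite /chi step_eq0 ?subr0 //.
rewrite mulr_le0_ge0 //; last by rewrite invr_ge0 ltW.
by rewrite subr_le0 sqnE lerXn2r ?nnegrE ?enorm_ge0 // ltW.
Qed.

Lemma chi_eq0 x : 2 * r <= enorm x -> chi x = 0.
Proof.
move=> xr; rewrite /chi step_eq1 ?subrr // ler_pdivlMr // mul1r.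
rewrite lerBrDr sqnE.
have : (2 * r) ^+ 2 <= enorm x ^+ 2.
  by rewrite lerXn2r ?nnegrE ?enorm_ge0 // mulr_ge0 // ltW.
by rewrite exprMn; lra.
Qed.

Let locally (P : R3 R -> Prop) (U : set (R3 R)) x : open U -> U x ->
  (forall y, U y -> P y) -> \near x, P x.
Proof. by move=> oU Ux UP; apply: filterS UP _; exact: open_nbhs_nbhs. Qed.

Lemma partial_chi_eq0 i x : enorm x < r \/ 2 * r < enorm x -> partial i chi x = 0.
Proof.
case=> xr.
  rewrite (@partial_near _ _ (cst 1)); last first.
    apply: (locally (enorm_open_ball (c := r)) xr) => y /= yr.
    by rewrite chi_eq1 // ltW.
  by apply: partial_eq; exact: is_derive_cst.
by apply: (partial_outside i _ xr) => y yr; rewrite chi_eq0 // ltW.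
Qed.

Lemma laplacian_chi_eq0 x : enorm x < r \/ 2 * r < enorm x -> laplacian chi x = 0.
Proof.
move=> h; rewrite /laplacian big1 // => i _.
case: h => xr.
  rewrite (@partial_near _ _ (cst 0)); first by apply: partial_eq; exact: is_derive_cst.
  apply: (locally (enorm_open_ball (c := r)) xr) => y /= yr.
  by rewrite partial_chi_eq0 //; left.
by apply: (partial_outside i _ xr) => y yr; rewrite partial_chi_eq0 //; right.
Qed.

End cutoff.

Section kernel.
Variable e : R.
Hypothesis e0 : 0 < e.

Definition pole i x : R :=
  if i == 0 then x.1.1 else if i == 1 then x.1.2 else x.2 + e.

Definition dist2 x : R := x.1.1 ^+ 2 + x.1.2 ^+ 2 + (x.2 + e) ^+ 2.

(** Equal to [dist2] where dist2 >= e^2 / 4 and to 1 where dist2 <= e^2 / 8, hence smooth and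
    positive everywhere. The pole is smoothed away inside a ball that does not reach the half-space
    x3 >= 0, and the kernel becomes smooth on the whole space. *)
Definition dist2_pos x : R :=
  dist2 x * step (8 / e ^+ 2 * dist2 x - 1) + (1 - step (8 / e ^+ 2 * dist2 x - 1)).

Definition newton x : R := (Num.sqrt (dist2_pos x))^-1.

(* Where [dist2 x >= e^2 / 4], and in particular on the cone, [psi] is the
   harmonic function [- d_3 (1 / |x - p|)] with pole [p = (0, 0, - e)]. *)
Definition psi x : R := (x.2 + e) * newton x ^+ 3.

Lemma dist2_ge0 x : 0 <= dist2 x. Proof. by rewrite /dist2 !addr_ge0 ?sqr_ge0. Qed.

Lemma dist2_pos_gt0 x : 0 < dist2_pos x.
Proof.
rewrite /dist2_pos; set s := step _.
have s0 : 0 <= s := step_ge0 _; have s1 : s <= 1 := step_le1 _.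
have [|d0] := eqVneq (dist2 x) 0.
  by move=> d0; rewrite d0 mul0r add0r subr_gt0 /s d0 mulr0 sub0r step_eq0.
have dp : 0 < dist2 x by rewrite lt_neqAle eq_sym d0 dist2_ge0.
have := mulr_ge0 (dist2_ge0 x) s0.
have [s_eq1|s_ne1] := eqVneq s 1; first by rewrite s_eq1 mulr1 subrr addr0.
have : s < 1 by rewrite lt_neqAle s_ne1.
by lra.
Qed.

Lemma sm_dist2 : sm dist2.
Proof.
do ?apply: sm_add; apply: sm_exp; do ?[exact: sm_c1|exact: sm_c2].
by apply: sm_add; [exact: sm_c3|exact: sm_cst].
Qed.

Lemma sm_newton : sm newton.
Proof.
apply: sm_inv; first by move=> x; rewrite gt_eqF // sqrtr_gt0 dist2_pos_gt0.
apply: sm_sqrt; first exact: dist2_pos_gt0.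
have st : sm (fun x => step (8 / e ^+ 2 * dist2 x - 1)).
  apply: sm_step; apply: sm_sub; last exact: sm_cst.
  by apply: sm_mul; [exact: sm_cst|exact: sm_dist2].
apply: sm_add; first by apply: sm_mul => //; exact: sm_dist2.
by apply: sm_sub => //; exact: sm_cst.
Qed.

Lemma sm_psi : sm psi.
Proof.
apply: sm_mul; last by apply: sm_exp; exact: sm_newton.
by apply: sm_add; [exact: sm_c3|exact: sm_cst].
Qed.

Lemma newton_gt0 x : 0 < newton x.
Proof. by rewrite invr_gt0 sqrtr_gt0 dist2_pos_gt0. Qed.

Definition far : set (R3 R) := [set x | e ^+ 2 / 4 < dist2 x].

Lemma open_far : open far.
Proof.
rewrite (_ : far = dist2 @^-1` `]e ^+ 2 / 4, +oo[%classic).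
  by apply: open_comp; [move=> y _; exact: (sm_continuous sm_dist2)|exact: interval_open].
by apply/seteqP; split => y /=; rewrite /far /= in_itv /= andbT.
Qed.

Let e2 : 0 < e ^+ 2. Proof. by rewrite exprn_gt0. Qed.

Lemma dist2_pos_far x : far x -> dist2_pos x = dist2 x.
Proof.
move=> fx; rewrite /dist2_pos step_eq1 ?mulr1 ?subrr ?addr0 //.
have : e ^+ 2 / 4 < dist2 x by [].
rewrite -(@ltr_pM2l _ (8 / e ^+ 2)) ?divr_gt0 //.
rewrite (_ : 8 / e ^+ 2 * (e ^+ 2 / 4) = 2); first by lra.
by field; rewrite gt_eqF.
Qed.

Lemma far_half x : 0 <= x.2 -> far x.
Proof.
move=> x2; rewrite /far /= /dist2.
have := sqr_ge0 x.1.1; have := sqr_ge0 x.1.2; move: e0 e2 x2; nra.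
Qed.

Lemma newton_sqr x : far x -> newton x ^+ 2 * dist2 x = 1.
Proof.
move=> fx; rewrite /newton exprVn sqr_sqrtr ?ltW ?dist2_pos_gt0 //.
rewrite dist2_pos_far // mulVf // gt_eqF //.
by apply: le_lt_trans fx; rewrite divr_ge0 // ltW.
Qed.

Lemma is_derive_pole i j x : is_derive x (unitvec i) (pole j) (i == j)%:R.
Proof.
case: (ord3_cases j) => ->; rewrite /pole /=; first exact: is_derive_c1.
  exact: is_derive_c2.
rewrite -[X in is_derive _ _ _ X]addr0.
exact: (is_derive_add_dir (is_derive_c3 x _) (is_derive_cst e x _)).
Qed.

Lemma dist2E x : dist2 x = \sum_(j < 3) pole j x ^+ 2.
Proof. by rewrite !big_ord_recl big_ord0 /pole /= addr0 addrA. Qed.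

Lemma is_derive_newton i x : far x ->
  is_derive x (unitvec i) newton (- pole i x * newton x ^+ 3).
Proof.
move=> fx.
have d2 : is_derive x (unitvec i) dist2 (2 * pole i x).
  have dp j := is_derive_pole i j x.
  have h : is_derive x (unitvec i)
     (fun x => pole 0 x * pole 0 x + pole 1 x * pole 1 x + pole 2 x * pole 2 x)
     (2 * pole i x).
    have d012 := is_derive_add_dir (is_derive_add_dir (is_derive_mul_dir (dp 0) (dp 0))
      (is_derive_mul_dir (dp 1) (dp 1))) (is_derive_mul_dir (dp 2) (dp 2)).
    apply: is_derive_eq d012 _.
    by case: (ord3_cases i) => ->; rewrite /pole /=; ring.
  rewrite (_ : dist2 = (fun x => pole 0 x * pole 0 x + pole 1 x * pole 1 x + pole 2 x * pole 2 x)) //.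
have d2x : 0 < dist2 x.
  by apply: le_lt_trans fx; rewrite divr_ge0 // ltW.
apply: (@near_eq_is_derive _ _ _ (fun y => (Num.sqrt (dist2 y))^-1)).
  have : \near x, far x by apply: open_nbhs_nbhs; split => //; exact: open_far.
  by apply: filterS => y fy; rewrite /newton dist2_pos_far.
have sn0 : Num.sqrt (dist2 x) != 0 by rewrite gt_eqF // sqrtr_gt0.
apply: is_derive_eq (is_derive_inv_dir sn0 (is_derive_sqrt_dir d2x d2)) _.
rewrite /newton dist2_pos_far //.
by move: (Num.sqrt _) sn0 => s sn0; field.
Qed.

Let dpsi i x : R := (i == 2)%:R * newton x ^+ 3 - 3 * (pole 2 x * pole i x) * newton x ^+ 5.

Lemma is_derive_newtonX i x n : far x ->
  is_derive x (unitvec i) (fun y => newton y ^+ n)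
    (- n%:R * pole i x * newton x ^+ (n + 2)).
Proof.
move=> fx; elim: n => [|n IH].
  by rewrite oppr0 !mul0r; exact: is_derive_cst.
rewrite (_ : (fun y => _) = (fun y => newton y * newton y ^+ n)); last first.
  by apply/funext => y; rewrite exprS.
apply: is_derive_eq (is_derive_mul_dir (is_derive_newton i fx) IH) _.
rewrite -natr1 !exprD !exprS expr0; ring.
Qed.

Lemma partial_psi i x : far x -> partial i psi x = dpsi i x.
Proof.
move=> fx; apply: partial_eq; rewrite /psi.
have h2 := is_derive_pole i 2 x.
apply: is_derive_eq (is_derive_mul_dir h2 (is_derive_newtonX i 3 fx)) _.
rewrite /dpsi; ring.
Qed.

Lemma laplacian_psi x : far x -> laplacian psi x = 0.
Proof.
move=> fx.
have h i : partial i (partial i psi) x =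
   - 6 * (i == 2)%:R * pole i x * newton x ^+ 5 - 3 * pole 2 x * newton x ^+ 5
     + 15 * pole 2 x * pole i x ^+ 2 * newton x ^+ 7.
  rewrite (@partial_near _ _ (dpsi i)); last first.
    have : \near x, far x by apply: open_nbhs_nbhs; split => //; exact: open_far.
    by apply: filterS => y fy; exact: partial_psi.
  apply: partial_eq; rewrite /dpsi.
  have hi := is_derive_pole i i x; have h2 := is_derive_pole i 2 x.
  have n3 := is_derive_newtonX i 3 fx; have n5 := is_derive_newtonX i 5 fx.
  have t1 := is_derive_mul_dir (is_derive_cst ((i == 2)%:R : R) x (unitvec i)) n3.
  have t2 := is_derive_mul_dir (is_derive_mul_dir (is_derive_cst (- 3 : R) x (unitvec i))
    (is_derive_mul_dir h2 hi)) n5.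
  have t3 := is_derive_add_dir t1 t2.
  rewrite (_ : (fun y => _) = (fun y => cst (i == 2)%:R y * newton y ^+ 3 +
     cst (- 3) y * (pole 2 y * pole i y) * newton y ^+ 5)); last first.
    by apply/funext => y; rewrite /cst !mulNr.
  apply: is_derive_eq t3 _; rewrite eqxx /cst /=.
  case: (ord3_cases i) => -> /=; ring.
rewrite /laplacian (eq_bigr _ (fun i _ => h i)).
have := newton_sqr fx; rewrite dist2E !big_ord_recl !big_ord0 /=.
have -> : (lift ord0 ord0 : 'I_3) = 1 by exact: val_inj.
have -> : (lift ord0 (lift ord0 ord0) : 'I_3) = 2 by exact: val_inj.
have -> : (ord0 : 'I_3) = 0 by exact: val_inj.
move: (newton x) (pole 0 x) (pole 1 x) (pole 2 x) => n a b c hn /=.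
have -> : n ^+ 7 = n ^+ 5 * n ^+ 2 by rewrite -exprD.
(* The sum of the three second derivatives factors through newton^2 * dist2 - 1 = 0. *)
transitivity (15 * c * n ^+ 5 * (n ^+ 2 * (a ^+ 2 + (b ^+ 2 + (c ^+ 2 + 0))) - 1)).
  ring.
by rewrite hn subrr mulr0.
Qed.

End kernel.

End test_functions.

(** * Weights uniform in [e] and the logarithmic divergence *)

Section cone_estimates.
Context {R : realType}.
Local Notation lambda := (@lebesgue_measure R).
Variable m : R.
Hypothesis m0 : 0 < m.

Definition plane_norm (a : R2 R) : R := Num.sqrt (a.1 ^+ 2 + a.2 ^+ 2).
Definition rho (a : R2 R) : measurableTypeR R := m * plane_norm a.

Lemma plane_norm_ge0 a : 0 <= plane_norm a. Proof. exact: sqrtr_ge0. Qed.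

Lemma plane_norm_sqr a : plane_norm a ^+ 2 = a.1 ^+ 2 + a.2 ^+ 2.
Proof. by rewrite sqr_sqrtr // addr_ge0 ?sqr_ge0. Qed.

Lemma plane_norm_fst a : `|a.1| <= plane_norm a.
Proof.
rewrite -(@ler_pXn2r R 2) ?nnegrE ?plane_norm_ge0 // plane_norm_sqr.
by rewrite real_normK ?num_real // lerDl sqr_ge0.
Qed.

Lemma plane_norm_snd a : `|a.2| <= plane_norm a.
Proof.
rewrite -(@ler_pXn2r R 2) ?nnegrE ?plane_norm_ge0 // plane_norm_sqr.
by rewrite real_normK ?num_real // lerDr sqr_ge0.
Qed.

Lemma rho_ge0 a : 0 <= rho a.
Proof. by rewrite mulr_ge0 ?plane_norm_ge0 // ltW. Qed.

Lemma measurable_plane_norm : measurable_fun setT (plane_norm : R2 R -> measurableTypeR R).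
Proof.
have ms : measurable_fun [set: R2 R] (fun a => a.1 ^+ 2 + a.2 ^+ 2 : measurableTypeR R).
  by apply: measurable_funD; apply: measurable_funX; [exact: measurable_fst|exact: measurable_snd].
apply: (measurableT_comp _ ms).
by apply: continuous_measurable1 => x; exact: sqrt_continuous.
Qed.

Lemma measurable_rho : measurable_fun setT rho.
Proof. by apply: measurable_funM; [exact: measurable_cst|exact: measurable_plane_norm]. Qed.

(** The reverse triangle inequality for the plane norm; squared, it is Cauchy-Schwarz, which follows
    from Lagrange's identity. *)
Lemma rho_lipschitz (a b : R2 R) :
  (rho a - rho b) ^+ 2 <= m ^+ 2 * ((a.1 - b.1) ^+ 2 + (a.2 - b.2) ^+ 2).
Proof.
rewrite /rho -mulrBr exprMn ler_pM2l ?exprn_gt0 //.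
have ha := plane_norm_sqr a; have hb := plane_norm_sqr b.
have a0 := plane_norm_ge0 a; have b0 := plane_norm_ge0 b.
have cs : a.1 * b.1 + a.2 * b.2 <= plane_norm a * plane_norm b.
  have [h|h] := leP (a.1 * b.1 + a.2 * b.2) 0.
    by apply: le_trans h _; rewrite mulr_ge0.
  rewrite -(@ler_pXn2r R 2) ?nnegrE ?mulr_ge0 ?(ltW h) // exprMn ha hb.
  by have := sqr_ge0 (a.1 * b.2 - a.2 * b.1); nra.
by rewrite sqrrB ha hb; nra.
Qed.

Lemma base_square tau : base rho tau `<=`
  (`](- (tau / m))%R, (tau / m)%R[%classic : set R) `*` (`](- (tau / m))%R, (tau / m)%R[%classic : set R).
Proof.
move=> a; rewrite /base /= /rho mulrC -ltr_pdivlMr // => h.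
have h1 := plane_norm_fst a; have h2 := plane_norm_snd a.
by split; rewrite /= in_itv /= -ltr_norml; apply: le_lt_trans h.
Qed.

Lemma area_base_le tau : 0 < tau -> (area (base rho tau) <= (4 * (tau / m) ^+ 2)%:E)%E.
Proof.
move=> tau0; have t0 : 0 < tau / m by rewrite divr_gt0.
set c := tau / m in t0 *.
have mQ : measurable ((`](- c)%R, c[%classic : set (measurableTypeR R)) `*`
    (`](- c)%R, c[%classic : set (measurableTypeR R))).
  by apply: measurableX; exact: measurable_itv.
apply: (@le_trans _ _ (area ((`](- c)%R, c[%classic : set (measurableTypeR R)) `*`
    (`](- c)%R, c[%classic : set (measurableTypeR R))))).
  apply: le_measure; rewrite ?inE //; first exact: (measurable_base measurable_rho).
  exact: base_square.
rewrite area_X; try exact: measurable_itv.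
rewrite !lebesgue_measure_itv /= lte_fin ifT; last by rewrite gtrN.
change (((c - - c) * (c - - c) : R)%:E <= (4 * c ^+ 2)%:E)%E.
by rewrite lee_fin le_eqVlt; apply/orP; left; apply/eqP; ring.
Qed.

Section inverse_root.
Variable e : R.
Hypothesis e0 : 0 < e.

(* [root_inv s = (s + e) ^ (-1/2)] for [s >= 0]; truncating at 0 keeps it bounded. *)
Definition root_inv (s : R) : R := (Num.sqrt (Num.max s 0 + e))^-1.

Let me0 s : 0 < Num.max s 0 + e.
Proof. by rewrite ltr_wpDl // le_max lexx orbT. Qed.

Lemma root_inv_gt0 s : 0 < root_inv s.
Proof. by rewrite invr_gt0 sqrtr_gt0. Qed.

Lemma root_inv_le s : root_inv s <= (Num.sqrt e)^-1.
Proof.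
rewrite lef_pV2 ?posrE ?sqrtr_gt0 //; apply: ler_wsqrtr.
by rewrite lerDr le_max lexx orbT.
Qed.

Lemma root_inv_sqr s : 0 <= s -> root_inv s ^+ 2 * (s + e) = 1.
Proof.
move=> s0; rewrite /root_inv max_l // exprVn sqr_sqrtr ?ltW //; last first.
  by rewrite ltr_wpDl.
by rewrite mulVf // gt_eqF // ltr_wpDl.
Qed.

Lemma continuous_root_inv : continuous root_inv.
Proof.
move=> s; apply: cvgV; first by rewrite gt_eqF // sqrtr_gt0.
apply: (@continuous_comp _ _ _ (fun s : R => Num.max s 0 + e) Num.sqrt); last exact: sqrt_continuous.
apply: cvgD; last exact: cvg_cst.
by apply: (@continuous_max _ _ (fun s : R => s) (cst (0 : R))); [exact: cvg_id|exact: cvg_cst].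
Qed.

Lemma integral_root_inv_le tau : 0 < tau -> e <= 1 ->
  (\int[lambda]_(t in `]0%R, tau[) (root_inv t)%:E <= (2 * Num.sqrt (tau + 1))%:E)%E.
Proof.
move=> tau0 e1.
have mr : measurable_fun [set: measurableTypeR R] (fun t => (root_inv t)%:E).
  apply/measurable_EFinP; apply: continuous_measurable1; exact: continuous_root_inv.
rewrite integral_itv_obnd_cbnd; last exact: measurable_funTS.
rewrite integral_itv_bndo_bndc; last exact: measurable_funTS.
pose F (t : R) := 2 * Num.sqrt (t + e).
have dF (t : R) : - e < t -> is_derive t (1 : R) F ((Num.sqrt (t + e))^-1).
  move=> t0; have te : 0 < t + e by lra.
  have h1 : is_derive t (1 : R) (fun u : R => u + e) (1 + 0).
    exact: (is_deriveD (is_derive_id t (1 : R)) (is_derive_cst e t (1 : R))).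
  have h2 := is_derive1_comp (f := Num.sqrt) (g := fun u : R => u + e) (is_derive1_sqrt te) h1.
  have h3 := is_deriveM (is_derive_cst (2 : R) t (1 : R)) h2.
  apply: is_derive_eq h3 _; rewrite /GRing.scale /= mulr0 !addr0 mulr1.
  have sn0 : Num.sqrt (t + e) != 0 by rewrite gt_eqF // sqrtr_gt0.
  by field.
have cF (t : R) : - e < t -> {for t, continuous F}.
  move=> t0; apply: differentiable_continuous; apply/derivable1_diffP.
  by case: (dF t t0).
rewrite (@continuous_FTC2 _ root_inv F) //.
- rewrite -EFinB lee_fin /F add0r.
  apply: (@le_trans _ _ (2 * Num.sqrt (tau + e))).
    by rewrite gerBl mulr_ge0 // sqrtr_ge0.
  by rewrite ler_pM2l // ler_wsqrtr // lerD2l.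
- by apply: continuous_subspaceT; exact: continuous_root_inv.
- split.
  + move=> t; rewrite in_itv /= => /andP[t0 _].
    have te : - e < t by have := e0; lra.
    by case: (dF t te).
  + by apply: cvg_at_right_filter; apply: cF; have := e0; lra.
  + by apply: cvg_at_left_filter; apply: cF; have := e0; lra.
- move=> t; rewrite in_itv /= => /andP[t0 _].
  have te : - e < t by have := e0; lra.
  rewrite derive1E; have [_ ->] := dF t te.
  by rewrite /root_inv max_l // ltW.
Qed.

(** Since (t - rho a) root_inv^2 <= (t + e) root_inv^2 = 1, a single power of [root_inv] is left,
    and (t + e)^(-1/2) is integrable uniformly in [e]. This is the first moment that Hardy's
    inequality asks for. *)
Lemma hardy_weight_le tau (a : R2 R) : 0 < tau -> e <= 1 ->
  (\int[lambda]_(t in `]rho a, tau[) ((t - rho a) * root_inv t ^+ 3)%:E <=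
   (2 * Num.sqrt (tau + 1))%:E)%E.
Proof.
move=> tau0 e1; apply: le_trans (integral_root_inv_le tau0 e1).
have mr : measurable_fun [set: measurableTypeR R] (root_inv : _ -> measurableTypeR R).
  by apply: continuous_measurable1; exact: continuous_root_inv.
have mrE : measurable_fun [set: measurableTypeR R] (fun t => (root_inv t)%:E).
  exact/measurable_EFinP.
have sub : (`]rho a, tau[%classic : set (measurableTypeR R)) `<=` `]0%R, tau[%classic.
  move=> t; rewrite /= !in_itv /= => /andP[h ->]; rewrite andbT.
  exact: le_lt_trans (rho_ge0 a) h.
apply: (@le_trans _ _ (\int[lambda]_(t in `]rho a, tau[) (root_inv t)%:E)%E); last first.
  apply: (ge0_subset_integral lambda (measurable_itv `]rho a, tau[) (measurable_itv `]0%R, tau[) _ _ sub).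
    exact: measurable_funTS.
  by move=> t _; rewrite lee_fin ltW // root_inv_gt0.
apply: (ge0_le_integral lambda (measurable_itv `]rho a, tau[)).
- move=> t; rewrite /= in_itv /= => /andP[h _].
  by rewrite lee_fin mulr_ge0 ?subr_ge0 ?(ltW h) // exprn_ge0 // ltW // root_inv_gt0.
- apply: measurable_funTS; apply/measurable_EFinP; apply: measurable_funM.
    by apply: measurable_funB; [exact: measurable_id|exact: measurable_cst].
  exact: measurable_funX.
- exact: measurable_funTS.
move=> t; rewrite /= in_itv /= => /andP[h _]; rewrite lee_fin.
have r0 := rho_ge0 a; have t0 : 0 <= t by lra.
have := root_inv_sqr t0; have := root_inv_gt0 t; move: (root_inv t) => b b0 hb.
rewrite exprS mulrCA ler_piMr ?(ltW b0) // -hb mulrC ler_wpM2l ?sqr_ge0 //.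
by move: e0; lra.
Qed.

(** Sliced by height: the slice at height t has area at most 4 (t / m)^2, and root_inv^5 t^2 <=
    root_inv because root_inv^2 t <= 1. *)
Lemma above_weight_le tau : 0 < tau -> e <= 1 ->
  (\int[volume]_(x in above rho tau) (root_inv x.2 ^+ 5)%:E <=
   (8 / m ^+ 2 * Num.sqrt (tau + 1))%:E)%E.
Proof.
move=> tau0 e1.
have mY : measurable (above rho tau) by exact: (measurable_above measurable_rho).
have mr : measurable_fun [set: measurableTypeR R] (root_inv : _ -> measurableTypeR R).
  by apply: continuous_measurable1; exact: continuous_root_inv.
have mf : measurable_fun [set: R3 R] (fun x => (root_inv x.2 ^+ 5)%:E).
  apply/measurable_EFinP; apply: measurable_funX.
  by apply: (measurableT_comp mr); exact: measurable_snd.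
have m5 : measurable_fun [set: measurableTypeR R] (fun t => (root_inv t ^+ 5)%:E).
  by apply/measurable_EFinP; exact: measurable_funX.
have p0 t : 0 <= root_inv t ^+ 5 by rewrite exprn_ge0 // ltW // root_inv_gt0.
pose g := (fun x : R3 R => (root_inv x.2 ^+ 5)%:E) \_ (above rho tau).
have mg : measurable_fun setT g.
  by apply/(measurable_restrictT _ mY); exact: measurable_funTS.
have g0 x : (0 <= g x)%E by rewrite /g patchE; case: ifP => // _; rewrite lee_fin.
rewrite integral_mkcond.
have -> : (\int[volume]_x g x = \int[lambda]_t \int[area]_a g (a, t))%E.
  exact: (@fubini_tonelli2 _ _ _ _ _ area lambda g mg g0).
have slice t : (\int[area]_a g (a, t) =
    (if (t < tau)%R then root_inv t ^+ 5 else 0)%:E * area (base rho t))%E.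
  have -> : (\int[area]_a g (a, t) = \int[area]_(a in base rho t)
      (if (t < tau)%R then root_inv t ^+ 5 else 0)%:E)%E.
    rewrite [RHS]integral_mkcond; apply: eq_integral => a _; rewrite /g !patchE.
    rewrite /above /base; case: (boolP (t < tau)%R) => tt.
      have -> : ((a, t) \in [set x : R3 R | (rho x.1 < x.2 < tau)%R]) =
          (a \in [set a | (rho a < t)%R]) => //.
      by apply/idP/idP; rewrite !in_setE /= tt andbT.
    rewrite ifF; first by case: ifP.
    by apply/negbTE/negP; rewrite in_setE /= (negbTE tt) andbF.
  by rewrite (integral_cst area (measurable_base measurable_rho t)).
under eq_integral do rewrite slice.
have base0 t : t <= 0 -> base rho t = set0.
  move=> t0; apply/seteqP; split => // a; rewrite /base /= => h.
  by have := rho_ge0 a; lra.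
apply: (@le_trans _ _ (\int[lambda]_(t in `]0%R, tau[) ((4 / m ^+ 2) * root_inv t)%:E)%E); last first.
  under eq_integral do rewrite EFinM.
  rewrite (ge0_integralZl lambda (measurable_itv _)); last 3 first.
  - by apply: measurable_funTS; exact/measurable_EFinP.
  - by move=> t _; rewrite lee_fin ltW // root_inv_gt0.
  - by rewrite lee_fin divr_ge0 // exprn_ge0 // ltW.
  apply: le_trans (lee_wpmul2l _ (integral_root_inv_le tau0 e1)) _.
    by rewrite lee_fin divr_ge0 // exprn_ge0 // ltW.
  rewrite -EFinM lee_fin le_eqVlt; apply/orP; left; apply/eqP.
  by field; rewrite gt_eqF.
rewrite [leRHS]integral_mkcond.
have mG := @measurable_fun_fubini_tonelli_G _ _ _ _ _ area _ mg g0.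
apply: (ge0_le_integral lambda measurableT).
- move=> t _; rewrite mule_ge0 // lee_fin; case: ifP => // _; exact: p0.
- by apply/(measurable_fun_eqP (fun t => \int[area]_a g (a, t))%E) => // t _; rewrite slice.
- apply/(measurable_restrictT _ (measurable_itv _)).
  by apply: measurable_funTS; apply/measurable_EFinP; apply: measurable_funM;
    [exact: measurable_cst|exact: mr].
move=> t _; rewrite patchE.
have [t0|t0] := leP t 0.
  rewrite base0 // measure0 mule0; case: ifP => // _.
  by rewrite lee_fin mulr_ge0 ?divr_ge0 ?exprn_ge0 // ?ltW // root_inv_gt0.
case: ifP => tt; last first.
  rewrite mul0e; case: ifP => // _.
  by rewrite lee_fin mulr_ge0 ?divr_ge0 ?exprn_ge0 // ?ltW // root_inv_gt0.
rewrite ifT; last by rewrite inE /= in_itv /= t0 tt.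
apply: le_trans (lee_wpmul2l _ (area_base_le t0)) _; first by rewrite lee_fin.
rewrite -EFinM lee_fin.
have := root_inv_sqr (ltW t0); have := root_inv_gt0 t; move: (root_inv t) => b b0 hb.
have h1 : b ^+ 2 * t <= 1 by rewrite -hb ler_wpM2l ?sqr_ge0 // lerDl ltW.
have h2 : 0 <= b ^+ 2 * t by rewrite mulr_ge0 ?sqr_ge0 // ltW.
rewrite [leLHS](_ : _ = 4 / m ^+ 2 * b * ((b ^+ 2 * t) * (b ^+ 2 * t))); last by field; rewrite gt_eqF.
apply: ler_piMr; first by rewrite mulr_ge0 ?divr_ge0 ?exprn_ge0 // ltW.
by apply: mulr_ile1.
Qed.

End inverse_root.

Section divergence.

Lemma log_integral (s e : R) : 0 < s -> 0 < e ->
  (\int[lambda]_(t in `]0%R, s[) (t * ((2 * t + e)^-1) ^+ 2)%:E =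
    (4^-1 * ln (2 * s + e) + e / 4 * (2 * s + e)^-1 - (4^-1 * ln e + 4^-1))%:E)%E.
Proof.
move=> s0 e0.
(* The absolute value changes nothing for t > 0 and makes the integrand continuous on the whole
   line. *)
pose f (t : R) := t * ((2 * `|t| + e)^-1) ^+ 2.
pose F (t : R) := 4^-1 * ln (2 * t + e) + e / 4 * (2 * t + e)^-1.
have p0 (t : R) : 0 < 2 * `|t| + e by rewrite ltr_wpDl // mulr_ge0.
have cf : continuous f.
  move=> t; apply: cvgM; first exact: cvg_id.
  rewrite /GRing.exp /=; apply: cvgM; apply: cvgV; rewrite ?gt_eqF //;
    by apply: cvgD; [apply: cvgM; [exact: cvg_cst|exact: norm_continuous]|exact: cvg_cst].
have mf : measurable_fun [set: measurableTypeR R] (fun t => (f t)%:E).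
  by apply/measurable_EFinP; exact: continuous_measurable1.
have -> : (\int[lambda]_(t in `]0%R, s[) (t * ((2 * t + e)^-1) ^+ 2)%:E =
    \int[lambda]_(t in `]0%R, s[) (f t)%:E)%E.
  apply: eq_integral => t; rewrite inE /= in_itv /= => /andP[t0 _].
  by rewrite /f gtr0_norm.
rewrite integral_itv_obnd_cbnd; last exact: measurable_funTS.
rewrite integral_itv_bndo_bndc; last exact: measurable_funTS.
have dF (t : R) : - e < 2 * t -> is_derive t (1 : R) F (t * ((2 * t + e)^-1) ^+ 2).
  move=> t0; have te : 0 < 2 * t + e by lra.
  have ten : 2 * t + e != 0 by rewrite gt_eqF.
  have h1 : is_derive t (1 : R) (fun u : R => 2 * u + e) 2.
    apply: is_derive_eq (is_deriveD (is_deriveM (is_derive_cst (2 : R) t (1 : R))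
      (is_derive_id t (1 : R))) (is_derive_cst e t (1 : R))) _.
    by rewrite /GRing.scale /= mulr1 mulr0 !addr0.
  have h2 := is_derive1_comp (f := @ln R) (g := fun u : R => 2 * u + e) (is_derive1_ln te) h1.
  have h3 := is_deriveV (f := fun u : R => 2 * u + e) ten h1.
  have h4 := is_deriveM (is_derive_cst (4^-1 : R) t (1 : R)) h2.
  have h5 := is_deriveM (is_derive_cst (e / 4 : R) t (1 : R)) h3.
  apply: is_derive_eq (is_deriveD h4 h5) _.
  by rewrite /GRing.scale /= !mulr0 !addr0; field.
have cF (t : R) : - e < 2 * t -> {for t, continuous F}.
  move=> t0; apply: differentiable_continuous; apply/derivable1_diffP.
  by case: (dF t t0).
rewrite (@continuous_FTC2 _ f F) //.
- rewrite -EFinB /F mulr0 add0r; congr (_%:E).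
  by field; rewrite !gt_eqF //; lra.
- exact: continuous_subspaceT.
- split.
  + move=> t; rewrite in_itv /= => /andP[t0 _].
    have te : - e < 2 * t by lra.
    by case: (dF t te).
  + by apply: cvg_at_right_filter; apply: cF; lra.
  + by apply: cvg_at_left_filter; apply: cF; lra.
move=> t; rewrite in_itv /= => /andP[t0 _].
have te : - e < 2 * t by lra.
by rewrite derive1E; have [_ ->] := dF t te; rewrite /f gtr0_norm.
Qed.

Lemma measurable_log_kernel (e : R) : 0 < e ->
  measurable_fun [set: R2 R] (fun a => (((plane_norm a + e)^-1) ^+ 2)%:E).
Proof.
move=> e0.
apply/measurable_EFinP; apply: measurable_funX.
have mpe : measurable_fun [set: R2 R] (fun a => (plane_norm a + e : measurableTypeR R)).
  by apply: measurable_funD; [exact: measurable_plane_norm|exact: measurable_cst].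
pose iv (u : R) := (Num.max u e)^-1.
have civ : continuous iv.
  move=> u; apply: cvgV; first by rewrite gt_eqF // lt_max e0 orbT.
  by apply: (@continuous_max _ _ (fun s : R => s) (cst e)); [exact: cvg_id|exact: cvg_cst].
rewrite (_ : (fun a => _) = iv \o (fun a => plane_norm a + e)).
  exact: (measurableT_comp (continuous_measurable1 civ) mpe).
apply/funext => a /=; rewrite /iv max_l // lerDr; exact: plane_norm_ge0.
Qed.

(** Polar coordinates are avoided: on the triangle 0 < a2 < a1 < s one has |a| <= 2 a1, so
    integrating in a2 leaves at least t / (2 t + e)^2 with t = a1, whose integral grows like (1/4)
    ln (1 / e). *)
Lemma log_divergence (sigma C : R) : 0 < sigma ->
  exists e, 0 < e <= 1 /\
   (C%:E < \int[area]_(a in base rho sigma) (((plane_norm a + e)^-1) ^+ 2)%:E)%E.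
Proof.
move=> sigma0.
(* With this [s], |a| <= 2 a1 < sigma / m puts the triangle inside [base rho sigma]. *)
pose s := sigma / (2 * m).
have s0 : 0 < s by rewrite divr_gt0 // mulr_gt0.
(* The exponent makes ln e <= ln (2 s) - (4 C + 2), so that the integral exceeds C by at least
   1/4. *)
pose e := Num.min 1 (2 * s * expR (- (4 * C + 2))).
have e0 : 0 < e.
  by rewrite /e lt_min ltr01 /=; apply: mulr_gt0; [exact: mulr_gt0|exact: expR_gt0].
exists e; split; first by rewrite e0 /= ge_min lexx.
pose T : set (R2 R) := [set a | (`]0%R, s[%classic : set R) a.1 /\ (`]0%R, a.1[%classic : set R) a.2].
have mT : measurable T.
  rewrite (_ : T = [set: R2 R] `&` fst @^-1` (`]0%R, s[%classic : set (measurableTypeR R)) `&`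
     ([set: R2 R] `&` (fun a : R2 R => (a.1 - a.2 : measurableTypeR R)) @^-1` `]0%R, +oo[%classic `&`
      ([set: R2 R] `&` snd @^-1` (`]0%R, +oo[%classic : set (measurableTypeR R))))).
    apply: measurableI; first by apply: measurable_fst => //; exact: measurable_itv.
    apply: measurableI; last by apply: measurable_snd => //; exact: measurable_itv.
    have md : measurable_fun [set: R2 R] (fun a : R2 R => (a.1 - a.2 : measurableTypeR R)).
      by apply: measurable_funB; [exact: measurable_fst|exact: measurable_snd].
    by apply: md => //; exact: measurable_itv.
  apply/seteqP; split => a; rewrite /T /= !in_itv /= !andbT subr_gt0.
    by move=> [/andP[h1 h2] /andP[h3 h4]]; rewrite h1 h2 h3 h4.
  by move=> [[_ ->] [[_ ->] [_ ->]]].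
have Tsub : T `<=` base rho sigma.
  move=> a [] /=; rewrite !in_itv /= => /andP[a1 as_] /andP[a2 a21].
  rewrite /base /rho /= -ltr_pdivlMl // mulrC.
  have nn : plane_norm a <= 2 * a.1.
    rewrite -(@ler_pXn2r R 2) ?nnegrE ?plane_norm_ge0 //; last by rewrite mulr_ge0 // ltW.
    by rewrite plane_norm_sqr; nra.
  apply: le_lt_trans nn _; rewrite (_ : sigma / m = 2 * s); first by lra.
  by rewrite /s; field; rewrite gt_eqF.
have mp := measurable_log_kernel e0.
apply: (@lt_le_trans _ _ (\int[area]_(a in T) (((plane_norm a + e)^-1) ^+ 2)%:E)%E); last first.
  apply: (ge0_subset_integral area mT (measurable_base measurable_rho sigma) _ _ Tsub).
    exact: measurable_funTS.
  by move=> a _; rewrite lee_fin sqr_ge0.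
pose g : R2 R -> \bar R := (fun a => (((plane_norm a + e)^-1) ^+ 2)%:E) \_ T.
have mg : measurable_fun setT g by apply/(measurable_restrictT _ mT); exact: measurable_funTS.
have g0 a : (0 <= g a)%E by rewrite /g patchE; case: ifP => // _; rewrite lee_fin sqr_ge0.
rewrite integral_mkcond.
have -> : (\int[area]_a g a = \int[lambda]_s \int[lambda]_t g (s, t))%E.
  exact: (@fubini_tonelli1 _ _ _ _ _ lambda lambda g mg g0).
have mF := @measurable_fun_fubini_tonelli_F _ _ _ _ _ lambda g mg g0.
apply: (@lt_le_trans _ _ (\int[lambda]_(t in `]0%R, s[) (t * ((2 * t + e)^-1) ^+ 2)%:E)%E).
  rewrite log_integral // lte_fin.
  have h1 : ln (2 * s) <= ln (2 * s + e).
    by rewrite ler_ln ?posrE; move: s0 e0; move: (s) (e) => a b; lra.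
  have h2 : ln e <= ln (2 * s) - (4 * C + 2).
    have ss : 0 < 2 * s by exact: mulr_gt0.
    rewrite -[X in _ <= _ + X](expRK (- (4 * C + 2))) -lnM ?posrE ?expR_gt0 //.
    have le : e <= 2 * s * expR (- (4 * C + 2)) by rewrite /e ge_min lexx orbT.
    have pe : 0 < 2 * s * expR (- (4 * C + 2)) by apply: mulr_gt0 => //; exact: expR_gt0.
    by rewrite ler_ln ?posrE.
  have h3 : 0 < e / 4 * (2 * s + e)^-1.
    by rewrite mulr_gt0 ?divr_gt0 // invr_gt0 addr_gt0 // mulr_gt0.
  by lra.
rewrite integral_mkcond.
have piv (t : R) : 0 < t -> 0 < 2 * t + e by move=> t0; rewrite addr_gt0 // mulr_gt0.
have sq0 (t : R) : 0 < t -> 0 <= t * ((2 * t + e)^-1) ^+ 2.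
  by move=> t0; rewrite mulr_ge0 ?sqr_ge0 // ltW.
have inner (t : R) : 0 < t -> t < s ->
   ((t * ((2 * t + e)^-1) ^+ 2)%:E <= \int[lambda]_u g (t, u))%E.
  move=> t0 ts.
  have -> : (\int[lambda]_u g (t, u) = \int[lambda]_(u in `]0%R, t[) g (t, u))%E.
    rewrite [RHS]integral_mkcond; apply: eq_integral => u _; rewrite patchE.
    case: ifP => // /negP ut; rewrite /g patchE ifF //; apply/negbTE/negP.
    by rewrite !in_setE => -[_ h]; apply: ut; rewrite in_setE.
  rewrite (_ : (_ * _)%:E = \int[lambda]_(u in `]0%R, t[) (((2 * t + e)^-1) ^+ 2)%:E)%E; last first.
    by rewrite (integral_itv_oo_cst _ t0) subr0 mulrC.
  apply: (ge0_le_integral lambda (measurable_itv _)).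
  - by move=> u _; rewrite lee_fin sqr_ge0.
  - exact: measurable_cst.
  - apply: measurable_funTS.
    exact: (measurableT_comp mg (measurable_fun_pair (measurable_cst t) (@measurable_id _ _ _))).
  move=> u ut; rewrite /g patchE ifT; last first.
    by rewrite in_setE /T /= in_itv /= t0 ts.
  move: ut; rewrite /= in_itv /= => /andP[u0 ut].
  rewrite lee_fin lerXn2r ?nnegrE ?invr_ge0 //.
  - by rewrite ltW // piv.
  - by rewrite addr_ge0 ?plane_norm_ge0 // ltW.
  rewrite lef_pV2 ?posrE ?piv //; last by rewrite ltr_wpDl ?plane_norm_ge0.
  rewrite lerD2r -(@ler_pXn2r R 2) ?nnegrE ?plane_norm_ge0 //; last by rewrite mulr_ge0 // ltW.
  by rewrite plane_norm_sqr /=; nra.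
have mh : measurable_fun [set: measurableTypeR R] ((fun t => (t * ((2 * t + e)^-1) ^+ 2)%:E) \_ `]0%R, s[).
  apply/(measurable_restrictT _ (measurable_itv _)).
  pose f (t : R) := t * ((2 * `|t| + e)^-1) ^+ 2.
  have cf : continuous f.
    move=> t; apply: cvgM; first exact: cvg_id.
    have pt : 0 < 2 * `|t| + e by rewrite ltr_wpDl // mulr_ge0.
    rewrite /GRing.exp /=; apply: cvgM; apply: cvgV; rewrite ?gt_eqF //;
      by apply: cvgD; [apply: cvgM; [exact: cvg_cst|exact: norm_continuous]|exact: cvg_cst].
  apply/(measurable_fun_eqP (fun t => (f t)%:E)).
    move=> t; rewrite in_setE /= in_itv /= => /andP[t0 _]; by rewrite /f gtr0_norm.
  by apply: measurable_funTS; apply/measurable_EFinP; exact: continuous_measurable1.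
apply: (ge0_le_integral lambda measurableT) => //.
- move=> t _; rewrite patchE; case: ifP => //.
  by rewrite in_setE /= in_itv /= => /andP[t0 _]; rewrite lee_fin sq0.
- move=> t _; rewrite patchE; case: ifP => [|_].
    by rewrite in_setE /= in_itv /= => /andP[t0 ts]; exact: inner.
  by apply: integral_ge0 => u _; exact: g0.
Qed.

End divergence.

End cone_estimates.

Section real_integrability.
Context d (T : measurableType d) (R : realType) (mu : {measure set T -> \bar R}).
Implicit Types (D : set T) (p q : T -> R).
Local Open Scope ereal_scope.

Lemma integrable_bounded_mul D p q (M : R) : measurable D ->
  mu.-integrable D (EFin \o p) -> measurable_fun D q ->
  (forall x, D x -> `|q x| <= M)%R ->
  mu.-integrable D (fun x => (p x * q x)%:E).
Proof.
move=> mD ip mq qM.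
have mp : measurable_fun D p by apply/measurable_EFinP; exact: measurable_int ip.
apply: (le_integrable mD _ _ (integrableZl mD M ip)).
  by apply/measurable_EFinP; exact: measurable_funM.
move=> x Dx; rewrite /= lee_fin !normrM mulrC ler_wpM2r //.
by apply: le_trans (qM _ Dx) _; exact: ler_norm.
Qed.

Lemma integrable_affine_bound D p q (K : R) : measurable D -> mu D < +oo ->
  measurable_fun D p -> measurable_fun D q -> (forall x, 0 <= q x)%R -> (0 <= K)%R ->
  \int[mu]_(x in D) (q x)%:E < +oo ->
  (forall x, D x -> `|p x| <= K * (1 + q x))%R ->
  mu.-integrable D (EFin \o p).
Proof.
move=> mD Doo mp mq q0 K0 qoo pq.
have iq : mu.-integrable D (fun x => (1 + q x)%:E).
  apply: (integrableD mD (f := fun=> 1%:E) (g := fun x => (q x)%:E)).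
    apply/integrableP; split; first exact: measurable_cst.
    rewrite (eq_integral (cst 1%:E)); last by move=> x _; rewrite /= normr1.
    by rewrite (integral_cst mu mD) mul1e.
  apply/integrableP; split; first exact/measurable_EFinP.
  rewrite (eq_integral (fun x => (q x)%:E)); first exact: qoo.
  by move=> x _; rewrite /= ger0_norm.
apply: (le_integrable mD _ _ (integrableZl mD K iq)); first exact/measurable_EFinP.
move=> x Dx; rewrite /= lee_fin normrM (ger0_norm K0) (ger0_norm (_ : 0 <= 1 + q x)%R).
  exact: pq.
by rewrite addr_ge0.
Qed.

Lemma integrable_sqr D p : measurable D -> mu D < +oo -> measurable_fun D p ->
  \int[mu]_(x in D) ((p x ^+ 2)%:E) < +oo -> mu.-integrable D (EFin \o p).
Proof.
move=> mD Doo mp poo.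
apply: (integrable_affine_bound (K := 1%R) (q := fun x => (p x ^+ 2)%R)) => //.
- exact: measurable_funX.
- by move=> x; rewrite sqr_ge0.
move=> x _; rewrite mul1r -(real_normK (num_real (p x))).
by move: `|p x|%R (normr_ge0 (p x)) => y y0; nra.
Qed.

End real_integrability.

Lemma continuous_gap {R : realType} (m : R) : continuous (fun x : R3 R => x.2 - rho m x.1 : R).
Proof.
have s2 : sm (fun x : R3 R => x.1.1 ^+ 2 + x.1.2 ^+ 2).
  by apply: sm_add; apply: sm_exp; [exact: sm_c1|exact: sm_c2].
move=> x; apply: cvgB; first exact: (sm_continuous (@sm_c3 R)).
apply: cvgM; first exact: cvg_cst.
apply: (@continuous_comp _ _ _ (fun x : R3 R => x.1.1 ^+ 2 + x.1.2 ^+ 2) Num.sqrt).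
  exact: (sm_continuous s2).
exact: sqrt_continuous.
Qed.

(** * A cutoff along the conic boundary *)

Section layer.
Context {R : realType}.
Variables m t : R.
Hypotheses (m0 : 0 < m) (t0 : 0 < t).
Implicit Types (x : R3 R) (i : 'I_3).

(** The plane norm smoothed at the axis. It exceeds the plane norm by at most [t], so that [height]
    is nonpositive as long as x3 - rho <= t and at least 1 once x3 - rho >= (m + 2) t. *)
Definition soft_norm x : R := Num.sqrt (x.1.1 ^+ 2 + x.1.2 ^+ 2 + t ^+ 2).
Definition height x : R := (x.2 - m * soft_norm x) / t - 1.

(* A smooth cutoff whose gradient lives in the layer
   [t <= x.2 - rho m x.1 <= (m + 2) t] and is there of order [1 / t]. *)
Definition kap x : R := step (height x).

Let t2 : 0 < t ^+ 2. Proof. by rewrite exprn_gt0. Qed.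

Let q0 x : 0 < x.1.1 ^+ 2 + x.1.2 ^+ 2 + t ^+ 2.
Proof. by rewrite ltr_wpDl // addr_ge0 ?sqr_ge0. Qed.

Let sm_q : sm (fun x : R3 R => x.1.1 ^+ 2 + x.1.2 ^+ 2 + t ^+ 2).
Proof.
apply: sm_add; last exact: sm_cst.
by apply: sm_add; apply: sm_exp; [exact: sm_c1|exact: sm_c2].
Qed.

Lemma sm_height : sm height.
Proof.
apply: sm_sub; last exact: sm_cst.
apply: sm_mul; last exact: sm_cst.
apply: sm_sub; first exact: sm_c3.
by apply: sm_mul; [exact: sm_cst|exact: sm_sqrt].
Qed.

Lemma sm_kap : sm kap. Proof. exact: (sm_step sm_height). Qed.

Lemma soft_norm_ge x : plane_norm x.1 <= soft_norm x.
Proof. by rewrite /plane_norm /soft_norm ler_wsqrtr // lerDl ltW. Qed.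

Lemma soft_norm_le x : soft_norm x <= plane_norm x.1 + t.
Proof.
rewrite -(@ler_pXn2r _ 2) ?nnegrE ?sqrtr_ge0 ?addr_ge0 ?plane_norm_ge0 ?(ltW t0) //.
rewrite {1}/soft_norm sqr_sqrtr ?(ltW (q0 x)) // sqrrD plane_norm_sqr lerD2r lerDl.
by rewrite mulrn_wge0 // mulr_ge0 ?plane_norm_ge0 // ltW.
Qed.

Lemma soft_norm_gt0 x : 0 < soft_norm x. Proof. by rewrite sqrtr_gt0. Qed.

Lemma kap_eq0 x : x.2 <= rho m x.1 + t -> kap x = 0.
Proof.
move=> h; rewrite /kap step_eq0 // /height subr_le0 ler_pdivrMr // mul1r.
have := soft_norm_ge x; rewrite -(ler_pM2l m0) => h1.
by move: h h1; rewrite /rho; lra.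
Qed.

Lemma height_ge1 x : (m + 2) * t <= x.2 - rho m x.1 -> 1 <= height x.
Proof.
move=> h; rewrite /height lerBrDr ler_pdivlMr //.
have := soft_norm_le x; rewrite -(ler_pM2l m0) => h1.
by move: h h1; rewrite /rho; lra.
Qed.

Lemma kap_eq1 x : (m + 2) * t <= x.2 - rho m x.1 -> kap x = 1.
Proof. by move=> /height_ge1; exact: step_eq1. Qed.

Lemma partial_kap i x : partial i kap x = dstep (height x) * partial i height x.
Proof.
apply: partial_eq; apply: (is_derive_comp_dir (is_derive_step _)).
exact: sm_derivable sm_height.
Qed.

Lemma partial_kap_eq0 i x : (m + 2) * t <= x.2 - rho m x.1 -> partial i kap x = 0.
Proof. by move=> /height_ge1 h; rewrite partial_kap dstep_eq1 // mul0r. Qed.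

Lemma partial_height_le i x : `|partial i height x| <= (1 + m) / t.
Proof.
have sn : 0 < soft_norm x := soft_norm_gt0 x.
have v1 := is_derive_c1 x (unitvec i); have v2 := is_derive_c2 x (unitvec i).
have v3 := is_derive_c3 x (unitvec i).
have dq : is_derive x (unitvec i) (fun x : R3 R => x.1.1 ^+ 2 + x.1.2 ^+ 2 + t ^+ 2)
   (2 * (x.1.1 * (unitvec i : R3 R).1.1 + x.1.2 * (unitvec i : R3 R).1.2)).
  have h := is_derive_add_dir (is_derive_add_dir (is_derive_mul_dir v1 v1)
     (is_derive_mul_dir v2 v2)) (is_derive_cst (t ^+ 2) x (unitvec i)).
  by apply: is_derive_eq h _; ring.
have ds : is_derive x (unitvec i) soft_norm ((soft_norm x)^-1 *
    (x.1.1 * (unitvec i : R3 R).1.1 + x.1.2 * (unitvec i : R3 R).1.2)).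
  apply: is_derive_eq (is_derive_sqrt_dir (q0 x) dq) _.
  rewrite -/(soft_norm x); move: (soft_norm x) sn => s s0; field; rewrite gt_eqF //.
have dh : is_derive x (unitvec i) height (t^-1 * ((unitvec i : R3 R).2 -
    m * ((soft_norm x)^-1 *
    (x.1.1 * (unitvec i : R3 R).1.1 + x.1.2 * (unitvec i : R3 R).1.2)))).
  have h1 := is_derive_mul_dir (is_derive_cst (- m) x (unitvec i)) ds.
  have h2 := is_derive_mul_dir (is_derive_add_dir v3 h1) (is_derive_cst (t^-1) x (unitvec i)).
  have h3 := is_derive_add_dir h2 (is_derive_cst (- 1 : R) x (unitvec i)).
  rewrite (_ : height = (fun y => (y.2 + cst (- m) y * soft_norm y) * cst t^-1 y + cst (-1) y)).
    apply: is_derive_eq h3 _; rewrite /cst; ring.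
  by apply/funext => y; rewrite /height /cst mulNr.
rewrite (partial_eq dh) normrM gtr0_norm ?invr_gt0 // mulrC.
apply: ler_wpM2r; first by rewrite invr_ge0 ltW.
have n1 := plane_norm_fst x.1; have n2 := plane_norm_snd x.1.
have ns := soft_norm_ge x.
have b1 : `|(soft_norm x)^-1 * x.1.1| <= 1.
  rewrite normrM gtr0_norm ?invr_gt0 // mulrC ler_pdivrMr // mul1r.
  exact: le_trans n1 ns.
have b2 : `|(soft_norm x)^-1 * x.1.2| <= 1.
  rewrite normrM gtr0_norm ?invr_gt0 // mulrC ler_pdivrMr // mul1r.
  exact: le_trans n2 ns.
rewrite unitvec1 unitvec2 unitvec3.
case: (ord3_cases i) => -> /=; rewrite !(mulr1, mulr0, addr0, add0r, sub0r, subr0).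
- rewrite normrN normrM gtr0_norm // (le_trans (ler_wpM2l (ltW m0) b1)) // mulr1.
  by rewrite lerDr.
- rewrite normrN normrM gtr0_norm // (le_trans (ler_wpM2l (ltW m0) b2)) // mulr1.
  by rewrite lerDr.
by rewrite normr1 lerDl ltW.
Qed.

Lemma partial_kap_le B i x : 0 <= B -> (forall s : R, `|dstep s| <= B) ->
  `|partial i kap x| <= B * (1 + m) / t.
Proof.
move=> B0 hB; rewrite partial_kap normrM -mulrA.
by apply: ler_pM; rewrite ?normr_ge0 //; exact: partial_height_le.
Qed.

End layer.

(** * Green's inequality near the conic boundary *)

Section green.
Context {R : realType}.
Local Notation lambda := (@lebesgue_measure R).
Variable m : R.
Hypothesis m0 : 0 < m.
Implicit Types (x : R3 R) (i : 'I_3).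

Let mrho : measurable_fun setT (rho m) := measurable_rho m.

Definition layer (c : R) : set (R3 R) := [set x | x.2 - rho m x.1 < c].

Lemma measurable_layer c : measurable (layer c).
Proof.
rewrite (_ : layer c = setT `&` (fun x : R3 R => (x.2 - rho m x.1)%R : measurableTypeR R)
   @^-1` `]-oo, c[%classic); first exact: (measurable_gap mrho).
by rewrite setTI; apply/seteqP; split => x; rewrite /layer /= in_itv.
Qed.

Lemma measurable_layer_slice c a :
  measurable_fun [set: measurableTypeR R] (fun s => \1_(layer c) ((a, s) : R3 R) : R).
Proof.
have h : measurable_fun [set: R3 R] (\1_(layer c) : R3 R -> R).
  by apply: measurable_indic; exact: measurable_layer.
exact: (measurableT_comp h (measurable_fun_pair (measurable_cst a) (@measurable_id _ _ _))).
Qed.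

Lemma layer_slice_le (b c tau : R) a (g : R -> R) : 0 < c -> 0 <= b ->
  measurable_fun [set: measurableTypeR R] (g : R -> measurableTypeR R) ->
  (forall s, rho m a < s -> s - rho m a < c -> 0 <= g s <= b) ->
  (\int[lambda]_(s in `]rho m a, tau[) (g s * \1_(layer c) ((a, s) : R3 R))%:E <= (b * c)%:E)%E.
Proof.
move=> c0 b0 mg gb.
have ab : rho m a < rho m a + c by rewrite ltrDl.
have mh : measurable_fun [set: measurableTypeR R]
    (fun s => (g s * \1_(layer c) ((a, s) : R3 R))%:E).
  apply/measurable_EFinP; apply: measurable_funM => //; exact: measurable_layer_slice.
have h0 s : rho m a < s -> (0 <= (g s * \1_(layer c) ((a, s) : R3 R))%:E)%E.
  move=> as_; rewrite lee_fin indicE; case: (boolP (_ \in _)); last by rewrite mulr0.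
  by rewrite in_setE /layer /= mulr1 => sc; case/andP: (gb _ as_ sc).
have -> : (b * c)%:E = (\int[lambda]_(s in `]rho m a, (rho m a + c)%R[) b%:E)%E.
  by rewrite integral_itv_oo_cst // addrAC subrr add0r.
rewrite [leLHS]integral_mkcond [leRHS]integral_mkcond.
apply: (ge0_le_integral lambda measurableT).
- by move=> s _; rewrite patchE; case: ifP => //; rewrite in_setE /= in_itv /= => /andP[? _]; exact: h0.
- apply/(measurable_restrictT _ (measurable_itv _)); exact: measurable_funTS.
- apply/(measurable_restrictT _ (measurable_itv _)); exact: measurable_cst.
move=> s _; rewrite !patchE; case: ifP => sI; last first.
  by case: ifP => // _; rewrite lee_fin.
move: sI; rewrite in_setE /= in_itv /= => /andP[as_ _].
rewrite indicE; case: (boolP (_ \in _)) => [|_]; last first.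
  by rewrite mulr0; case: ifP => // _; rewrite lee_fin.
rewrite in_setE /layer /= => sc; rewrite ifT.
  by rewrite mulr1 lee_fin; case/andP: (gb _ as_ sc).
by rewrite in_setE /= in_itv /= as_ addrC -ltrBlDr.
Qed.

Lemma volume_layer_le tau c : 0 < c ->
  (\int[volume]_(x in above (rho m) tau) (\1_(layer c) x)%:E <=
   c%:E * area (base (rho m) tau))%E.
Proof.
move=> c0; rewrite (above_fubini mrho); last 2 first.
- apply: measurable_funTS; apply/measurable_EFinP; apply: measurable_indic; exact: measurable_layer.
- by move=> x _; rewrite lee_fin.
rewrite -(integral_cst area (measurable_base mrho tau)).
apply: (ge0_le_integral area (measurable_base mrho tau)).
- by move=> a _; apply: integral_ge0 => s _; rewrite lee_fin.
- apply: (measurable_above_integral mrho (f := fun x => (\1_(layer c) x)%:E)).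
    by apply: measurable_funTS; apply/measurable_EFinP; apply: measurable_indic; exact: measurable_layer.
  by move=> x _; rewrite lee_fin.
- exact: measurable_cst.
move=> a _; rewrite -[X in X%:E]mul1r.
have := @layer_slice_le 1 c tau a (cst 1) c0 ler01 (measurable_cst _).
rewrite /cst; under eq_integral do rewrite mul1r.
by apply => s _ _; rewrite ler01 lexx.
Qed.

Lemma volume_above_lty tau : 0 < tau -> (volume (above (rho m) tau) < +oo)%E.
Proof.
move=> tau0; have mY := measurable_above mrho tau.
have Ysub x : above (rho m) tau x -> \1_(layer tau) x = 1 :> R.
  move=> /andP[h1 h2]; rewrite indicE mem_set //.
  by rewrite /layer /= (le_lt_trans _ h2) // gerBl rho_ge0.
have -> : (volume (above (rho m) tau) =
    \int[volume]_(x in above (rho m) tau) (\1_(layer tau) x)%:E)%E.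
  rewrite -[LHS]mul1e -(integral_cst volume mY).
  by apply: eq_integral => x; rewrite in_setE => Yx; rewrite Ysub.
apply: le_lt_trans (volume_layer_le tau tau0) _.
rewrite lte_mul_pinfty // ?lee_fin ?ltW //.
by apply: le_lt_trans (area_base_le m0 tau0) _; rewrite ltry.
Qed.

Lemma sm_bounded f (c : R) : sm f -> (forall x, c < enorm x -> f x = 0) ->
  exists2 B : R, 0 <= B & forall x, `|f x| <= B.
Proof.
move=> sf f0; have [B B0 hB] := @continuous_bounded_ball R f c (sm_continuous sf).
exists B => // x; have [|xc] := leP (enorm x) c; first exact: hB.
by rewrite f0 // normr0.
Qed.

Section estimate.
Variables (tau r : R) (U : R3 R -> R) (dU : 'I_3 -> R3 R -> R) (phi : R3 R -> R).
Variable D : R.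
Hypothesis D0 : 0 <= D.
Hypothesis tau0 : 0 < tau.
Hypothesis r_tau : r < tau.
Local Notation Y := (above (rho m) tau).
Hypothesis mU : measurable_fun Y U.
Hypothesis mdU : forall i, measurable_fun Y (dU i).
Hypothesis U2 : (\int[volume]_(x in Y) (U x ^+ 2)%:E < +oo)%E.
Hypothesis dU2 : forall i, (\int[volume]_(x in Y) (dU i x ^+ 2)%:E < +oo)%E.
Hypothesis weak : forall i psi, test_function Y psi ->
  (\int[volume]_(x in Y) (U x * partial i psi x + dU i x * psi x)%:E = 0)%E.
Hypothesis hardy : forall (B M : R) (W : R3 R -> R), 0 <= M ->
  measurable_fun setT W -> (forall x, 0 <= W x <= B) ->
  (forall a, base (rho m) tau a ->
     (\int[lambda]_(s in `]rho m a, tau[) ((s - rho m a) * W (a, s))%:E <= M%:E)%E) ->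
  (\int[volume]_(x in Y) (U x ^+ 2 * W x)%:E <= (8 * M * D)%:E)%E.
Hypothesis sphi : sm phi.
Hypothesis phi0 : forall x, r < enorm x -> phi x = 0.

Let mY : measurable Y := measurable_above mrho tau.

Let area_lty : (area (base (rho m) tau) < +oo)%E.
Proof. by apply: le_lt_trans (area_base_le m0 tau0) _; rewrite ltry. Qed.

Let volume_lty := volume_above_lty tau0.

Let iU : volume.-integrable Y (EFin \o U). Proof. exact: integrable_sqr. Qed.

Let idU i : volume.-integrable Y (EFin \o dU i). Proof. exact: integrable_sqr. Qed.

Let mcont (f : R3 R -> R) : sm f -> measurable_fun Y f.
Proof. by move=> sf; apply: measurable_funTS; apply: continuous_measurable3; exact: sm_continuous. Qed.

(** [kap] vanishes up to height [t] above the graph and [phi] where |x| > r, with r < tau; the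
    support is therefore a compact subset of the open solid. *)
Let cutoff_test t i : 0 < t -> test_function Y (fun x => kap m t x * partial i phi x).
Proof.
move=> t0; have sk := sm_kap m t0.
have sp : sm (fun x => kap m t x * partial i phi x) by apply: sm_mul => //; exact: sm_partial.
have z0 x : r < enorm x -> kap m t x * partial i phi x = 0.
  by move=> xr; rewrite (partial_outside i phi0) // mulr0.
have [cs ss] := supp_compact z0.
split => // [|x xs]; first exact: sm_smooth.
have xt : rho m x.1 + t <= x.2.
  have cl : closed [set x : R3 R | t <= x.2 - rho m x.1].
    rewrite (_ : [set x | _] = (fun x : R3 R => x.2 - rho m x.1) @^-1` `[t, +oo[%classic).
      by apply: closed_comp; [move=> y _; exact: continuous_gap|exact: interval_closed].
    by apply/seteqP; split => y /=; rewrite in_itv /= andbT.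
  have sub : supp (fun x => kap m t x * partial i phi x) `<=` [set x : R3 R | t <= x.2 - rho m x.1].
    have /closure_id -> := cl.
    apply: closureS => y /= y0; rewrite leNgt; apply: contra y0 => yt.
    by rewrite kap_eq0 ?mul0r // addrC -lerBlDr ltW.
  by have /= := sub _ xs; rewrite lerBrDl.
rewrite /above /= (lt_le_trans _ xt) ?ltrDl //=.
apply: le_lt_trans r_tau; apply: le_trans (ss _ xs).
by apply: le_trans (coord3_le_enorm x); exact: ler_norm.
Qed.

Lemma integrable_gradient :
  volume.-integrable Y (fun x => (\sum_(i < 3) dU i x * partial i phi x)%:E).
Proof.
rewrite (_ : (fun x => _) = fun x => (\sum_(i < 3) (dU i x * partial i phi x)%:E)%E); last first.
  by apply/funext => x; rewrite sumEFin.
apply: (integrable_sum mY) => i _.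
have [b _ hb] := sm_bounded (sm_partial i sphi) (partial_outside i phi0).
by apply: (integrable_bounded_mul (M := b)) => //; apply: mcont; exact: sm_partial.
Qed.

(** Weighted AM-GM, from (delta |y| - 1)^2 >= 0. *)
Let norm_le_sqr (y delta : R) : 0 < delta -> `|y| <= delta * y ^+ 2 + delta^-1.
Proof.
move=> d0; have dn : delta * delta^-1 = 1 by rewrite divff // gt_eqF.
rewrite -(real_normK (num_real y)); move: `|y| (normr_ge0 y) => n n0.
have : 0 <= (delta * n - 1) ^+ 2 * delta^-1 by rewrite mulr_ge0 ?sqr_ge0 // invr_ge0 ltW.
rewrite (_ : (delta * n - 1) ^+ 2 * delta^-1 =
  (delta * delta^-1) * (delta * n ^+ 2) - 2 * (delta * delta^-1) * n + delta^-1); last by ring.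
rewrite dn => h; rewrite -subr_ge0.
rewrite (_ : _ - n = 1 * (delta * n ^+ 2) - 2 * 1 * n + delta^-1 + n); last by ring.
exact: addr_ge0.
Qed.

(* Tested against [kap m t * partial i phi], the weak gradient gives the claim up to
   terms supported in the layer of width [(m + 2) t]. Weighted AM-GM bounds these by
   [delta] times integrals controlled by Hardy's inequality, plus [1 / delta] times the
   volume [O(t)] of the layer; then [t = delta ^ 2]. *)
Lemma green_approx : exists2 C : R, 0 <= C & forall delta : R, 0 < delta ->
  (`| \int[volume]_(x in Y) (\sum_(i < 3) dU i x * partial i phi x)%:E | <=
   \int[volume]_(x in Y) (`|U x| * `|laplacian phi x|)%:E + (C * delta)%:E)%E.
Proof.
have [B B0 hB] := @dstep_bounded R.
have pb i : exists2 b : R, 0 <= b & forall x, `|partial i phi x| <= b.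
  by apply: (sm_bounded (c := r)); [exact: sm_partial|exact: partial_outside].
have [L L0 hL] : exists2 L : R, 0 <= L & forall i x, `|partial i phi x| <= L.
  have [b0 b00 h0] := pb 0; have [b1 b10 h1] := pb 1; have [b2 b20 h2] := pb 2.
  exists (b0 + b1 + b2); first by rewrite !addr_ge0.
  move=> i x; case: (ord3_cases i) => ->.
  - by apply: le_trans (h0 x) _; rewrite -addrA lerDl addr_ge0.
  - by apply: le_trans (h1 x) _; rewrite addrAC lerDr addr_ge0.
  - by apply: le_trans (h2 x) _; rewrite lerDr addr_ge0.
pose G x := \sum_(i < 3) dU i x ^+ 2.
have mG : measurable_fun Y G.
  by apply: measurable_sum => i; exact: measurable_funX.
have G0 x : 0 <= G x by apply: sumr_ge0 => i _; exact: sqr_ge0.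
have Goo : (\int[volume]_(x in Y) (G x)%:E < +oo)%E.
  have -> : (\int[volume]_(x in Y) (G x)%:E =
      \sum_(i < 3) \int[volume]_(x in Y) (dU i x ^+ 2)%:E)%E.
    rewrite -(ge0_integral_sum volume mY).
    - by apply: eq_integral => x _; rewrite /G sumEFin.
    - by move=> i; apply/measurable_EFinP; exact: measurable_funX.
    - by move=> i x _; rewrite lee_fin sqr_ge0.
  by apply: lte_sum_pinfty => i _; exact: dU2.
pose b := B * (1 + m).
have b0 : 0 <= b by rewrite mulr_ge0 // addr_ge0 // ltW.
pose K := m + 2.
have K0 : 0 < K by rewrite addr_gt0.
pose g := fine (\int[volume]_(x in Y) (G x)%:E).
have gE : (\int[volume]_(x in Y) (G x)%:E)%E = g%:E.
  by rewrite fineK // ge0_fin_numE // integral_ge0 // => x _; rewrite lee_fin.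
have g0 : 0 <= g by rewrite fine_ge0 // integral_ge0 // => x _; rewrite lee_fin.
pose a := fine (area (base (rho m) tau)).
have aE : area (base (rho m) tau) = a%:E by rewrite fineK // ge0_fin_numE.
have a0 : 0 <= a by rewrite fine_ge0.
(* The three groups come from the energy of [dU], from Hardy's bound with first moment K^2, and from
   the volume of the layer, at most K t a, divided by delta, with t = delta^2. *)
exists (L * g + (3 * L * b * (8 * K ^+ 2 * D) + (3 * L + 3 * L * b) * (K * a))).
  have Kge0 := ltW K0.
  by do ?[by []|apply: addr_ge0|apply: mulr_ge0|apply: exprn_ge0].
move=> delta d0; pose t := delta ^+ 2; have t0 : 0 < t by rewrite exprn_gt0.
pose z : R3 R -> R := \1_(layer (K * t)).
have mz : measurable_fun setT z by apply: measurable_indic; exact: measurable_layer.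
have Kt0 : 0 < K * t by rewrite mulr_gt0.
pose W x := z x / t ^+ 2.
have mW : measurable_fun setT W by apply: measurable_funM => //; exact: measurable_cst.
have z01 x : 0 <= z x <= 1 by rewrite /z indicE; case: (_ \in _); rewrite ?ler01 ?lexx.
have t20 : 0 < t ^+ 2 by rewrite exprn_gt0.
have W0 x : 0 <= W x.
  by case/andP: (z01 x) => ? _; rewrite divr_ge0 // ltW.
have hW : (\int[volume]_(x in Y) (U x ^+ 2 * W x)%:E <= (8 * K ^+ 2 * D)%:E)%E.
  apply: (hardy (B := (t ^+ 2)^-1)) => //.
  - by rewrite sqr_ge0.
  - move=> x; rewrite W0 /=; case/andP: (z01 x) => _ ?.
    by rewrite /W ler_pdivrMr // mulVf // gt_eqF.
  move=> p _.
  have mg : measurable_fun [set: measurableTypeR R] (fun s : R => (s - rho m p) / t ^+ 2).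
    apply: measurable_funM; last exact: measurable_cst.
    by apply: measurable_funB; [exact: measurable_id|exact: measurable_cst].
  have gb s : rho m p < s -> s - rho m p < K * t -> 0 <= (s - rho m p) / t ^+ 2 <= K / t.
    move=> ps sK; rewrite divr_ge0 ?(ltW t20) ?subr_ge0 ?(ltW ps) //=.
    rewrite ler_pdivrMr // (_ : K / t * t ^+ 2 = K * t) ?(ltW sK) //.
    by field; rewrite gt_eqF.
  have := @layer_slice_le (K / t) (K * t) tau p _ Kt0 (divr_ge0 (ltW K0) (ltW t0)) mg gb.
  rewrite (_ : K / t * (K * t) = K ^+ 2); last by field; rewrite gt_eqF.
  under eq_integral do rewrite mulrAC -mulrA.
  by [].

pose T x := \sum_(i < 3) (U x * partial i (fun x => kap m t x * partial i phi x) x +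
   dU i x * (kap m t x * partial i phi x)).
pose A x := \sum_(i < 3) dU i x * partial i phi x.
have sk := sm_kap m t0.
have sp i : sm (partial i phi) by exact: sm_partial.
have skp i : sm (fun x => kap m t x * partial i phi x) by apply: sm_mul.
have iA : volume.-integrable Y (EFin \o A) := integrable_gradient.
have iTi i : volume.-integrable Y (fun x => (U x * partial i (fun x => kap m t x * partial i phi x) x +
   dU i x * (kap m t x * partial i phi x))%:E).
  have z0 x : r < enorm x -> kap m t x * partial i phi x = 0.
    by move=> xr; rewrite (partial_outside i phi0) // mulr0.
  have [c _ hc] := sm_bounded (skp i) z0.
  have [c' _ hc'] := sm_bounded (sm_partial i (skp i)) (partial_outside i z0).
  apply: (integrableD mY (f := fun x => (U x * partial i (fun x => kap m t x * partial i phi x) x)%:E)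
     (g := fun x => (dU i x * (kap m t x * partial i phi x))%:E)).
    apply: (integrable_bounded_mul (M := c')) => //; apply: mcont; exact: sm_partial.
  apply: (integrable_bounded_mul (M := c)) => //; exact: mcont.
have iT : volume.-integrable Y (EFin \o T).
  rewrite (_ : _ \o _ = fun x => \sum_(i < 3) (U x * partial i (fun x => kap m t x * partial i phi x) x +
   dU i x * (kap m t x * partial i phi x))%:E); last first.
    by apply/funext => x; rewrite /= sumEFin.
  exact: (integrable_sum mY).
have T0 : (\int[volume]_(x in Y) (T x)%:E = 0)%E.
  transitivity (\int[volume]_(x in Y) \sum_(i < 3) (U x * partial i (fun x => kap m t x * partial i phi x) x +
   dU i x * (kap m t x * partial i phi x))%:E)%E.
    by apply: eq_integral => x _; rewrite /T sumEFin.
  rewrite (integral_sum mY iTi) big1 // => i _; apply: weak; exact: cutoff_test.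
have -> : (\int[volume]_(x in Y) (A x)%:E = \int[volume]_(x in Y) ((A x)%:E - (T x)%:E))%E.
  by rewrite (integralB mY iA iT) T0 sube0.
have mA : measurable_fun Y A by apply/measurable_EFinP; exact: measurable_int iA.
have mT : measurable_fun Y T by apply/measurable_EFinP; exact: measurable_int iT.
have mAT : measurable_fun Y (fun x => A x - T x) by exact: measurable_funB.
apply: le_trans (le_abse_integral volume mY _) _; first exact/measurable_EFinP.
have mUa : measurable_fun Y (fun x => `|U x| * `|laplacian phi x|).
  apply: measurable_funM; first exact: measurableT_comp.
  apply: measurableT_comp => //; apply: measurable_sum => i.
  by apply: mcont; do 2 apply: sm_partial.
have mWY : measurable_fun Y W by exact: measurable_funTS.
have mzY : measurable_fun Y z by exact: measurable_funTS.
have mUW : measurable_fun Y (fun x => U x ^+ 2 * W x).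
  by apply: measurable_funM => //; exact: measurable_funX.
have UW0 x : 0 <= U x ^+ 2 * W x by rewrite mulr_ge0 ?sqr_ge0.
have z0 x : 0 <= z x by case/andP: (z01 x).
pose c3 := (3 * L + 3 * L * b) / delta.
have c30 : 0 <= c3 by do ?[exact: ltW|by []|apply: divr_ge0|apply: addr_ge0|apply: mulr_ge0].
pose s' x := (3 * L * b * delta) * (U x ^+ 2 * W x) + c3 * z x.
pose s x := (L * delta) * G x + 1 * s' x.
have c10 : 0 <= L * delta by rewrite mulr_ge0 // ltW.
have c20 : 0 <= 3 * L * b * delta by do ?[exact: ltW|by []|apply: mulr_ge0].
have s'0 x : 0 <= s' x by apply: addr_ge0; apply: mulr_ge0.
have s0 x : 0 <= s x by apply: addr_ge0; apply: mulr_ge0.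
have ms' : measurable_fun Y s'.
  by apply: measurable_funD; apply: measurable_funM => //; exact: measurable_cst.
have ms : measurable_fun Y s.
  by apply: measurable_funD; apply: measurable_funM => //; exact: measurable_cst.
have pointwise x : Y x -> `|A x - T x| <= `|U x| * `|laplacian phi x| + s x.
  move=> Yx; have lapE : laplacian phi x = \sum_(i < 3) partial i (partial i phi) x by [].
  pose k := kap m t x.
  (* The term in U * laplacian phi is the one that survives; the other two vanish off the layer,
     where kap = 1 and its gradient is 0. *)
  have AT : A x - T x = (1 - k) * (\sum_(i < 3) dU i x * partial i phi x) - U x * (k * laplacian phi x)
      - U x * (\sum_(i < 3) partial i phi x * partial i (kap m t) x).
    have -> : T x = U x * (k * laplacian phi x) +
        U x * (\sum_(i < 3) partial i phi x * partial i (kap m t) x) + k * A x.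
      rewrite lapE !mulr_sumr -!big_split /=; apply: eq_bigr => i _.
      rewrite (partialM _ _ sk (sp i)) -/k.
      by move: (partial i (partial i phi) x) (partial i (kap m t) x) (partial i phi x) => p q p'; ring.
    by rewrite /A; move: (bigop _ _ _) (bigop _ _ _) => p q; ring.
  have k0 : 0 <= k := step_ge0 _; have k1 : k <= 1 := step_le1 _.
  have nk : `|k * laplacian phi x| <= `|laplacian phi x|.
    by rewrite normrM (ger0_norm k0) ler_piMl.
  have sx0 := s0 x.
  have tri : `|A x - T x| <= `|U x| * `|laplacian phi x| +
     (`|(1 - k) * (\sum_(i < 3) dU i x * partial i phi x)| +
      `|U x * (\sum_(i < 3) partial i phi x * partial i (kap m t) x)|).
    rewrite AT; apply: le_trans (ler_normB _ _) _.
    rewrite addrA lerD2r; apply: le_trans (ler_normB _ _) _.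
    by rewrite [leLHS]addrC lerD2r normrM ler_wpM2l.
  apply: le_trans tri _; rewrite lerD2l.
  have [zx|zx] := boolP (x \in layer (K * t)); last first.
    have xK : K * t <= x.2 - rho m x.1.
      by rewrite leNgt; apply: contra zx => h; rewrite in_setE.
    rewrite /k (kap_eq1 m0 t0 xK) subrr mul0r normr0 add0r big1 ?mulr0 ?normr0 //.
    by move=> i _; rewrite (partial_kap_eq0 m0 t0) ?mulr0.
  have zE : z x = 1 by rewrite /z indicE zx.
  have h1 : `|(1 - k) * (\sum_(i < 3) dU i x * partial i phi x)| <=
      L * (delta * G x + 3 * delta^-1).
    rewrite normrM ger0_norm ?subr_ge0 //.
    apply: (@le_trans _ _ `|\sum_(i < 3) dU i x * partial i phi x|).
      by rewrite ler_piMl // gerBl.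
    apply: le_trans (ler_norm_sum _ _ _) _.
    apply: (@le_trans _ _ (\sum_(i < 3) (L * (delta * dU i x ^+ 2 + delta^-1)))).
      apply: ler_sum => i _; rewrite normrM mulrC.
      by apply: ler_pM => //; exact: norm_le_sqr.
    by rewrite -mulr_sumr big_split /= -mulr_sumr sumr_const card_ord -[_ *+ 3]mulr_natl.
  have h2 : `|U x * (\sum_(i < 3) partial i phi x * partial i (kap m t) x)| <=
      (3 * L * b) * (delta * (U x ^+ 2 / t ^+ 2) + delta^-1).
    have sl : `|\sum_(i < 3) partial i phi x * partial i (kap m t) x| <= 3 * (L * (b / t)).
      apply: le_trans (ler_norm_sum _ _ _) _.
      rewrite -[leRHS](_ : \sum_(i < 3) (L * (b / t)) = _); last first.
        by rewrite sumr_const card_ord -[_ *+ 3]mulr_natl.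
      apply: ler_sum => i _; rewrite normrM; apply: ler_pM => //.
      by rewrite /b; exact: partial_kap_le.
    rewrite normrM; apply: le_trans (ler_wpM2l (normr_ge0 _) sl) _.
    have ti : 0 < t^-1 by rewrite invr_gt0.
    have := norm_le_sqr (U x / t) d0; rewrite normrM (gtr0_norm ti) exprMn exprVn => ut.
    rewrite (_ : `|U x| * (3 * (L * (b / t))) = 3 * L * b * (`|U x| * t^-1)); last by ring.
    by apply: ler_wpM2l => //; do ?[by []|apply: mulr_ge0].
  apply: le_trans (lerD h1 h2) _.
  rewrite /s /s' /W /c3 zE; rewrite le_eqVlt; apply/orP; left; apply/eqP.
  by rewrite div1r; move: (t ^+ 2)^-1 (G x) (U x ^+ 2) delta^-1 => w p q e; ring.
have I1 : (\int[volume]_(x in Y) `|(A x)%:E - (T x)%:E| <=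
   1%:E * \int[volume]_(x in Y) (`|U x| * `|laplacian phi x|)%:E +
   1%:E * \int[volume]_(x in Y) (s x)%:E)%E.
  apply: (@le_integral2 _ _ _ volume Y (fun x => `|A x - T x|)) => //.
  - exact: measurableT_comp.
  by move=> x Yx; rewrite !mul1r; exact: pointwise.
apply: le_trans I1 _; rewrite !mul1e leeD2l //.
have I2 := @le_integral2 _ _ _ volume Y s G s' (L * delta) 1 mY c10 ler01 ms mG ms'
  (fun x _ => s0 x) (fun x _ => G0 x) (fun x _ => s'0 x) (fun x _ => lexx _).
have I3 := @le_integral2 _ _ _ volume Y s' (fun x => U x ^+ 2 * W x) z _ _ mY c20 c30 ms' mUW mzY
  (fun x _ => s'0 x) (fun x _ => UW0 x) (fun x _ => z0 x) (fun x _ => lexx _).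
apply: le_trans I2 _; rewrite mul1e gE.
apply: le_trans (leeD2l _ I3) _.
have hz : (\int[volume]_(x in Y) (z x)%:E <= (K * t * a)%:E)%E.
  by rewrite EFinM -aE; exact: volume_layer_le.
apply: (@le_trans _ _ ((L * delta)%:E * g%:E + ((3 * L * b * delta)%:E * (8 * K ^+ 2 * D)%:E +
   c3%:E * (K * t * a)%:E))%E).
  by apply: leeD2l; apply: leeD; apply: lee_wpmul2l; rewrite ?lee_fin.
rewrite -!EFinM -!EFinD lee_fin /c3 /t.
rewrite le_eqVlt; apply/orP; left; apply/eqP.
by rewrite expr2; field; rewrite gt_eqF.
Qed.

Lemma green_le :
  (`| \int[volume]_(x in Y) (\sum_(i < 3) dU i x * partial i phi x)%:E | <=
   \int[volume]_(x in Y) (`|U x| * `|laplacian phi x|)%:E)%E.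
Proof.
have [C C0 h] := green_approx.
apply/lee_addgt0Pr => e e0.
have d0 : 0 < e / (C + 1) by rewrite divr_gt0 // ltr_wpDl.
apply: le_trans (h _ d0) _; rewrite leeD2l // lee_fin mulrA ler_pdivrMr ?ltr_wpDl //.
by rewrite mulrC ler_wpM2l ?lerDl // ltW.
Qed.

End estimate.

End green.

(** * Bounds on the kernel, uniform in [e] *)

Section test_function_bounds.
Context {R : realType}.
Implicit Types (x : R3 R) (i : 'I_3).

Lemma sum3E (F : 'I_3 -> R) : \sum_(i < 3) F i = F 0 + F 1 + F 2.
Proof.
rewrite !big_ord_recl big_ord0 addr0 addrA.
by congr (F _ + F _ + F _); exact: val_inj.
Qed.

Lemma newton_pole_le1 (e : R) i x : 0 < e -> far e x -> `|pole e i x| * newton e x <= 1.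
Proof.
move=> e0 fx; have n0 := newton_gt0 e x.
rewrite -(@ler_pXn2r _ 2) ?nnegrE ?mulr_ge0 ?(ltW n0) // expr1n exprMn mulrC.
rewrite -(newton_sqr e0 fx) ler_wpM2l ?sqr_ge0 // real_normK ?num_real //.
rewrite dist2E (bigD1 i) //= lerDl; apply: sumr_ge0 => j _; exact: sqr_ge0.
Qed.

Lemma psi_ge0 (e : R) x : 0 < e -> 0 <= x.2 -> 0 <= psi e x.
Proof.
move=> e0 x0; rewrite /psi mulr_ge0 ?exprn_ge0 ?(ltW (newton_gt0 _ _)) //.
by rewrite addr_ge0 // ltW.
Qed.

Lemma psi_le_newton (e : R) x : 0 < e -> 0 <= x.2 -> psi e x <= newton e x ^+ 2.
Proof.
move=> e0 x0; have n0 := newton_gt0 e x.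
have := newton_pole_le1 2 e0 (far_half e0 x0); rewrite /pole /= => h.
rewrite /psi exprS mulrA ler_piMl ?sqr_ge0 //; apply: le_trans h.
by rewrite ler_wpM2r ?(ltW n0) // ler_norm.
Qed.

(** On the half-space psi <= newton^2 <= (x3 + e)^-2: the kernel is dominated by a function of the
    height alone, a weight fit for integration along vertical lines. *)
Lemma psi_le_root_inv (e : R) x : 0 < e -> 0 <= x.2 -> psi e x <= root_inv e x.2 ^+ 4.
Proof.
move=> e0 x0; apply: le_trans (psi_le_newton e0 x0) _.
have xe : 0 < x.2 + e by rewrite ltr_wpDl.
have := root_inv_sqr e0 x0; move: (root_inv e x.2) => b hb.
have -> : b ^+ 4 = ((x.2 + e)^-1) ^+ 2.
  have -> : (x.2 + e)^-1 = b ^+ 2 by apply: (mulIf (lt0r_neq0 xe)); rewrite hb mulVf // gt_eqF.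
  by rewrite -exprM.
rewrite lerXn2r ?nnegrE ?invr_ge0 ?(ltW xe) ?(ltW (newton_gt0 _ _)) //.
rewrite -(ler_pM2l xe) divff ?gt_eqF //.
have := newton_pole_le1 2 e0 (far_half e0 x0); rewrite /pole /=.
by rewrite gtr0_norm.
Qed.

(** On the graph the distance to the pole is at most (1 + m) (|a| + e), and x3 + e is at least m /
    (1 + m) times |a| + e. *)
Lemma psi_graph_ge (m e : R) (a : R2 R) : 0 < m -> 0 < e ->
  m / (1 + m) ^+ 4 * ((plane_norm a + e)^-1) ^+ 2 <= psi e (a, rho m a).
Proof.
move=> m0 e0; pose x : R3 R := (a, rho m a).
have r0 : 0 <= rho m a by apply: rho_ge0.
have fx : far e x by apply: far_half.
have p0 := plane_norm_ge0 a; set p := plane_norm a in p0 *.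
have pe : 0 < p + e by rewrite ltr_wpDl.
have m1 : 0 < 1 + m by rewrite addr_gt0.
have n0 := newton_gt0 e x.
have nl : ((1 + m) * (p + e))^-1 <= newton e x.
  have ni : 0 < (newton e x)^-1 by rewrite invr_gt0.
  rewrite -[leRHS]invrK lef_pV2 ?posrE ?mulr_gt0 //.
  rewrite -(@ler_pXn2r _ 2) ?nnegrE ?invr_ge0 ?mulr_ge0 ?(ltW n0) ?(ltW m1) ?(ltW pe) //.
  rewrite exprVn; have d0 : newton e x ^+ 2 != 0 by rewrite gt_eqF // exprn_gt0.
  have -> : (newton e x ^+ 2)^-1 = dist2 e x.
    by apply: (mulfI d0); rewrite newton_sqr // divff.
  rewrite /dist2 /= -plane_norm_sqr -/p {1}/rho -/p exprMn.
  move: m0 e0 p0; clear; move: (m) (e) (p) => m' e' q m0 e0 q0.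
  have h1 : 0 <= q * m' by rewrite mulr_ge0 // ltW.
  have h2 : 0 <= e' * m' by rewrite mulr_ge0 // ltW.
  have h3 : 0 <= q * e' by rewrite mulr_ge0 // ltW.
  have h4 : 0 <= q * m' * e' by rewrite mulr_ge0 // ltW.
  have h5 : 0 <= e' * m' * e' by rewrite mulr_ge0 // ltW.
  have h6 : 0 <= q * m' * q by rewrite mulr_ge0.
  have h7 : 0 <= q * m' * e' * m' by rewrite mulr_ge0 // ltW.
  have h8 : 0 <= e' * m' * e' * m' by rewrite mulr_ge0 // ltW.
  rewrite -subr_ge0 (_ : _ - _ = 2 * (q * e') + 2 * (q * m' * e') + 2 * (e' * m' * e') +
     2 * (q * m' * q) + e' * m' * e' * m' + 2 * (q * m' * e' * m')); last by ring.
  by do ?[by []|apply: addr_ge0|apply: mulr_ge0].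
rewrite /psi -/x; set N := newton e x in n0 nl *.
have xl : m / (1 + m) * (p + e) <= x.2 + e.
  rewrite /x /= /rho -/p mulrAC ler_pdivrMr // mulrDr.
  move: m0 e0 p0; clear; move: (m) (e) (p) => m' e' q m0 e0 q0.
  have h1 : 0 <= m' * q * m' by rewrite mulr_ge0 ?mulr_ge0 ?(ltW m0).
  rewrite -subr_ge0 (_ : _ - _ = m' * q * m' + e'); last by ring.
  by rewrite addr_ge0 // ltW.
have N3 : (((1 + m) * (p + e))^-1) ^+ 3 <= N ^+ 3.
  by rewrite lerXn2r ?nnegrE ?invr_ge0 ?mulr_ge0 ?(ltW n0) ?(ltW m1) ?(ltW pe).
apply: le_trans (ler_pM _ _ xl N3); last 2 first.
- by rewrite mulr_ge0 ?divr_ge0 ?(ltW m0) ?(ltW m1) ?(ltW pe).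
- by rewrite exprn_ge0 // invr_ge0 mulr_ge0 ?(ltW m1) ?(ltW pe).
rewrite le_eqVlt; apply/orP; left; apply/eqP.
by move: pe m1; clear; move: (p + e) (1 + m) => q s q0 s0; field; rewrite !gt_eqF.
Qed.

(** Harmonicity leaves only terms with a derivative of [chi], which live on r <= |x| <= 2 r. There,
    for x3 >= 0, the distance to the pole is at least |x| >= r, so psi <= r^-2 and its partial
    derivatives are at most (1 + 3) r^-3, whatever [e] is. *)
Lemma laplacian_test_bounded (r : R) : 0 < r ->
  exists2 C : R, 0 <= C & forall e x, 0 < e -> 0 <= x.2 ->
    `|laplacian (fun x => chi r x * psi e x) x| <= C.
Proof.
move=> r0.
have schi := sm_chi r.
have pb i : exists2 b : R, 0 <= b & forall x, enorm x <= 2 * r -> `|partial i (chi r) x| <= b.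
  by apply: continuous_bounded_ball; apply: sm_continuous; exact: sm_partial.
have lb : exists2 b : R, 0 <= b & forall x, enorm x <= 2 * r -> `|laplacian (chi r) x| <= b.
  apply: continuous_bounded_ball; apply: sm_continuous; rewrite /laplacian.
  rewrite (_ : (fun x => _) = (fun x => partial 0 (partial 0 (chi r)) x +
    partial 1 (partial 1 (chi r)) x + partial 2 (partial 2 (chi r)) x)).
    have s2 i : sm (partial i (partial i (chi r))) by exact: sm_partial (sm_partial _ schi).
    exact: (sm_add (sm_add (s2 0) (s2 1)) (s2 2)).
  by apply/funext => x; exact: sum3E.
have [b [b0 hb]] : exists b : R, 0 <= b /\
    forall i x, enorm x <= 2 * r -> `|partial i (chi r) x| <= b.
  have [c0 c00 h0] := pb 0; have [c1 c10 h1] := pb 1; have [c2 c20 h2] := pb 2.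
  exists (c0 + c1 + c2); split; first by rewrite !addr_ge0.
  move=> i x xr; case: (ord3_cases i) => ->.
  - by apply: le_trans (h0 x xr) _; rewrite -addrA lerDl addr_ge0.
  - by apply: le_trans (h1 x xr) _; rewrite addrAC lerDr addr_ge0.
  - by apply: le_trans (h2 x xr) _; rewrite lerDr addr_ge0.
have [l l0 hl] := lb.
have ri : 0 <= r^-1 by rewrite invr_ge0 ltW.
exists (2 * (3 * (b * (4 * r^-1 ^+ 3))) + r^-1 ^+ 2 * l).
  by do ?[by []|apply: addr_ge0|apply: mulr_ge0|apply: exprn_ge0].
move=> e x e0 x0; have fx := far_half e0 x0.
rewrite laplacianM //; last exact: sm_psi.
rewrite laplacian_psi // mulr0 add0r.
have [xr|xr] := boolP ((enorm x < r) || (2 * r < enorm x)).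
  have xr' : enorm x < r \/ 2 * r < enorm x by apply/orP.
  rewrite laplacian_chi_eq0 // mulr0 addr0 big1 ?mulr0 ?normr0.
    by do ?[by []|apply: addr_ge0|apply: mulr_ge0|apply: exprn_ge0].
  by move=> i _; rewrite partial_chi_eq0 // mul0r.
move: xr; rewrite negb_or -!leNgt => /andP[rx xr].
have n0 := newton_gt0 e x.
have nr : newton e x <= r^-1.
  rewrite -(@ler_pXn2r _ 2) ?nnegrE ?(ltW n0) // [leRHS]exprVn.
  rewrite -(@ler_pM2r _ (r ^+ 2)) ?exprn_gt0 // mulVf ?expf_neq0 ?gt_eqF //.
  rewrite -(newton_sqr e0 fx) ler_wpM2l ?sqr_ge0 //.
  apply: (@le_trans _ _ (enorm x ^+ 2)); first by rewrite lerXn2r ?nnegrE ?enorm_ge0 // ltW.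
  rewrite -sqnE /sqn /dist2 lerD2l lerXn2r ?nnegrE ?addr_ge0 ?(ltW e0) //.
  by rewrite lerDl ltW.
have psile : `|psi e x| <= r^-1 ^+ 2.
  rewrite ger0_norm ?psi_ge0 //; apply: le_trans (psi_le_newton e0 x0) _.
  by rewrite lerXn2r ?nnegrE ?(ltW n0).
have dpsile i : `|partial i (psi e) x| <= 4 * r^-1 ^+ 3.
  rewrite partial_psi //; apply: (@le_trans _ _ (4 * newton e x ^+ 3)); last first.
    by rewrite ler_wpM2l // lerXn2r ?nnegrE ?(ltW n0).
  have h1 := newton_pole_le1 2 e0 fx; have h2 := newton_pole_le1 i e0 fx.
  apply: le_trans (ler_normB _ _) _.
  have -> : 3 * (pole e 2 x * pole e i x) * newton e x ^+ 5 =
     3 * newton e x ^+ 3 * ((pole e 2 x * newton e x) * (pole e i x * newton e x)) by ring.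
  have N3 : 0 <= newton e x ^+ 3 by rewrite exprn_ge0 // ltW.
  have -> : 4 * newton e x ^+ 3 = newton e x ^+ 3 + 3 * newton e x ^+ 3 by ring.
  apply: lerD.
    rewrite normrM (ger0_norm N3) ler_piMl //.
    by case: (i == 2); rewrite ?normr1 ?normr0.
  rewrite normrM (ger0_norm (mulr_ge0 _ N3)) // ler_piMr //; first exact: mulr_ge0.
  rewrite !normrM (gtr0_norm n0).
  by apply: mulr_ile1 => //; rewrite mulr_ge0 // ltW.
apply: le_trans (ler_normD _ _) _; apply: lerD; last first.
  by rewrite normrM; apply: ler_pM => //; exact: hl.
rewrite normrM ger0_norm // ler_wpM2l //.
apply: le_trans (ler_norm_sum _ _ _) _.
rewrite -[leRHS](_ : \sum_(i < 3) (b * (4 * r^-1 ^+ 3)) = _); last first.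
  by rewrite sumr_const card_ord -[_ *+ 3]mulr_natl.
by apply: ler_sum => i _; rewrite normrM; apply: ler_pM => //; exact: hb.
Qed.

End test_function_bounds.

(** * Geometry of the corner *)

Section cone_geometry.
Context {R : realType}.
Implicit Types (x : R3 R) (A : set (R3 R)).

Lemma plane_normE x : enorm x ^+ 2 = plane_norm x.1 ^+ 2 + x.2 ^+ 2.
Proof. by rewrite enorm_sqr plane_norm_sqr. Qed.

Lemma angle_axis_lt (theta : R) x : 0 < theta < pi / 2 -> x != 0 ->
  (0 <= angle x (0, 0, 1) < theta) = (cos theta * enorm x < x.2).
Proof.
move=> /andP[t0 tpi] x0.
have tpi' : theta <= pi.
  by apply: le_trans (ltW tpi) _; rewrite ler_pdivrMr // ler_peMr ?pi_ge0 // ler1n.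
have xn : 0 < enorm x.
  rewrite lt_neqAle enorm_ge0 andbT eq_sym; apply: contra x0 => /eqP x0.
  have h1 := coord1_le_enorm x; have h2 := coord2_le_enorm x; have h3 := coord3_le_enorm x.
  rewrite x0 !normr_le0 in h1 h2 h3.
  case: x {x0} h1 h2 h3 => [[a b] c] /= /eqP -> /eqP -> /eqP ->; exact: eqxx.
have e3 : enorm ((0, 0, 1) : R3 R) = 1.
  by rewrite /enorm /dot /= !mulr0 mulr1 !add0r sqrtr1.
have d3 : dot x (0, 0, 1) = x.2 by rewrite /dot /= !mulr0 mulr1 !add0r.
rewrite /angle e3 d3 mulr1; set c := x.2 / enorm x.
have c1 : -1 <= c <= 1.
  rewrite -ler_norml normrM (gtr0_norm (_ : 0 < (enorm x)^-1)) ?invr_gt0 //.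
  by rewrite ler_pdivrMr // mul1r coord3_le_enorm.
rewrite acos_ge0 //=.
have ci : acos c \in `[0, pi] by rewrite in_itv /= acos_ge0 // acos_lepi.
have ti : theta \in `[0, pi] by rewrite in_itv /= (ltW t0) tpi'.
rewrite -(ltr_cos ci ti) acosK; last by rewrite in_itv.
by rewrite ltr_pdivlMr.
Qed.

(** Both conditions force x3 > 0; then both sides can be squared, and cos^2 + sin^2 = 1 turns cos
    theta |x| < x3 into the graph inequality with slope cot theta. The strict inequality excludes
    the apex on the right-hand side. *)
Lemma coneE (theta : R) : 0 < theta < pi / 2 ->
  cone theta = [set x : R3 R | rho (cos theta / sin theta) x.1 < x.2].
Proof.
move=> ht; have /andP[t0 tpi] := ht.
have c0 : 0 < cos theta.
  by apply: cos_gt0_pihalf; rewrite tpi andbT (lt_trans _ t0) // oppr_lt0 divr_gt0 // pi_gt0.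
have s0 : 0 < sin theta.
  apply: sin_gt0_pi; rewrite t0 (lt_trans tpi) //.
  by rewrite ltr_pdivrMr // ltr_pMr ?pi_gt0 // ltr1n.
have cs := cos2Dsin2 theta; move: c0 s0 cs; set c := cos theta; set s := sin theta => c0 s0 cs.
have key x : (c * enorm x < x.2) = (rho (c / s) x.1 < x.2).
  have p0 := plane_norm_ge0 x.1; have n0 := enorm_ge0 x; have e := plane_normE x.
  have r0 : 0 <= rho (c / s) x.1 by rewrite mulr_ge0 // divr_ge0 // ltW.
  have [x2|x2] := leP x.2 0.
    apply/idP/idP => h; exfalso; move: h; apply/negP; rewrite -leNgt.
    - by apply: le_trans x2 _; rewrite mulr_ge0 // ltW.
    - exact: le_trans x2 _.
  rewrite -(@ltr_pXn2r _ 2) ?nnegrE ?mulr_ge0 ?(ltW c0) ?(ltW x2) //.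
  rewrite -[RHS](@ltr_pXn2r _ 2) ?nnegrE ?(ltW x2) //.
  rewrite /rho !exprMn exprVn e mulrAC ltr_pdivrMr ?exprn_gt0 //.
  have -> : s ^+ 2 = 1 - c ^+ 2 by rewrite -cs [RHS]addrAC subrr add0r.
  by rewrite -subr_gt0 -[RHS]subr_gt0; congr (0 < _); ring.
apply/seteqP; split => x /=.
  by move=> [x0]; rewrite angle_axis_lt // key.
move=> xr; have x0 : x != 0.
  apply/eqP => x0; move: xr; rewrite x0 /rho /plane_norm /=.
  by rewrite !expr0n /= addr0 sqrtr0 mulr0 ltxx.
by split => //; rewrite angle_axis_lt // key.
Qed.

End cone_geometry.

Section corner.
Context {R : realType}.
Variables m h : R.
Hypotheses (m0 : 0 < m) (h0 : 0 < h).
(** [A] will stand for the domain, for the cone and for the truncated cone, which all have the same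
    boundary near the apex. *)
Variable A : set (R3 R).
Hypothesis corner : A `&` eball h = [set x | rho m x.1 < x.2] `&` eball h.
Implicit Types x : R3 R.

Let corner_iff x : enorm x < h -> A x <-> rho m x.1 < x.2.
Proof.
move=> xh; split => [Ax|xr].
  by have [] : ([set x | rho m x.1 < x.2] `&` eball h) x by rewrite -corner.
by have [] : (A `&` eball h) x by rewrite corner.
Qed.

Lemma enorm_nbhs x (U : set (R3 R)) : nbhs x U ->
  exists2 d : R, 0 < d & forall y, enorm (y - x) < d -> U y.
Proof.
move=> /nbhs_ballP[d /= d0 dU]; exists d => // y yd; apply: dU.
have h1 := coord1_le_enorm (y - x); have h2 := coord2_le_enorm (y - x).
have h3 := coord3_le_enorm (y - x).
by split; [split|]; rewrite /ball /= distrC; apply: le_lt_trans yd.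
Qed.

Lemma graph_boundary x : enorm x < h -> x.2 = rho m x.1 -> boundary A x.
Proof.
move=> xh xr; split.
  move=> U Ux.
  have hx : nbhs x [set y : R3 R | enorm y < h].
    by apply: open_nbhs_nbhs; split => //; exact: enorm_open_ball.
  have [d d0 dU] := enorm_nbhs (filterI Ux hx).
  pose v : R3 R := (0, 0, d / 2).
  have vn : enorm v = d / 2.
    by rewrite /enorm /dot /= !mulr0 !add0r -expr2 sqrtr_sqr gtr0_norm // divr_gt0.
  have [Uy yh] : U (x + v) /\ enorm (x + v) < h.
    by apply: dU; rewrite addrAC subrr add0r vn ltr_pdivrMr // ltr_pMr // ltr1n.
  exists (x + v); split => //; apply/(corner_iff yh).
  have v1 : x.1 + (0, 0) = x.1 := addr0 _.
  by rewrite /v /= v1 -xr ltrDl divr_gt0.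
move=> /nbhs_singleton /(corner_iff xh); by rewrite -xr ltxx.
Qed.

Lemma boundary_graph x : open A -> enorm x < h -> boundary A x -> x.2 = rho m x.1.
Proof.
move=> oA xh [cx nx]; apply/eqP; rewrite eq_le; apply/andP; split.
  rewrite leNgt; apply/negP => /(corner_iff xh) Ax.
  by apply: nx; apply: open_nbhs_nbhs.
rewrite leNgt; apply/negP => xr.
have U : nbhs x [set y : R3 R | y.2 < rho m y.1 /\ enorm y < h].
  have o1 : open [set y : R3 R | y.2 < rho m y.1].
    rewrite (_ : [set y | _] = (fun y : R3 R => y.2 - rho m y.1) @^-1` `]-oo, 0[%classic).
      by apply: open_comp; [move=> y _; exact: continuous_gap|exact: interval_open].
    by apply/seteqP; split => y /=; rewrite in_itv /= subr_lt0.
  by apply: open_nbhs_nbhs; split; [exact: openI o1 (enorm_open_ball (c := h))|].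
have [y [Ay [yr yh]]] := cx _ U.
by move: Ay => /(corner_iff yh); rewrite ltNge (ltW yr).
Qed.

End corner.

(** * Complex-valued functions *)

Section complex_parts.
Context {R : realType}.
Implicit Types (z : R[i]) (u f : R3 R -> R[i]) (A : set (R3 R)).

(** One boolean for the real or the imaginary part: the contradiction is reached on a single part of
    the transmission identity, one in which eta(0) v(0) does not vanish. *)
Definition part (b : bool) z : R := if b then complex.Re z else complex.Im z.

Lemma partD b z y : part b (z + y) = part b z + part b y.
Proof. by case: z y => [p q] [s t]; case: b. Qed.

Lemma partN b z : part b (- z) = - part b z.
Proof. by case: z => [p q]; case: b. Qed.

Lemma partB b z y : part b (z - y) = part b z - part b y.
Proof. by rewrite partD partN. Qed.

Lemma partMr b z (s : R) : part b (z * s%:C%C) = part b z * s.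
Proof. by case: z => [p q]; case: b => /=; rewrite !mulr0 ?subr0 ?add0r. Qed.

Lemma part0 b : part b 0 = 0. Proof. by case: b. Qed.

Lemma part_sum b (F : 'I_3 -> R[i]) : part b (\sum_(i < 3) F i) = \sum_(i < 3) part b (F i).
Proof. by rewrite (big_morph (part b) (partD b) (part0 b)). Qed.

Lemma normc_sqr z : Normc.normc z ^+ 2 = complex.Re z ^+ 2 + complex.Im z ^+ 2.
Proof. by case: z => p q /=; rewrite sqr_sqrtr // addr_ge0 ?sqr_ge0. Qed.

Lemma normc_ge0 z : 0 <= Normc.normc z.
Proof. by case: z => p q; exact: sqrtr_ge0. Qed.

Lemma part_le b z : `|part b z| <= Normc.normc z.
Proof.
rewrite -(@ler_pXn2r _ 2) ?nnegrE ?normc_ge0 // real_normK ?num_real // normc_sqr.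
by case: b => /=; rewrite ?lerDl ?lerDr sqr_ge0.
Qed.

Lemma part_sqr_le b z : part b z ^+ 2 <= Normc.normc z ^+ 2.
Proof. by rewrite normc_sqr; case: b => /=; rewrite ?lerDl ?lerDr sqr_ge0. Qed.

Lemma normc_le_parts z : Normc.normc z <= `|part true z| + `|part false z|.
Proof.
rewrite -(@ler_pXn2r _ 2) ?nnegrE ?normc_ge0 ?addr_ge0 // normc_sqr sqrrD.
rewrite !real_normK ?num_real //= addrAC lerDl.
by rewrite mulrn_wge0 // mulr_ge0.
Qed.

Lemma part_neq0 z : z != 0 -> exists b, part b z != 0.
Proof.
case: z => p q z0; have [p0|p0] := eqVneq p 0; last by exists true.
by exists false; apply: contra z0 => /= /eqP ->; rewrite p0.
Qed.

Lemma part_cintegral b (mu : set (R3 R) -> \bar R) A f :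
  part b (cintegral mu A f) = fine (\int[mu]_(x in A) (part b (f x))%:E)%E.
Proof. by case: b. Qed.

Lemma measurable_part b A u : cmeasurable A u -> measurable_fun A (fun x => part b (u x)).
Proof. by case=> h1 h2; case: b. Qed.

Lemma measurable_normc_sqr A u : measurable A -> cmeasurable A u ->
  measurable_fun A (fun x => Normc.normc (u x) ^+ 2).
Proof.
move=> mA mu; under eq_fun do rewrite normc_sqr.
apply: measurable_funD; apply: measurable_funX.
  exact: (measurable_part true mu).
exact: (measurable_part false mu).
Qed.

Lemma smooth_part b u : csmooth u -> smooth (fun x => part b (u x)).
Proof. by case=> h1 h2; case: b; [exact: h1|exact: h2]. Qed.

Lemma partial_part b i u x :
  partial i (fun y => part b (u y)) x = part b (cpartial i u x).
Proof. by case: b. Qed.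

Lemma cmeasurableD A u f : cmeasurable A u -> cmeasurable A f ->
  cmeasurable A (fun x => u x + f x).
Proof.
move=> mu mf; split.
  rewrite (_ : (fun x => _) = (fun x => part true (u x) + part true (f x))).
    by apply: measurable_funD; exact: measurable_part.
  by apply/funext => x; rewrite -partD.
rewrite (_ : (fun x => _) = (fun x => part false (u x) + part false (f x))).
  by apply: measurable_funD; exact: measurable_part.
by apply/funext => x; rewrite -partD.
Qed.

Lemma cmeasurableN A u : cmeasurable A u -> cmeasurable A (fun x => - u x).
Proof.
move=> mu; split.
  rewrite (_ : (fun x => _) = (fun x => - part true (u x))).
    by apply: measurable_funN (measurable_part true mu).
  by apply/funext => x; rewrite -partN.
rewrite (_ : (fun x => _) = (fun x => - part false (u x))).
  by apply: measurable_funN (measurable_part false mu).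
by apply/funext => x; rewrite -partN.
Qed.

Lemma cmeasurableM A u f : cmeasurable A u -> cmeasurable A f ->
  cmeasurable A (fun x => u x * f x).
Proof.
move=> [u1 u2] [f1 f2]; split.
  rewrite (_ : (fun x => _) = (fun x => complex.Re (u x) * complex.Re (f x) -
     complex.Im (u x) * complex.Im (f x))).
    by apply: measurable_funB; apply: measurable_funM.
  by apply/funext => x; case: (u x) (f x) => [p q] [s t].
rewrite (_ : (fun x => _) = (fun x => complex.Re (u x) * complex.Im (f x) +
   complex.Im (u x) * complex.Re (f x))).
  by apply: measurable_funD; apply: measurable_funM.
by apply/funext => x; case: (u x) (f x) => [p q] [s t].
Qed.

Lemma cmeasurable_cst A z : cmeasurable A (fun=> z).
Proof. by split; exact: measurable_cst. Qed.

Lemma cmeasurableS A A' u : measurable A -> A' `<=` A -> cmeasurable A u -> cmeasurable A' u.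
Proof. by move=> mA AA [h1 h2]; split; apply: measurable_funS AA _. Qed.

(* Truncating an essentially bounded function makes the bound hold everywhere,
   and does not change integrals. *)
Definition truncate (M : R) z : R[i] := if Normc.normc z <= M then z else 0.

Lemma normc_truncate M z : 0 <= M -> Normc.normc (truncate M z) <= M.
Proof. by rewrite /truncate; case: ifP => // _ M0; rewrite Normc.normc0. Qed.

Lemma cmeasurable_truncate M A u : measurable A -> cmeasurable A u ->
  cmeasurable A (fun x => truncate M (u x)).
Proof.
move=> mA mu.
have mb : measurable_fun A (fun x => Normc.normc (u x) <= M).
  have -> : (fun x => Normc.normc (u x) <= M) =
      (fun x => (0 <= M) && (Normc.normc (u x) ^+ 2 <= M ^+ 2)).
    apply/funext => x; have n0 := normc_ge0 (u x).
    have [M0|M0] := leP 0 M; first by rewrite ler_pXn2r ?nnegrE.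
    by apply/negbTE; rewrite -ltNge (lt_le_trans M0).
  apply: measurable_and; first exact: measurable_cst.
  by apply: measurable_fun_ler; [exact: measurable_normc_sqr|exact: measurable_cst].
split.
  rewrite (_ : (fun x => _) = (fun x => if Normc.normc (u x) <= M then part true (u x) else 0)).
    apply: (measurable_fun_if mA mb); [|exact: measurable_cst].
    exact: (measurable_funS mA (fun x => @proj1 _ _) (measurable_part true mu)).
  by apply/funext => x; rewrite /truncate; case: ifP.
rewrite (_ : (fun x => _) = (fun x => if Normc.normc (u x) <= M then part false (u x) else 0)).
  apply: (measurable_fun_if mA mb); [|exact: measurable_cst].
    exact: (measurable_funS mA (fun x => @proj1 _ _) (measurable_part false mu)).
by apply/funext => x; rewrite /truncate; case: ifP.
Qed.

End complex_parts.

Lemma holder_small {R : realType} (alpha : R) A (u : R3 R -> R[i]) (kappa : R) : 0 < alpha ->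
  holder alpha A u -> A 0 -> 0 < kappa ->
  exists2 d : R, 0 < d & forall x, A x -> enorm x < d -> Normc.normc (u x - u 0) <= kappa.
Proof.
move=> a0 [M hM] A0 k0; have M0 : 0 < `|M| + 1 by rewrite ltr_wpDl.
have kM : 0 < kappa / (`|M| + 1) by rewrite divr_gt0.
exists ((kappa / (`|M| + 1)) `^ alpha^-1); first exact: powR_gt0.
move=> x Ax xd; apply: le_trans (hM _ _ Ax A0) _; rewrite subr0.
apply: (@le_trans _ _ ((`|M| + 1) * (kappa / (`|M| + 1)))); last first.
  by rewrite mulrC divfK // gt_eqF.
apply: (@le_trans _ _ ((`|M| + 1) * enorm x `^ alpha)).
  by apply: ler_wpM2r; [exact: powR_ge0|rewrite (le_trans (ler_norm M)) // lerDl].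
apply: ler_wpM2l; first exact: ltW.
have -> : kappa / (`|M| + 1) = ((kappa / (`|M| + 1)) `^ alpha^-1) `^ alpha.
  by rewrite -powRrM mulVf ?gt_eqF // powRr1 // ltW.
by apply: ge0_ler_powR; rewrite ?nnegrE ?enorm_ge0 ?powR_ge0 // ltW.
Qed.

(** * Traces *)

Section null_transfer.
Context {R : realType}.
Variable m : R.
Hypothesis m0 : 0 < m.
Local Notation rho := (rho m).
Let mrho : measurable_fun setT rho := measurable_rho m.

Lemma area_le_graph : exists2 c : R, 0 < c &
  (forall S, measurable S -> c%:E * area S <= graph_measure mrho S)%E /\
  (forall S, measurable S -> graph_measure mrho S <= ((1 + m ^+ 2) * c)%:E * area S)%E.
Proof.
have [c c0 flatE] := @flat_area R; exists c => //; split => S mS.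
  by rewrite -flatE //; exact: flat_le_graph.
by rewrite EFinM -muleA -flatE //; apply: graph_le_flat; exact: rho_lipschitz.
Qed.

(** Carries the transmission condition, known almost everywhere for the surface measure, to almost
    every vertical line. *)
Lemma area_negligible_graph (N : set (R3 R)) (sigma : R) : hausdorff2.-negligible N ->
  area.-negligible (base rho sigma `&` [set a | N (a, rho a)]).
Proof.
move=> [M [mM M0 NM]]; have [c c0 [cle _]] := area_le_graph.
have mS : measurable ([set: R2 R] `&` (fun a => (a, rho a) : R3 R) @^-1` M).
  exact: (measurable_graph_point mrho).
rewrite setTI in mS.
exists ((fun a => (a, rho a) : R3 R) @^-1` M); split => //; last by move=> a [_ /NM].
have : (c%:E * area ((fun a => (a, rho a) : R3 R) @^-1` M) <= 0)%E.
  apply: le_trans (cle _ mS) _; rewrite -M0; apply: le_hausdorff2.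
  by move=> [a s] []; rewrite /graph /= => ->.
rewrite pmule_rle0 ?lte_fin // => h.
by apply/eqP; rewrite eq_le h measure_ge0.
Qed.

(** Carries back to the surface what vertical lines reveal about the trace. *)
Lemma graph_negligible_area (N : set (R2 R)) : area.-negligible N ->
  hausdorff2.-negligible (graph rho `&` fst @^-1` N).
Proof.
move=> [M [mM M0 NM]]; have [c c0 [_ cle]] := area_le_graph.
exists (graph rho `&` fst @^-1` M); split.
- exact: (measurable_graph_fst mrho).
- apply/eqP; rewrite eq_le hausdorff2_ge0 andbT.
  by have := cle _ mM; rewrite M0 mule0.
by move=> x [? /NM].
Qed.

End null_transfer.

Section square_convergence.
Context d (T : measurableType d) (R : realType) (mu : {measure set T -> \bar R}).
Local Open Scope ereal_scope.

Lemma sq_cvgB D (p q : nat -> T -> R) (p0 q0 : T -> R) : measurable D ->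
  (forall n, measurable_fun D (p n)) -> (forall n, measurable_fun D (q n)) ->
  measurable_fun D p0 -> measurable_fun D q0 ->
  \int[mu]_(x in D) ((p n x - p0 x) ^+ 2)%:E @[n --> \oo] --> 0 ->
  \int[mu]_(x in D) ((q n x - q0 x) ^+ 2)%:E @[n --> \oo] --> 0 ->
  \int[mu]_(x in D) (((p n x - q n x) - (p0 x - q0 x)) ^+ 2)%:E @[n --> \oo] --> 0.
Proof.
move=> mD mp mq mp0 mq0 cp cq.
have h : (2%R%:E * \int[mu]_(x in D) ((p n x - p0 x) ^+ 2)%:E +
  2%R%:E * \int[mu]_(x in D) ((q n x - q0 x) ^+ 2)%:E) @[n --> \oo] --> 0.
  have -> : 0 = 2%R%:E * 0 + 2%R%:E * 0 :> \bar R by rewrite !mule0 adde0.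
  by apply: cvgeD; [rewrite !mule0|apply: cvgeZl|apply: cvgeZl].
apply: (squeeze_cvge _ (cvg_cst 0) h); apply: nearW => n; apply/andP; split.
  by apply: integral_ge0 => x _; rewrite lee_fin sqr_ge0.
have ms (f g : T -> R) : measurable_fun D f -> measurable_fun D g ->
    measurable_fun D (fun x => ((f x - g x) ^+ 2)%R).
  by move=> mf mg; apply: measurable_funX; exact: measurable_funB.
apply: le_integral2 => //; do ?[by move=> x _; rewrite sqr_ge0].
- by apply: ms; exact: measurable_funB.
- exact: ms.
- exact: ms.
move=> x _; move: (p n x) (q n x) (p0 x) (q0 x) => a b a' b'.
rewrite -subr_ge0 (_ : _ - _ = ((a - a') + (b - b')) ^+ 2)%R ?sqr_ge0 //; ring.
Qed.

Lemma sq_cvgS D E (p : nat -> T -> R) (p0 : T -> R) : measurable D -> measurable E -> D `<=` E ->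
  (forall n, measurable_fun E (p n)) -> measurable_fun E p0 ->
  \int[mu]_(x in E) ((p n x - p0 x) ^+ 2)%:E @[n --> \oo] --> 0 ->
  \int[mu]_(x in D) ((p n x - p0 x) ^+ 2)%:E @[n --> \oo] --> 0.
Proof.
move=> mD mE DE mp mp0 cp.
apply: (squeeze_cvge _ (cvg_cst 0) cp); apply: nearW => n; apply/andP; split.
  by apply: integral_ge0 => x _; rewrite lee_fin sqr_ge0.
apply: ge0_subset_integral => //.
  by apply/measurable_EFinP; apply: measurable_funX; exact: measurable_funB.
by move=> x _; rewrite lee_fin sqr_ge0.
Qed.

End square_convergence.

Lemma sqnorm_part_cvg {R : realType} (mu : {measure set (R3 R) -> \bar R}) D
    (un : nat -> R3 R -> R[i]) (u : R3 R -> R[i]) (b : bool) : measurable D ->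
  (forall n, cmeasurable D (un n)) -> cmeasurable D u ->
  sqnorm mu D (fun x => un n x - u x) @[n --> \oo] --> 0%E ->
  (\int[mu]_(x in D) ((part b (un n x) - part b (u x)) ^+ 2)%:E)%E @[n --> \oo] --> 0%E.
Proof.
move=> mD mn mu_ cv; apply: (squeeze_cvge _ (cvg_cst 0%E) cv).
apply: nearW => n; apply/andP; split.
  by apply: integral_ge0 => x _; rewrite lee_fin sqr_ge0.
have mB : cmeasurable D (fun x => un n x - u x) by apply: cmeasurableD => //; exact: cmeasurableN.
apply: (ge0_le_integral mu mD).
- by move=> x _; rewrite lee_fin sqr_ge0.
- apply/measurable_EFinP; apply: measurable_funX.
  by apply: measurable_funB; exact: measurable_part.
- by apply/measurable_EFinP; exact: measurable_normc_sqr.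
by move=> x _; rewrite lee_fin -partB part_sqr_le.
Qed.

Section traces.
Context {R : realType}.
Implicit Types (Omega : set (R3 R)) (p g : R3 R -> R).

(* The real and imaginary parts of a function with an L^2 trace, in the form
   needed for estimates along vertical lines. *)
Definition vertical_trace Omega p g := exists (f f3 : nat -> R3 R -> R) (d3 : R3 R -> R),
  [/\ [/\ forall n, continuous (f n), forall n, continuous (f3 n) &
        forall n (a : R2 R) (s : R),
          is_derive s (1 : R) (fun t : R => f n (a, t)) (f3 n (a, s))],
      [/\ measurable_fun Omega p, measurable_fun Omega d3 & measurable_fun (boundary Omega) g],
      (\int[volume]_(x in Omega) (d3 x ^+ 2)%:E < +oo)%E &
      [/\ (\int[volume]_(x in Omega) ((f n x - p x) ^+ 2)%:E)%E @[n --> \oo] --> 0%E,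
          (\int[volume]_(x in Omega) ((f3 n x - d3 x) ^+ 2)%:E)%E @[n --> \oo] --> 0%E &
          (\int[hausdorff2]_(x in boundary Omega) ((f n x - g x) ^+ 2)%:E)%E @[n --> \oo] --> 0%E]].

Lemma measurable_boundary Omega : measurable (boundary Omega).
Proof.
by apply: measurableD; [apply: closed_measurable3; exact: closed_closure|
  apply: open_measurable3; exact: open_interior].
Qed.

Lemma smooth_vertical (f : R3 R -> R) (a : R2 R) (s : R) : smooth f ->
  is_derive s (1 : R) (fun t : R => f (a, t)) (partial 2 f (a, s)).
Proof.
move=> sf; have [_ /(_ 2 (a, s)) df] := sf [::].
pose g (t : R) := f (a, t).
have E : (fun h : R => h^-1 *: ((g \o shift s) (h *: (1 : R)) - g s)) =
         (fun h : R => h^-1 *: ((f \o shift (a, s)) (h *: (unitvec 2 : R3 R)) - f (a, s))).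
  apply/funext => h; congr (_ *: (f _ - _)).
  have -> : h *: (1 : R) = h by exact: mulr1.
  apply: injective_projections => /=.
    by apply: injective_projections => /=; rewrite /GRing.scale /= mulr0 add0r.
  by rewrite /GRing.scale /= mulr1.
split; first by rewrite /derivable E.
by rewrite /partial /derive E.
Qed.

Lemma sqr_lty (mu : {measure set (R3 R) -> \bar R}) D (u : R3 R -> R[i]) b : measurable D ->
  L2 mu D u -> (\int[mu]_(x in D) (part b (u x) ^+ 2)%:E < +oo)%E.
Proof.
move=> mD [mu_ u2]; apply: le_lt_trans u2; apply: (ge0_le_integral mu mD).
- by move=> x _; rewrite lee_fin sqr_ge0.
- by apply/measurable_EFinP; apply: measurable_funX; exact: measurable_part.
- by apply/measurable_EFinP; exact: measurable_normc_sqr.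
by move=> x _; rewrite lee_fin part_sqr_le.
Qed.

Lemma csmooth_measurable (u : R3 R -> R[i]) D : csmooth u -> cmeasurable D u.
Proof.
move=> [s1 s2]; split; apply: measurable_funTS; apply: continuous_measurable3.
  by case: (s1 [::]).
by case: (s2 [::]).
Qed.

Lemma smooth_partial (f : R3 R -> R) i : smooth f -> smooth (partial i f).
Proof. by move=> sf s; have := sf (rcons s i); rewrite -cats1 foldr_cat. Qed.

Lemma csmooth_cpartial (u : R3 R -> R[i]) i : csmooth u -> csmooth (cpartial i u).
Proof. by move=> [s1 s2]; split; [exact: (smooth_partial i s1)|exact: (smooth_partial i s2)]. Qed.

Lemma trace_vertical Omega (u g : R3 R -> R[i]) b : measurable Omega -> is_trace Omega u g ->
  vertical_trace Omega (fun x => part b (u x)) (fun x => part b (g x)).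
Proof.
move=> mO [[mg _] [du [un [[[mu _] hdu] sun cu cd cg]]]].
exists (fun n x => part b (un n x)), (fun n x => part b (cpartial 2 (un n) x)),
  (fun x => part b (du 2 x)).
have [L2d _] := hdu 2; have [md _] := L2d.
split.
- split=> n.
  + by have [] := smooth_part b (sun n) [::].
  + by have [] := smooth_part b (csmooth_cpartial 2 (sun n)) [::].
  + by move=> a s; rewrite -partial_part; apply: smooth_vertical; exact: smooth_part.
- by split; exact: measurable_part.
- exact: sqr_lty.
split.
- by apply: sqnorm_part_cvg => // n; exact: csmooth_measurable.
- apply: sqnorm_part_cvg => // n; apply: csmooth_measurable; exact: csmooth_cpartial.
- apply: sqnorm_part_cvg => //; first exact: measurable_boundary.
  by move=> n; exact: csmooth_measurable.
Qed.

Lemma vertical_traceB Omega p g p' g' : measurable Omega ->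
  vertical_trace Omega p g -> vertical_trace Omega p' g' ->
  vertical_trace Omega (fun x => p x - p' x) (fun x => g x - g' x).
Proof.
move=> mO [f [f3 [d3 [[cf cf3 df] [mp md mg] d3oo [cvf cvd cvg_]]]]].
move=> [f' [f3' [d3' [[cf' cf3' df'] [mp' md' mg'] d3oo' [cvf' cvd' cvg_']]]]].
have mB := @measurable_boundary Omega.
have mc D (h : R3 R -> R) : continuous h -> measurable_fun D h.
  by move=> ch; apply: measurable_funTS; exact: continuous_measurable3.
exists (fun n x => f n x - f' n x), (fun n x => f3 n x - f3' n x), (fun x => d3 x - d3' x).
split.
- split=> [n x|n x|n a s].
  + by apply: cvgB; [exact: cf|exact: cf'].
  + by apply: cvgB; [exact: cf3|exact: cf3'].
  + by have h1 := df n a s; have h2 := df' n a s; exact: is_deriveB h1 h2.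
- by split; exact: measurable_funB.
- have h := @le_integral2 _ _ _ volume Omega (fun x => (d3 x - d3' x) ^+ 2)
    (fun x => d3 x ^+ 2) (fun x => d3' x ^+ 2) 2 2 mO (ler0n _ 2) (ler0n _ 2).
  apply: le_lt_trans (h _ _ _ _ _ _ _) _.
  + by apply: measurable_funX; exact: measurable_funB.
  + exact: measurable_funX.
  + exact: measurable_funX.
  + by move=> x _; exact: sqr_ge0.
  + by move=> x _; exact: sqr_ge0.
  + by move=> x _; exact: sqr_ge0.
  + move=> x _; rewrite -subr_ge0 (_ : _ - _ = (d3 x + d3' x) ^+ 2) ?sqr_ge0 //; ring.
  by apply: lte_add_pinfty; rewrite lte_mul_pinfty.
split.
- by apply: sq_cvgB => // n; apply: mc; [exact: cf|exact: cf'].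
- by apply: sq_cvgB => // n; apply: mc; [exact: cf3|exact: cf3'].
- by apply: sq_cvgB => // n; apply: mc; [exact: cf|exact: cf'].
Qed.

End traces.

Section traces_near_corner.
Context {R : realType}.
Local Notation lambda := (@lebesgue_measure R).
Variables m tau : R.
Hypotheses (m0 : 0 < m) (tau0 : 0 < tau).
Variable Omega : set (R3 R).
Hypothesis mOmega : measurable Omega.
Local Notation rho := (rho m).
Local Notation Y := (above rho tau).
Hypothesis Ysub : Y `<=` Omega.
Hypothesis graph_sub : forall a, base rho tau a -> boundary Omega (a, rho a).
Let mrho : measurable_fun setT rho := measurable_rho m.
Let rho0 := rho_ge0 m0.
Let mY : measurable Y := measurable_above mrho tau.
Let mbase : measurable (base rho tau) := measurable_base mrho tau.

Lemma measurable_slice (g : R3 R -> R) : measurable_fun (boundary Omega) g ->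
  measurable_fun (base rho tau) (fun a => g (a, rho a)).
Proof.
move=> mg; apply: (measurable_comp (@measurable_boundary R Omega) _ mg).
  by move=> _ [a ab <-]; exact: graph_sub.
by apply: measurable_funTS; exact: (measurable_graph_point mrho).
Qed.

(** L^2 convergence on the boundary passes to the base because [area] is at most a multiple of the
    surface measure. *)
Lemma slice_cvg (f : nat -> R3 R -> R) (g : R3 R -> R) : (forall n, continuous (f n)) ->
  measurable_fun (boundary Omega) g ->
  (\int[hausdorff2]_(x in boundary Omega) ((f n x - g x) ^+ 2)%:E)%E @[n --> \oo] --> 0%E ->
  (\int[area]_(a in base rho tau) ((f n (a, rho a) - g (a, rho a)) ^+ 2)%:E)%E
    @[n --> \oo] --> 0%E.
Proof.
move=> cf mg cv; have [c c0 [cle _]] := area_le_graph m0.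
have mf n D : measurable_fun D (f n).
  by apply: measurable_funTS; apply: continuous_measurable3; exact: cf.
have h : (c^-1%:E * \int[hausdorff2]_(x in boundary Omega) ((f n x - g x) ^+ 2)%:E)%E
    @[n --> \oo] --> 0%E.
  have -> : 0%E = (c^-1%:E * 0)%E :> \bar R by rewrite mule0.
  exact: cvgeZl.
apply: (squeeze_cvge _ (cvg_cst 0%E) h); apply: nearW => n; apply/andP; split.
  by apply: integral_ge0 => x _; rewrite lee_fin sqr_ge0.
pose k : R2 R -> \bar R := (fun a => ((f n (a, rho a) - g (a, rho a)) ^+ 2)%:E) \_ (base rho tau).
have mk : measurable_fun setT k.
  apply/(measurable_restrictT _ mbase); apply/measurable_EFinP; apply: measurable_funX.
  apply: measurable_funB; last exact: measurable_slice.
  apply: measurable_funTS.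
  exact: (measurableT_comp (mf n setT) (measurable_graph_point mrho)).
have k0 a : (0 <= k a)%E by rewrite /k patchE; case: ifP => // _; rewrite lee_fin sqr_ge0.
have le1 := area_le_graph_integral (ltW c0) cle mbase mk k0.
rewrite -(lee_pmul2l _ (_ : 0 < c%:E)%E) ?lte_fin // muleA -EFinM divff ?gt_eqF // mul1e.
have -> : (\int[area]_(a in base rho tau) ((f n (a, rho a) - g (a, rho a)) ^+ 2)%:E =
   \int[area]_(a in base rho tau) k a)%E.
  by apply: eq_integral => a ab; rewrite /k patchE ab.
apply: le_trans le1 _.
have -> : (\int[hausdorff2]_(x in graph rho `&` fst @^-1` base rho tau) k x.1 =
   \int[hausdorff2]_(x in graph rho `&` fst @^-1` base rho tau) ((f n x - g x) ^+ 2)%:E)%E.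
  apply: eq_integral => -[a s]; rewrite in_setE /graph /= => -[/= -> ab].
  by rewrite /k patchE ifT // in_setE.
have mgraph := measurable_graph_fst mrho mbase.
have sub : graph rho `&` fst @^-1` base rho tau `<=` boundary Omega.
  by move=> [a s]; rewrite /graph /= => -[/= -> ab]; exact: graph_sub.
apply: (ge0_subset_integral hausdorff2 mgraph (@measurable_boundary R Omega) _ _ sub).
  by apply/measurable_EFinP; apply: measurable_funX; exact: measurable_funB.
by move=> x _; rewrite lee_fin sqr_ge0.
Qed.

(** [D] is the energy of the vertical derivative over the solid, fixed before the weight: one
    constant serves every [W]. *)
Lemma hardy_trace (p g : R3 R -> R) : vertical_trace Omega p g ->
  area.-negligible (base rho tau `&` [set a | g (a, rho a) != 0]) ->
  exists2 D : R, 0 <= D & forall (B M : R) (W : R3 R -> R), 0 <= M ->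
    measurable_fun setT W -> (forall x, 0 <= W x <= B) ->
    (forall a, base rho tau a ->
       (\int[lambda]_(s in `]rho a, tau[) ((s - rho a) * W (a, s))%:E <= M%:E)%E) ->
    (\int[volume]_(x in Y) (p x ^+ 2 * W x)%:E <= (8 * M * D)%:E)%E.
Proof.
move=> [f [f3 [d3 [[cf cf3 df] [mp md mg] d3oo [cvf cvd cvg_]]]]] null.
have mc n D : measurable_fun D (f n).
  by apply: measurable_funTS; apply: continuous_measurable3; exact: cf.
have mc3 n D : measurable_fun D (f3 n).
  by apply: measurable_funTS; apply: continuous_measurable3; exact: cf3.
have mpY : measurable_fun Y p by exact: (measurable_funS mOmega Ysub mp).
have mdY : measurable_fun Y d3 by exact: (measurable_funS mOmega Ysub md).
have cvfY : (\int[volume]_(x in Y) ((f n x - p x) ^+ 2)%:E)%E @[n --> \oo] --> 0%E.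
  by apply: (sq_cvgS mY mOmega).
have cvdY : (\int[volume]_(x in Y) ((f3 n x - d3 x) ^+ 2)%:E)%E @[n --> \oo] --> 0%E.
  by apply: (sq_cvgS mY mOmega).
have cvg0 : (\int[area]_(a in base rho tau) ((f n (a, rho a) - 0) ^+ 2)%:E)%E
    @[n --> \oo] --> 0%E.
  rewrite (_ : (fun n => _) = (fun n =>
    \int[area]_(a in base rho tau) ((f n (a, rho a) - g (a, rho a)) ^+ 2)%:E)%E).
    exact: slice_cvg.
  apply/funext => n.
  have msl : measurable_fun (base rho tau) (fun a => f n (a, rho a)).
    by apply: measurable_funTS; exact: (measurableT_comp (mc n setT) (measurable_graph_point mrho)).
  apply: ae_eq_integral => //.
  - by apply/measurable_EFinP; apply: measurable_funX; apply: measurable_funB.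
  - apply/measurable_EFinP; apply: measurable_funX; apply: measurable_funB => //.
    exact: measurable_slice.
  apply: negligibleS null => a /= /not_implyP[ab ne]; split => //.
  by apply/eqP => g0; apply: ne; rewrite g0.
pose D := fine (\int[volume]_(x in Y) (d3 x ^+ 2)%:E).
have I0 : (0 <= \int[volume]_(x in Y) (d3 x ^+ 2)%:E)%E.
  by apply: integral_ge0 => x _; rewrite lee_fin sqr_ge0.
have Ioo : (\int[volume]_(x in Y) (d3 x ^+ 2)%:E < +oo)%E.
  apply: le_lt_trans d3oo; apply: (ge0_subset_integral volume mY mOmega _ _ Ysub).
    by apply/measurable_EFinP; exact: measurable_funX.
  by move=> x _; rewrite lee_fin sqr_ge0.
have DE : (\int[volume]_(x in Y) (d3 x ^+ 2)%:E)%E = D%:E by rewrite fineK // ge0_fin_numE.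
exists D; first exact: fine_ge0.
move=> B M W M0 mW WB hW; rewrite EFinM -DE.
exact: (@hardy_limit _ _ mrho rho0 tau f f3 p d3 (cst 0) tau0 cf cf3 df mpY mdY
  cvfY cvdY cvg0 B M W (fun=> erefl) M0 mW WB hW).
Qed.

(** The trace is only an L^2 limit, so its values near the apex have to be recovered from those of
    the function inside the solid. *)
Lemma trace_value (p g : R3 R -> R) (a0 kappa sigma : R) : vertical_trace Omega p g ->
  sigma < tau -> 0 <= kappa -> (forall x, Y x -> `|p x - a0| <= kappa) ->
  area (base rho sigma `&` [set a | kappa < `|g (a, rho a) - a0|]) = 0%E.
Proof.
move=> [f [f3 [d3 [[cf cf3 df] [mp md mg] d3oo [cvf cvd cvg_]]]]] st k0 pk.
have mc n D : measurable_fun D (f n).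
  by apply: measurable_funTS; apply: continuous_measurable3; exact: cf.
have mc3 n D : measurable_fun D (f3 n).
  by apply: measurable_funTS; apply: continuous_measurable3; exact: cf3.
have mpY : measurable_fun Y p by exact: (measurable_funS mOmega Ysub mp).
have mdY : measurable_fun Y d3 by exact: (measurable_funS mOmega Ysub md).
have cvfY : (\int[volume]_(x in Y) ((f n x - p x) ^+ 2)%:E)%E @[n --> \oo] --> 0%E.
  by apply: (sq_cvgS mY mOmega).
have cvdY : (\int[volume]_(x in Y) ((f3 n x - d3 x) ^+ 2)%:E)%E @[n --> \oo] --> 0%E.
  by apply: (sq_cvgS mY mOmega).
have Ioo : (\int[volume]_(x in Y) (d3 x ^+ 2)%:E < +oo)%E.
  apply: le_lt_trans d3oo; apply: (ge0_subset_integral volume mY mOmega _ _ Ysub).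
    by apply/measurable_EFinP; exact: measurable_funX.
  by move=> x _; rewrite lee_fin sqr_ge0.
exact: (@trace_limit _ _ mrho tau f f3 p d3 (fun a => g (a, rho a)) cf cf3 df mpY mdY
  (measurable_slice mg) cvfY cvdY (slice_cvg cf mg cvg_) a0 kappa sigma st k0 pk Ioo).
Qed.

End traces_near_corner.

(** * Bulk and boundary terms *)

Definition corner_test {R : realType} (r e : R) (x : R3 R) : R := chi r x * psi e x.

Section bulk.
Context {R : realType}.
Local Notation lambda := (@lebesgue_measure R).
Variables m tau : R.
Hypotheses (m0 : 0 < m) (tau0 : 0 < tau).
Local Notation rho := (rho m).
Local Notation Y := (above rho tau).
Let mrho : measurable_fun setT rho := measurable_rho m.
Let mY : measurable Y := measurable_above mrho tau.

Definition hardy_bound (U : R3 R -> R) (D : R) := forall (B M : R) (W : R3 R -> R), 0 <= M ->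
  measurable_fun setT W -> (forall x, 0 <= W x <= B) ->
  (forall a, base rho tau a ->
     (\int[lambda]_(s in `]rho a, tau[) ((s - rho a) * W (a, s))%:E <= M%:E)%E) ->
  (\int[volume]_(x in Y) (U x ^+ 2 * W x)%:E <= (8 * M * D)%:E)%E.

Section weights.
Variable e : R.
Hypotheses (e0 : 0 < e) (e1 : e <= 1).
Let b x : R := root_inv e (x : R3 R).2.

Let mb n D : measurable_fun D (fun x => b x ^+ n).
Proof.
apply: measurable_funX; apply: measurable_funTS.
exact: (measurableT_comp (continuous_measurable1 (continuous_root_inv e0)) measurable_snd).
Qed.

Let b0 x n : 0 <= b x ^+ n. Proof. by rewrite exprn_ge0 // ltW // root_inv_gt0. Qed.

(** [root_inv] is at most e^(-1/2), so its cube is an admissible weight; this bound depends on [e]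
    but does not enter the conclusion. *)
Lemma weight_hardy U D : hardy_bound U D ->
  (\int[volume]_(x in Y) (U x ^+ 2 * b x ^+ 3)%:E <= (8 * (2 * Num.sqrt (tau + 1)) * D)%:E)%E.
Proof.
move=> hU; apply: (hU ((Num.sqrt e)^-1 ^+ 3) _ (fun x => b x ^+ 3)).
- by rewrite mulr_ge0 // sqrtr_ge0.
- exact: mb.
- move=> x; have bp : 0 <= b x by apply: ltW; exact: root_inv_gt0.
  have ble : b x <= (Num.sqrt e)^-1 by exact: root_inv_le.
  by rewrite b0 /=; apply: lerXn2r; rewrite ?nnegrE ?invr_ge0 ?sqrtr_ge0.
by move=> a _; exact: hardy_weight_le.
Qed.

Lemma weight_linear U D : measurable_fun Y U -> hardy_bound U D ->
  (\int[volume]_(x in Y) (`|U x| * b x ^+ 4)%:E <=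
   (8 * (2 * Num.sqrt (tau + 1)) * D + 8 / m ^+ 2 * Num.sqrt (tau + 1))%:E)%E.
Proof.
move=> mU hU; rewrite EFinD.
apply: le_trans (leeD (weight_hardy hU) (above_weight_le m0 e0 tau0 e1)).
rewrite -[X in (_ <= X + _)%E]mul1e -[X in (_ <= _ + X)%E]mul1e.
have mp : measurable_fun Y (fun x => `|U x| * b x ^+ 4).
  by apply: measurable_funM; [exact: measurableT_comp|exact: mb].
have mq : measurable_fun Y (fun x => U x ^+ 2 * b x ^+ 3).
  by apply: measurable_funM; [exact: measurable_funX|exact: mb].
have p0 x : Y x -> 0 <= `|U x| * b x ^+ 4 by rewrite mulr_ge0.
have q0 x : Y x -> 0 <= U x ^+ 2 * b x ^+ 3 by rewrite mulr_ge0 // sqr_ge0.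
apply: (@le_integral2 _ _ _ volume Y _ _ _ 1 1 mY ler01 ler01 mp mq (@mb 5 Y) p0 q0
  (fun x _ => b0 x 5)).
move=> x _; rewrite !mul1r -/(b x) -(real_normK (num_real (U x))).
have := b0 x 3; move: `|U x| (normr_ge0 (U x)) (b x) (b0 x 1) => u u0 c c0 c3.
have h : 0 <= c ^+ 3 * ((u - c) ^+ 2 + u * c).
  by rewrite mulr_ge0 // addr_ge0 ?sqr_ge0 // mulr_ge0.
rewrite -subr_ge0 (_ : _ - _ = c ^+ 3 * ((u - c) ^+ 2 + u * c)) //; ring.
Qed.

(** On the solid x3 + e <= tau + 1, so sqrt (tau + 1) root_inv >= 1, and a fifth power of [root_inv]
    is obtained at the cost of that factor. *)
Lemma weight_cst :
  (\int[volume]_(x in Y) (b x ^+ 4)%:E <=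
   (Num.sqrt (tau + 1) * (8 / m ^+ 2 * Num.sqrt (tau + 1)))%:E)%E.
Proof.
have s0 : 0 <= Num.sqrt (tau + 1) by exact: sqrtr_ge0.
rewrite EFinM; apply: le_trans (lee_wpmul2l _ (above_weight_le m0 e0 tau0 e1)); last first.
  by rewrite lee_fin.
apply: (@le_integral1 _ _ _ volume Y _ _ _ mY s0 (@mb 4 Y) (@mb 5 Y) (fun x _ => b0 x 4)
  (fun x _ => b0 x 5)).
move=> x /andP[x1 x2]; rewrite -/(b x) [X in _ <= _ * X]exprS mulrA ler_peMl //.
have x0 : 0 <= x.2 by rewrite (le_trans (rho_ge0 m0 x.1)) // ltW.
have bp : 0 < b x by rewrite root_inv_gt0.
rewrite -(@ler_pXn2r _ 2) ?nnegrE ?mulr_ge0 ?(ltW bp) // expr1n exprMn sqr_sqrtr; last first.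
  by rewrite addr_ge0 ?(ltW tau0).
rewrite -[leLHS](root_inv_sqr e0 x0) -/(b x) mulrC ler_wpM2r ?sqr_ge0 //.
by rewrite lerD // ltW.
Qed.

End weights.

(* The bound [C] does not depend on [e], although [corner_test r e] blows up at the
   apex as [e] tends to 0: its Laplacian stays bounded because [psi e] is harmonic, and
   [F] is tamed by Hardy's inequality through
   [|U| b^4 <= U^2 b^3 + b^5] with [b = (x.2 + e) ^ (-1/2)]. *)
Lemma bulk_bound (r CF D D1 D2 : R) (U U1 U2 F : R3 R -> R) (dU : 'I_3 -> R3 R -> R) :
  0 < r -> 2 * r < tau -> 0 <= CF -> 0 <= D ->
  measurable_fun Y U -> measurable_fun Y U1 -> measurable_fun Y U2 -> measurable_fun Y F ->
  (forall i, measurable_fun Y (dU i)) ->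
  (\int[volume]_(x in Y) (U x ^+ 2)%:E < +oo)%E ->
  (forall i, \int[volume]_(x in Y) (dU i x ^+ 2)%:E < +oo)%E ->
  (forall i psi, test_function Y psi ->
    (\int[volume]_(x in Y) (U x * partial i psi x + dU i x * psi x)%:E = 0)%E) ->
  hardy_bound U D -> hardy_bound U1 D1 -> hardy_bound U2 D2 ->
  (forall x, Y x -> `|F x| <= CF * (1 + `|U1 x| + `|U2 x|)) ->
  exists C : R, forall e, 0 < e -> e <= 1 ->
    (`|\int[volume]_(x in Y) (\sum_(i < 3) dU i x * partial i (corner_test r e) x +
       F x * corner_test r e x)%:E| <= C%:E)%E.
Proof.
move=> r0 rtau CF0 D0 mU mU1 mU2 mF mdU U2oo dU2oo weak hU h1 h2 hF.
have [Cl Cl0 hCl] := laplacian_test_bounded r0.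
have volY := volume_above_lty m0 tau0.
have iU : volume.-integrable Y (EFin \o U) by exact: integrable_sqr.
pose A := fine (\int[volume]_(x in Y) (`|U x|)%:E)%E.
have AE : (\int[volume]_(x in Y) (`|U x|)%:E)%E = A%:E.
  rewrite fineK // ge0_fin_numE; last by apply: integral_ge0 => x _; rewrite lee_fin.
  by have /integrableP[_] := iU.
pose q := Num.sqrt (tau + 1); pose w := 8 / m ^+ 2 * q.
(* [Cl * A] bounds the terms with a differentiated cutoff; the rest bounds [F] against root_inv^4,
   separately for 1, |U1| and |U2|. *)
exists (Cl * A + CF * (q * w + ((8 * (2 * q) * D1 + w) + (8 * (2 * q) * D2 + w)))).
move=> e e0 e1; set phi := corner_test r e.
have sphi : sm phi by apply: sm_mul; [exact: sm_chi|exact: sm_psi].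
have phi0 x : 2 * r < enorm x -> phi x = 0.
  by move=> xr; rewrite /phi /corner_test chi_eq0 ?mul0r // ltW.
have Y0 x : Y x -> 0 <= x.2.
  by move=> /andP[x1 _]; rewrite (le_trans (rho_ge0 m0 x.1)) // ltW.
have phib x : Y x -> 0 <= phi x <= root_inv e x.2 ^+ 4.
  move=> /Y0 x0; rewrite /phi /corner_test mulr_ge0 ?chi_ge0 ?psi_ge0 //=.
  apply: le_trans (psi_le_root_inv e0 x0).
  by rewrite ler_piMl ?psi_ge0 // chi_le1.
have mphi D' : measurable_fun D' phi.
  by apply: measurable_funTS; apply: continuous_measurable3; exact: sm_continuous.
have green := green_le m0 D0 tau0 rtau mU mdU U2oo dU2oo weak hU sphi phi0.
have iG := integrable_gradient m0 tau0 mdU dU2oo sphi phi0.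
have lap : (\int[volume]_(x in Y) (`|U x| * `|laplacian phi x|)%:E <= (Cl * A)%:E)%E.
  rewrite EFinM -AE; apply: (@le_integral1 _ _ _ volume Y
    (fun x => `|U x| * `|laplacian phi x|) (fun x => `|U x|)) => //.
  - apply: measurable_funM; first exact: measurableT_comp.
    apply: measurableT_comp => //; apply: measurable_funTS.
    apply: measurable_sum => i; apply: continuous_measurable3; apply: sm_continuous.
    by do 2 apply: sm_partial.
  - exact: measurableT_comp.
  by move=> x /Y0 x0; rewrite mulrC ler_wpM2r // hCl.
have mb4 : measurable_fun Y (fun x : R3 R => root_inv e x.2 ^+ 4).
  apply: measurable_funX; apply: measurable_funTS.
  exact: (measurableT_comp (continuous_measurable1 (continuous_root_inv e0)) measurable_snd).
have mabs (f : R3 R -> R) : measurable_fun Y f -> measurable_fun Y (fun x => `|f x|).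
  by move=> mf; exact: measurableT_comp.
have b40 (x : R3 R) : 0 <= root_inv e x.2 ^+ 4 by rewrite exprn_ge0 // ltW // root_inv_gt0.
pose s2 x := 1 * (`|U1 x| * root_inv e x.2 ^+ 4) + 1 * (`|U2 x| * root_inv e x.2 ^+ 4).
pose s1 x := 1 * root_inv e x.2 ^+ 4 + 1 * s2 x.
have mU14 : measurable_fun Y (fun x => `|U1 x| * root_inv e x.2 ^+ 4).
  by apply: measurable_funM => //; exact: mabs.
have mU24 : measurable_fun Y (fun x => `|U2 x| * root_inv e x.2 ^+ 4).
  by apply: measurable_funM => //; exact: mabs.
have ms2 : measurable_fun Y s2.
  by apply: measurable_funD; apply: measurable_funM => //; exact: measurable_cst.
have ms1 : measurable_fun Y s1.
  by apply: measurable_funD; apply: measurable_funM => //; exact: measurable_cst.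
have s20 x : 0 <= s2 x by rewrite /s2 !mul1r addr_ge0 // mulr_ge0.
have s10 x : 0 <= s1 x by rewrite /s1 !mul1r addr_ge0.
have mFp : measurable_fun Y (fun x => F x * phi x) by exact: measurable_funM.
have Fbound : (\int[volume]_(x in Y) (`|F x * phi x|)%:E <=
    (CF * (q * w + ((8 * (2 * q) * D1 + w) + (8 * (2 * q) * D2 + w))))%:E)%E.
  rewrite EFinM.
  apply: (@le_trans _ _ (CF%:E * \int[volume]_(x in Y) (s1 x)%:E)%E).
    apply: (@le_integral1 _ _ _ volume Y (fun x => `|F x * phi x|) s1) => //; first exact: mabs.
    move=> x Yx; have /andP[p0 p1] := phib x Yx.
    rewrite normrM (ger0_norm p0); apply: le_trans (ler_pM _ _ (hF x Yx) p1) _ => //.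
    rewrite le_eqVlt; apply/orP; left; apply/eqP; rewrite /s1 /s2; ring.
  apply: lee_wpmul2l; first by rewrite lee_fin.
  have I1 := @le_integral2 _ _ _ volume Y s1 (fun x => root_inv e x.2 ^+ 4) s2 1 1 mY ler01 ler01
    ms1 mb4 ms2 (fun x _ => s10 x) (fun x _ => b40 x) (fun x _ => s20 x) (fun x _ => lexx _).
  apply: le_trans I1 _; rewrite !mul1e !EFinD; apply: leeD; first exact: weight_cst.
  have p1 x : Y x -> 0 <= `|U1 x| * root_inv e x.2 ^+ 4 by rewrite mulr_ge0.
  have p2 x : Y x -> 0 <= `|U2 x| * root_inv e x.2 ^+ 4 by rewrite mulr_ge0.
  have I2 := @le_integral2 _ _ _ volume Y s2 _ _ 1 1 mY ler01 ler01
    ms2 mU14 mU24 (fun x _ => s20 x) p1 p2 (fun x _ => lexx _).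
  apply: le_trans I2 _; rewrite !mul1e -!EFinD EFinD.
  by apply: leeD; exact: weight_linear.
have iF : volume.-integrable Y (fun x => (F x * phi x)%:E).
  apply/integrableP; split; first exact/measurable_EFinP.
  by apply: le_lt_trans Fbound _; rewrite ltry.
have -> : (\int[volume]_(x in Y) (\sum_(i < 3) dU i x * partial i phi x + F x * phi x)%:E =
   \int[volume]_(x in Y) (\sum_(i < 3) dU i x * partial i phi x)%:E +
   \int[volume]_(x in Y) (F x * phi x)%:E)%E.
  by rewrite -(integralD mY iG iF).
apply: le_trans (lee_abs_add _ _) _; rewrite EFinD; apply: leeD.
  exact: le_trans green lap.
apply: le_trans (le_abse_integral volume mY _) _; last exact: Fbound.
exact/measurable_EFinP.
Qed.

End bulk.

Lemma enorm_le_plane {R : realType} (x : R3 R) : enorm x <= plane_norm x.1 + `|x.2|.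
Proof.
have p0 := plane_norm_ge0 x.1.
rewrite -(@ler_pXn2r _ 2) ?nnegrE ?enorm_ge0 ?addr_ge0 // plane_normE sqrrD.
by rewrite real_normK ?num_real // addrAC lerDl mulrn_wge0 // mulr_ge0.
Qed.

Section boundary_term.
Context {R : realType}.
Variables m r : R.
Hypotheses (m0 : 0 < m) (r0 : 0 < r).
Local Notation rho := (rho m).
Let mrho : measurable_fun setT rho := measurable_rho m.

Definition patch (s : R) : set (R3 R) := graph rho `&` fst @^-1` base rho s.

Lemma measurable_patch s : measurable (patch s).
Proof. exact: (measurable_graph_fst mrho (measurable_base mrho s)). Qed.

Lemma patch_lty s : 0 < s -> (hausdorff2 (patch s) < +oo)%E.
Proof.
move=> s0; have [c c0 [_ cle]] := area_le_graph m0.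
apply: le_lt_trans (cle _ (measurable_base mrho s)) _.
apply: (@le_lt_trans _ _ (((1 + m ^+ 2) * c)%:E * (4 * (s / m) ^+ 2)%:E)%E).
  apply: lee_wpmul2l; last exact: area_base_le.
  by rewrite lee_fin mulr_ge0 ?(ltW c0) // addr_ge0 ?sqr_ge0.
by rewrite -EFinM ltry.
Qed.

Lemma patch_ge0 s x : patch s x -> 0 <= x.2.
Proof. by move=> [gx _]; rewrite (gx : x.2 = _) rho_ge0. Qed.

Lemma corner_test_ge0 e x : 0 < e -> 0 <= x.2 -> 0 <= corner_test r e x.
Proof. by move=> e0 x0; rewrite mulr_ge0 ?chi_ge0 ?psi_ge0. Qed.

(* On the graph [corner_test r e] is at least of order [(|a| + e)^-2], whose integral
   over a disc grows like [ln (1 / e)]. *)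
Lemma boundary_unbounded (f0 T : R3 R -> R) (K c : R) : 0 < c -> 0 <= K ->
  measurable_fun (patch (2 * r)) f0 -> measurable_fun (patch (2 * r)) T ->
  (forall x, 0 <= T x) ->
  (\int[hausdorff2]_(x in patch (2 * r)) (T x)%:E < +oo)%E ->
  (forall x, patch (2 * r) x -> `|f0 x| <= K * (1 + T x)) ->
  hausdorff2.-negligible (patch (2 * r) `&` [set x | f0 x < c]) ->
  forall C : R, exists e : R, [/\ 0 < e, e <= 1,
    hausdorff2.-integrable (patch (2 * r)) (fun x => (f0 x * corner_test r e x)%:E) &
    (C%:E < \int[hausdorff2]_(x in patch (2 * r)) (f0 x * corner_test r e x)%:E)%E].
Proof.
move=> c0 K0 mf mT T0 Too fK null C.
have rr : 0 < 2 * r by rewrite mulr_gt0.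
have mG := measurable_patch (2 * r); have Goo := patch_lty rr.
(* Points of the graph over [base sigma] satisfy |x| <= (1 + m) |a| < r, hence chi = 1 there. *)
pose sigma := r * m / (1 + m).
have m1 : 0 < 1 + m by rewrite addr_gt0.
have sigma0 : 0 < sigma by rewrite divr_gt0 // mulr_gt0.
have [ca ca0 [cle _]] := area_le_graph m0.
pose c2 := m / (1 + m) ^+ 4.
have c20 : 0 < c2 by rewrite divr_gt0 // exprn_gt0.
have k0 : 0 < ca * (c * c2) by apply: mulr_gt0 => //; exact: mulr_gt0.
(* The divisor collects the factors lost below: [ca] from area to surface, [c] from [f0], [c2] from
   the kernel on the graph. *)
have [e [/andP[e0 e1] he]] := log_divergence m0 (C / (ca * (c * c2))) sigma0.
exists e; split => //.
  have stest : sm (corner_test r e) by apply: sm_mul; [exact: sm_chi|exact: sm_psi].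
  have test_out x : 2 * r < enorm x -> corner_test r e x = 0.
    by move=> xr; rewrite /corner_test chi_eq0 ?mul0r // ltW.
  have [b _ hb] := sm_bounded stest test_out.
  apply: (integrable_bounded_mul (M := b)) => //.
    exact: (integrable_affine_bound mG Goo mf mT T0 K0 Too fK).
  by apply: measurable_funTS; apply: continuous_measurable3; exact: sm_continuous.
have mtest D : measurable_fun D (corner_test r e).
  apply: measurable_funTS; apply: continuous_measurable3; apply: sm_continuous.
  by apply: sm_mul; [exact: sm_chi|exact: sm_psi].
have test0 x : patch (2 * r) x -> 0 <= corner_test r e x.
  by move=> /patch_ge0; exact: corner_test_ge0.
(* Raising [f0] to at least [c] changes it only on a null set and makes the integrand nonnegative on
   the patch, so that the domain of integration can be shrunk. *)
pose f2 x := Num.max (f0 x) c * corner_test r e x.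
have mf2 : measurable_fun (patch (2 * r)) f2.
  apply: measurable_funM => //.
  by apply: (measurable_maxr (g := fun=> c)) => //; exact: measurable_cst.
have -> : (\int[hausdorff2]_(x in patch (2 * r)) (f0 x * corner_test r e x)%:E =
    \int[hausdorff2]_(x in patch (2 * r)) (f2 x)%:E)%E.
  apply: ae_eq_integral => //.
  - by apply/measurable_EFinP; exact: measurable_funM.
  - exact/measurable_EFinP.
  apply: negligibleS null => x /= /not_implyP[Gx ne]; split => //.
  rewrite ltNge; apply/negP => fc; apply: ne; rewrite /f2.
  by congr (_%:E); rewrite max_l.
have f20 x : patch (2 * r) x -> 0 <= f2 x.
  by move=> Gx; rewrite mulr_ge0 ?test0 // le_max (ltW c0) orbT.
have mS := measurable_patch sigma.
have Ssub : patch sigma `<=` patch (2 * r).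
  move=> x [gx bx]; split => //; apply: lt_trans bx _; rewrite /sigma ltr_pdivrMr //.
  have : 0 < r * m by rewrite mulr_gt0.
  by move: (r) r0 => r' r'0; lra.
apply: (@lt_le_trans _ _ (\int[hausdorff2]_(x in patch sigma) (f2 x)%:E)%E); last first.
  apply: (ge0_subset_integral hausdorff2 mS mG _ _ Ssub); first exact/measurable_EFinP.
  by move=> x Gx; rewrite lee_fin f20.
pose k a : \bar R := ((c * c2)%:E * (((plane_norm a + e)^-1) ^+ 2)%:E)%E.
have cc : 0 <= c * c2 by rewrite mulr_ge0 // ltW.
have mk : measurable_fun [set: R2 R] k.
  by apply: measurable_funeM; exact: measurable_log_kernel.
have kge a : (0 <= k a)%E by rewrite mule_ge0 // lee_fin // sqr_ge0.
have mb := measurable_base mrho sigma.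
have := area_le_graph_integral (ltW ca0) cle mb mk kge.
have -> : (\int[area]_(a in base rho sigma) k a =
    (c * c2)%:E * \int[area]_(a in base rho sigma) (((plane_norm a + e)^-1) ^+ 2)%:E)%E.
  apply: (ge0_integralZl area mb); rewrite ?lee_fin //.
    by apply: measurable_funTS; exact: measurable_log_kernel.
  by move=> a _; rewrite lee_fin sqr_ge0.
rewrite muleA -EFinM => kle.
apply: (@lt_le_trans _ _ ((ca * (c * c2))%:E *
    \int[area]_(a in base rho sigma) (((plane_norm a + e)^-1) ^+ 2)%:E)%E).
  by rewrite -lte_pdivrMl // -EFinM mulrC.
apply: le_trans kle _; apply: (ge0_le_integral hausdorff2 mS).
- by move=> x _; exact: kge.
- apply: measurable_funTS; exact: (measurableT_comp mk measurable_fst).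
- apply/measurable_EFinP; exact: measurable_funS mG Ssub mf2.
move=> x [gx bx]; have xE : x = (x.1, rho x.1) by rewrite -(gx : x.2 = _) -surjective_pairing.
have x0 : 0 <= x.2 by apply: (@patch_ge0 sigma); split.
have xr : enorm x <= r.
  apply: le_trans (enorm_le_plane x) _; rewrite ger0_norm // (gx : x.2 = _) /rho.
  have : plane_norm x.1 * (1 + m) <= r.
    have : m * plane_norm x.1 < sigma by exact: bx.
    rewrite /sigma ltr_pdivlMr // mulrAC -mulrA [_ * m]mulrC ltr_pM2l // => /ltW.
    by rewrite mulrC.
  by rewrite mulrDr mulr1 (mulrC m).
rewrite lee_fin -mulrA /f2 /corner_test chi_eq1 // mul1r.
apply: ler_pM; first exact: ltW.
- by rewrite mulr_ge0 ?(ltW c20) // sqr_ge0.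
- by rewrite le_max lexx orbT.
by rewrite {2}xE; exact: psi_graph_ge.
Qed.

End boundary_term.

(** * Real parts of the weak identities, and the contradiction *)

Lemma integral_restrict d (T : measurableType d) (R : realType) (mu : {measure set T -> \bar R})
    (D E : set T) (f : T -> \bar R) : D `<=` E -> (forall x, E x -> ~ D x -> f x = 0%E) ->
  (\int[mu]_(x in E) f x = \int[mu]_(x in D) f x)%E.
Proof.
move=> DE f0; rewrite [LHS]integral_mkcond [RHS]integral_mkcond.
apply: eq_integral => x _; rewrite !patchE.
case: ifPn => xE; case: ifPn => xD //.
- by rewrite f0 //; [exact: set_mem|move=> Dx; move/negP: xD; apply; exact: mem_set].
- by case/negP: xE; apply: mem_set; apply: DE; exact: set_mem.
Qed.

Section real_identities.
Context {R : realType}.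
Variables (Omega Y : set (R3 R)) (c : R).
Hypotheses (mOmega : measurable Omega) (mY : measurable Y) (Ysub : Y `<=` Omega).
Hypothesis Yoo : (volume Y < +oo)%E.
Hypothesis Yball : forall x, Y x -> enorm x <= c.
Implicit Types (u f : R3 R -> R[i]) (psi phi : R3 R -> R) (b : bool).

Lemma L2_part_lty u b : L2 volume Omega u ->
  (\int[volume]_(x in Y) (part b (u x) ^+ 2)%:E < +oo)%E.
Proof.
move=> hu; apply: le_lt_trans (sqr_lty b mOmega hu).
apply: (ge0_subset_integral volume mY mOmega _ _ Ysub).
  apply/measurable_EFinP; apply: measurable_funX; exact: measurable_part (proj1 hu).
by move=> x _; rewrite lee_fin sqr_ge0.
Qed.

Lemma L2_part_measurable u b : L2 volume Omega u -> measurable_fun Y (fun x => part b (u x)).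
Proof. by move=> [mu _]; exact: (measurable_funS mOmega Ysub (measurable_part b mu)). Qed.

Lemma L2_part_integrable u b : L2 volume Omega u ->
  volume.-integrable Y (fun x => (part b (u x))%:E).
Proof.
by move=> hu; apply: integrable_sqr => //; [exact: L2_part_measurable|exact: L2_part_lty].
Qed.

Lemma bounded_on psi : continuous psi -> exists B : R, forall x, Y x -> `|psi x| <= B.
Proof.
move=> cp; have [B _ hB] := @continuous_bounded_ball R psi c cp.
by exists B => x Yx; apply: hB; exact: Yball.
Qed.

Lemma part_mul_integrable u b psi : L2 volume Omega u -> continuous psi ->
  volume.-integrable Y (fun x => (part b (u x) * psi x)%:E).
Proof.
move=> hu cp; have [B hB] := bounded_on cp.
apply: (integrable_bounded_mul (M := B)) => //; first exact: L2_part_integrable.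
by apply: measurable_funTS; exact: continuous_measurable3.
Qed.

Lemma weak_part i u f psi b : L2 volume Omega u -> L2 volume Omega f ->
  weak_partial Omega i u f -> test_function Y psi ->
  volume.-integrable Y (fun x => (part b (u x) * partial i psi x + part b (f x) * psi x)%:E) /\
  (\int[volume]_(x in Y) (part b (u x) * partial i psi x + part b (f x) * psi x)%:E = 0)%E.
Proof.
move=> hu hf hw [spsi cpsi sY].
(* Off [Y] the derivative vanishes too, since the complement of the support is open. *)
have out x : ~ Y x -> psi x = 0 /\ partial i psi x = 0.
  move=> nY; have nS : (~` supp psi) x by move=> /sY.
  have zero y : (~` supp psi) y -> psi y = 0.
    by move=> ny; apply/eqP; apply: contrapT => /negP py; apply: ny; exact: subset_closure.
  split; first exact: zero.
  rewrite (@partial_near _ _ (cst 0)); first by apply: partial_eq; exact: is_derive_cst.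
  have : \near x, (~` supp psi) x.
    by apply: open_nbhs_nbhs; split => //; apply: closed_openC; exact: closed_closure.
  by apply: filterS => y; exact: zero.
have c0 : continuous psi by case: (spsi [::]).
have c1 : continuous (partial i psi) by case: (spsi [:: i]).
have i1 := part_mul_integrable b hu c1; have i2 := part_mul_integrable b hf c0.
split; first exact: (integrableD mY i1 i2).
have tO : test_function Omega psi by split => //; exact: subset_trans Ysub.
have := congr1 (part b) (hw _ tO).
rewrite partN !part_cintegral.
under eq_integral do rewrite partMr.
under [X in _ = - fine X]eq_integral do rewrite partMr.
rewrite (integral_restrict volume Ysub); last by move=> x _ /out[_ ->]; rewrite mulr0.
rewrite (integral_restrict volume Ysub); last by move=> x _ /out[-> _]; rewrite mulr0.
move=> eqf.
transitivity (\int[volume]_(x in Y) (part b (u x) * partial i psi x)%:E +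
   \int[volume]_(x in Y) (part b (f x) * psi x)%:E)%E.
  by rewrite -(integralD mY i1 i2).
(* The complex identity speaks only of [fine] values; integrability turns it back into an identity
   between the integrals themselves. *)
move: (integrable_fin_num mY i1) (integrable_fin_num mY i2) eqf.
move=> /fineK {2}<- /fineK {2}<- ->.
by rewrite -EFinD addNr.
Qed.

(** [f'] agrees with [f] almost everywhere on [Y] and may be better behaved: essential bounds become
    bounds at every point. The integral shrinks to [Y], where the test function lives. *)
Lemma part_normal_derivative b (du : 'I_3 -> R3 R -> R[i]) f f' phi :
  (forall i, cmeasurable Y (du i)) -> cmeasurable Y f -> cmeasurable Y f' ->
  {ae volume, forall x, Y x -> f x = f' x} -> sm phi ->
  (forall x, Omega x -> ~ Y x -> phi x = 0 /\ forall i, partial i phi x = 0) ->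
  part b (normal_derivative Omega du f phi) =
  fine (\int[volume]_(x in Y)
    (\sum_(i < 3) part b (du i x) * partial i phi x + part b (f' x) * phi x)%:E)%E.
Proof.
move=> mdu mf mf' ff' sphi out; rewrite /normal_derivative part_cintegral; congr fine.
under eq_integral do (rewrite partD part_sum partMr; under eq_bigr do rewrite partMr).
rewrite (integral_restrict volume Ysub); last first.
  move=> x Ox nY; have [-> dphi] := out x Ox nY.
  by rewrite mulr0 addr0 big1 // => i _; rewrite dphi mulr0.
have mc g : sm g -> measurable_fun Y g.
  by move=> sg; apply: measurable_funTS; apply: continuous_measurable3; exact: sm_continuous.
have msum g : cmeasurable Y g -> measurable_fun Y
   (fun x => (\sum_(i < 3) part b (du i x) * partial i phi x + part b (g x) * phi x)%:E).
  move=> mg; apply/measurable_EFinP; apply: measurable_funD.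
    apply: measurable_sum => i; apply: measurable_funM; first exact: measurable_part.
    by apply: mc; exact: sm_partial.
  by apply: measurable_funM; [exact: measurable_part|exact: mc].
apply: ae_eq_integral => //; [exact: msum|exact: msum|].
by apply: filterS ff' => x h Yx; rewrite h.
Qed.

End real_identities.

Section complex_bounds.
Context {R : realType}.
Implicit Types z : R[i].

Lemma le_1_sqr (n : R) : n <= 1 + n ^+ 2.
Proof.
rewrite -subr_ge0 (_ : _ - n = (n - 2^-1) ^+ 2 + 3 / 4); last by field.
by rewrite addr_ge0 ?sqr_ge0 // divr_ge0.
Qed.

Lemma normcD z z' : Normc.normc (z + z') <= Normc.normc z + Normc.normc z'.
Proof. exact: le_normcD. Qed.

Lemma normc_opp z : Normc.normc (- z) = Normc.normc z.
Proof. by case: z => a b /=; rewrite !sqrrN. Qed.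

Lemma normc_real (K : R) : 0 <= K -> Normc.normc K%:C%C = K.
Proof. by move=> K0 /=; rewrite expr0n /= addr0 sqrtr_sqr ger0_norm. Qed.

(** [w] has no pointwise bound, but the difference of the two sources is -K ((1 + V) (w - v) + V v),
    in which only w - v is unbounded. *)
Lemma source_bound (K M N : R) (zV zv zw : R[i]) : 0 <= K ->
  Normc.normc zV <= M -> Normc.normc zv <= N ->
  Normc.normc (- K%:C%C * (1 + zV) * zw - - K%:C%C * zv) <=
   K * (1 + M + M * N) * (1 + `|part true zw - part true zv| + `|part false zw - part false zv|).
Proof.
move=> K0 VM vN; have M0 := le_trans (normc_ge0 zV) VM; have N0 := le_trans (normc_ge0 zv) vN.
have -> : - K%:C%C * (1 + zV) * zw - - K%:C%C * zv =
    - (K%:C%C * ((1 + zV) * (zw - zv) + zV * zv)) by ring.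
rewrite normc_opp Normc.normcM normc_real // -mulrA ler_wpM2l //.
apply: le_trans (normcD _ _) _; rewrite !Normc.normcM -!partB.
have h1 : Normc.normc (1 + zV) <= 1 + M.
  by apply: le_trans (normcD _ _) _; rewrite Normc.normc1 lerD2l.
have h2 := normc_le_parts (zw - zv).
have a0 := normr_ge0 (part true (zw - zv)); have b0 := normr_ge0 (part false (zw - zv)).
have M1 : 0 <= 1 + M by rewrite addr_ge0.
apply: le_trans (lerD (ler_pM (normc_ge0 _) (normc_ge0 _) h1 h2)
  (ler_pM (normc_ge0 _) (normc_ge0 _) VM vN)) _.
move: `|_| `|_| a0 b0 => a b a0 b0; have MN := mulr_ge0 M0 N0; have ab := addr_ge0 b0 a0.
rewrite -subr_ge0 (_ : _ - _ = 1 + M + M * N * (a + b)); last by ring.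
by apply: addr_ge0 => //; apply: mulr_ge0.
Qed.

Lemma product_close (z z' e e' : R[i]) (kappa : R) : 0 <= kappa -> kappa <= 1 ->
  Normc.normc (e - e') <= kappa -> Normc.normc (z - z') <= 2 * kappa ->
  Normc.normc (e * z - e' * z') <= kappa * (2 * (Normc.normc e' + 1) + Normc.normc z').
Proof.
move=> k0 k1 he hz.
have -> : e * z - e' * z' = e * (z - z') + (e - e') * z' by ring.
have ne : Normc.normc e <= Normc.normc e' + 1.
  rewrite -[e](subrK e') addrC; apply: le_trans (normcD _ _) _.
  by rewrite lerD2l (le_trans he).
apply: le_trans (normcD _ _) _; rewrite !Normc.normcM.
apply: le_trans (lerD (ler_pM (normc_ge0 _) (normc_ge0 _) ne hz)
  (ler_wpM2r (normc_ge0 _) he)) _.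
by rewrite le_eqVlt; apply/orP; left; apply/eqP; ring.
Qed.

End complex_bounds.

Theorem theorem4p2 (R : realType) (Omega Gamma : set (R3 R)) (k : R)
    (V q eta v w : R3 R -> R[i]) (h theta0 alpha : R)
    (hOmega : bounded_lipschitz_domain Omega)
    (hcompl : connected (~` Omega))
    (hGamma : exists2 U : set (R3 R), open U & Gamma = U `&` boundary Omega)
    (hk : 0 < k)
    (hV : Linf volume Omega V)
    (hq : forall x, Omega x -> q x = 1 + V x)
    (heta : Linf hausdorff2 (boundary Omega) eta)
    (hvw : conductive_transmission_eigenfunctions Omega Gamma k q eta v w)
    (h0 : Gamma 0)
    (hh : 0 < h)
    (htheta : 0 < theta0 < pi / 2)
    (hcorner : Omega `&` eball h = cone theta0 `&` eball h)
    (halpha : 0 < alpha < 1)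
    (hv : holder alpha (closure (cone theta0 `&` eball h)) v)
    (hqH2 : H2 (cone theta0 `&` eball h) q)
    (hetaC : holder alpha (closure (boundary (cone theta0) `&` eball h)) eta)
    (heta0 : eta 0 <> 0) :
  v 0 = 0.
Proof.
apply: contrapT => v0.
have [oOmega _ _ _ _] := hOmega.
have mOmega : measurable Omega by exact: open_measurable3.
have [U0 oU0 GE] := hGamma.
have /andP[al0 _] := halpha; have /andP[th0 thpi] := htheta.
pose m := cos theta0 / sin theta0.
have m0 : 0 < m.
  apply: divr_gt0.
    by apply: cos_gt0_pihalf; rewrite thpi andbT (lt_trans _ th0) // oppr_lt0 divr_gt0 // pi_gt0.
  by apply: sin_gt0_pihalf; rewrite th0.
have coneEm : cone theta0 = [set x : R3 R | rho m x.1 < x.2] := coneE htheta.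
(* The same description of the corner is needed three times: for the domain, for the cone, whose
   boundary carries the regularity of [eta], and for the truncated cone, whose closure carries that
   of [v]. *)
have corner : Omega `&` eball h = [set x | rho m x.1 < x.2] `&` eball h.
  by rewrite hcorner coneEm.
have cornerC : cone theta0 `&` eball h = [set x | rho m x.1 < x.2] `&` eball h by rewrite coneEm.
have cornerB : (cone theta0 `&` eball h) `&` eball h =
    [set x | rho m x.1 < x.2] `&` eball h by rewrite coneEm -setIA setIid.
have rho00 : rho m (0 : R2 R) = 0.
  by rewrite /rho /plane_norm /= !expr0n /= addr0 sqrtr0 mulr0.
have closure0 : closure (cone theta0 `&` eball h) 0.
  by have [] := graph_boundary cornerB (x := 0) (eq_ind_r (fun t => t < h) hh enorm0) (esym rho00).
have eta_dom x : enorm x < h -> x.2 = rho m x.1 ->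
    closure (boundary (cone theta0) `&` eball h) x.
  by move=> xh xr; apply: subset_closure; split => //; exact: (graph_boundary cornerC).
have eta_dom0 : closure (boundary (cone theta0) `&` eball h) 0.
  by apply: eta_dom; rewrite ?enorm0 // rho00.
pose c := eta 0 * v 0.
have cn0 : c != 0 by rewrite mulf_neq0 //; apply/eqP.
have [b cb] := part_neq0 cn0.
pose c1 := `|part b c| / 2.
have c10 : 0 < c1 by rewrite divr_gt0 // normr_gt0.
(* [S] is the constant of [product_close]: if [eta] is within [kappa] and the trace within 2 kappa
   of their values at the apex, their product is within kappa S <= c1 of [c], that is, within half
   of |part b c|. *)
pose S := 2 * (Normc.normc (eta 0) + 1) + Normc.normc (v 0).
have S0 : 0 <= S by rewrite addr_ge0 ?normc_ge0 // mulr_ge0 // addr_ge0 ?normc_ge0.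
have S1 : 0 < S + 1 by rewrite ltr_wpDl.
pose kappa := Num.min 1 (c1 / (S + 1)).
have kappa0 : 0 < kappa by rewrite lt_min ltr01 divr_gt0.
have kappa1 : kappa <= 1 by rewrite ge_min lexx.
have kappaS : kappa * S <= c1.
  apply: (@le_trans _ _ (c1 / (S + 1) * (S + 1))); last by rewrite divfK // gt_eqF.
  apply: ler_pM => //; first exact: ltW; last by rewrite lerDl.
  by rewrite ge_min lexx orbT.
have [d1 d10 hd1] : exists2 d : R, 0 < d & forall y : R3 R, enorm y < d -> U0 y.
  have : nbhs (0 : R3 R) U0.
    by apply: open_nbhs_nbhs; split => //; move: h0; rewrite GE => -[].
  by move=> /enorm_nbhs[d d0 dU]; exists d => // y yd; apply: dU; rewrite subr0.
have [d2 d20 hd2] := holder_small al0 hv closure0 kappa0.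
have [d3 d30 hd3] := holder_small al0 hetaC eta_dom0 kappa0.
pose eps := Num.min (Num.min h d1) (Num.min d2 d3).
have eps0 : 0 < eps by rewrite !lt_min hh d10 d20 d30.
have m1 : 0 < 1 + m by rewrite addr_gt0.
(* Chosen so that tau / m + tau = eps: the solid of height [tau] then lies in the ball of radius
   [eps]. *)
pose tau := eps * m / (1 + m).
have tau0 : 0 < tau by rewrite divr_gt0 // mulr_gt0.
pose r := tau / 4.
have r0 : 0 < r by rewrite divr_gt0.
have r_tau : 2 * r < tau.
  by move: (tau) tau0 @r r0 => t t0 r' _; rewrite /r'; lra.
have small x : rho m x.1 < tau -> 0 <= x.2 -> x.2 < tau ->
    [/\ enorm x < eps, enorm x < h, enorm x < d1, enorm x < d2 & enorm x < d3].
  move=> x1 x20 x2.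
  have xe : enorm x < eps.
    apply: le_lt_trans (enorm_le_plane x) _; rewrite ger0_norm //.
    have : plane_norm x.1 < tau / m by rewrite ltr_pdivlMr // mulrC.
    have -> : eps = tau / m + tau by rewrite /tau; field; rewrite !gt_eqF.
    by move=> ?; apply: ltrD.
  have /andP[/andP[? ?] /andP[? ?]] : ((enorm x < h) && (enorm x < d1)) &&
      ((enorm x < d2) && (enorm x < d3)) by rewrite -!lt_min.
  by split.
pose Y := above (rho m) tau.
have mrho := measurable_rho m.
have mY : measurable Y := measurable_above mrho tau.
have Y0 x : Y x -> [/\ rho m x.1 < tau, 0 <= x.2 & x.2 < tau].
  move=> /andP[x1 x2]; have p0 := rho_ge0 m0 x.1.
  by split => //; [exact: lt_trans x2|exact: le_trans (ltW x1)].
have Ysmall x : Y x -> [/\ enorm x < eps, enorm x < h, enorm x < d1, enorm x < d2 & enorm x < d3].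
  by move=> /Y0[? ? ?]; exact: small.
have Ysub : Y `<=` Omega.
  move=> x Yx; have [_ xh _ _ _] := Ysmall x Yx; have /andP[x1 _] := Yx.
  by have [] : (Omega `&` eball h) x by rewrite corner.
have Ydom x : Y x -> closure (cone theta0 `&` eball h) x.
  move=> Yx; have [_ xh _ _ _] := Ysmall x Yx; have /andP[x1 _] := Yx.
  by apply: subset_closure; rewrite cornerC.
have Yball x : Y x -> enorm x <= eps by move=> /Ysmall[/ltW].
have Yoo := volume_above_lty m0 tau0.
have base_small a : base (rho m) tau a -> [/\ enorm ((a, rho m a) : R3 R) < eps,
    enorm ((a, rho m a) : R3 R) < h, enorm ((a, rho m a) : R3 R) < d1,
    enorm ((a, rho m a) : R3 R) < d2 & enorm ((a, rho m a) : R3 R) < d3].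
  by move=> ab; apply: small => //=; exact: rho_ge0.
have graph_sub a : base (rho m) tau a -> boundary Omega (a, rho m a).
  by move=> /base_small[_ ah _ _ _]; exact: (graph_boundary corner).
have graph_Gamma a : base (rho m) tau a -> Gamma (a, rho m a).
  move=> ab; rewrite GE; split; last exact: graph_sub.
  by apply: hd1; have [] := base_small a ab.
have patch_tau x : patch m (2 * r) x -> base (rho m) tau x.1 /\ x = (x.1, rho m x.1).
  move=> [gx bx]; split; first exact: lt_trans r_tau.
  by rewrite -(gx : x.2 = _) -surjective_pairing.
have [_ _ _ [dv [dw [tv [tw [[Hv Hw] [trv trw] tvw green]]]]]] := hvw.
have [L2v hdv] := Hv; have [L2w hdw] := Hw.
have L2dv i := (hdv i).1; have L2dw i := (hdw i).1.
have [mv _] := L2v; have [mw _] := L2w.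
have [mtv tv2] := trv.1.
pose vw b' x := part b' (w x) - part b' (v x).
have vtr b' : vertical_trace Omega (vw b') (fun x => part b' (tw x) - part b' (tv x)).
  by apply: vertical_traceB => //; exact: trace_vertical.
have tr0 b' : area.-negligible (base (rho m) tau `&`
    [set a | part b' (tw (a, rho m a)) - part b' (tv (a, rho m a)) != 0]).
  apply: negligibleS (area_negligible_graph m0 tau tvw) => a [ab ne].
  split => //= H; move/negP: ne; apply; rewrite H ?subrr //; exact: graph_Gamma.
have hardy b' := hardy_trace m0 tau0 mOmega Ysub graph_sub (vtr b') (tr0 b').
(* Green's inequality concerns the part [b] alone, but the complex coefficient mixes the parts in
   the source term, so Hardy's inequality is needed for both. *)
have [D D0 hD] := hardy b; have [D1 _ hD1] := hardy true; have [D2 _ hD2] := hardy false.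
have mvw b' : measurable_fun Y (vw b').
  by apply: measurable_funB; apply: (L2_part_measurable mOmega Ysub).
pose dU i x := part b (dw i x) - part b (dv i x).
have mdU i : measurable_fun Y (dU i).
  by apply: measurable_funB; apply: (L2_part_measurable mOmega Ysub).
have sq_lty (f g : R3 R -> R[i]) : L2 volume Omega f -> L2 volume Omega g ->
    (\int[volume]_(x in Y) ((part b (f x) - part b (g x)) ^+ 2)%:E < +oo)%E.
  move=> Lf Lg.
  have mf := L2_part_measurable mOmega Ysub b Lf; have mg := L2_part_measurable mOmega Ysub b Lg.
  have I := @le_integral2 _ _ _ volume Y (fun x => (part b (f x) - part b (g x)) ^+ 2)
    (fun x => part b (f x) ^+ 2) (fun x => part b (g x) ^+ 2) 2 2 mY (ler0n _ 2) (ler0n _ 2)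
    (measurable_funX 2 (measurable_funB mf mg)) (measurable_funX 2 mf) (measurable_funX 2 mg)
    (fun x _ => sqr_ge0 _) (fun x _ => sqr_ge0 _) (fun x _ => sqr_ge0 _).
  apply: le_lt_trans (I _) _.
    move=> x _; rewrite -subr_ge0 (_ : _ - _ = (part b (f x) + part b (g x)) ^+ 2) ?sqr_ge0 //; ring.
  apply: lte_add_pinfty; rewrite lte_mul_pinfty //; exact: (L2_part_lty mOmega mY Ysub).
have weak i psi : test_function Y psi ->
    (\int[volume]_(x in Y) (vw b x * partial i psi x + dU i x * psi x)%:E = 0)%E.
  move=> tp.
  have [iw zw] := weak_part mOmega mY Ysub Yoo Yball b L2w (L2dw i) (hdw i).2 tp.
  have [iv zv] := weak_part mOmega mY Ysub Yoo Yball b L2v (L2dv i) (hdv i).2 tp.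
  transitivity (\int[volume]_(x in Y)
    ((part b (w x) * partial i psi x + part b (dw i x) * psi x)%:E -
     (part b (v x) * partial i psi x + part b (dv i x) * psi x)%:E))%E.
    by apply: eq_integral => x _; rewrite -EFinB /vw /dU; congr (_%:E); ring.
  by rewrite (integralB mY iw iv) zw zv sube0.
have [mV [M0 hM0]] := hV.
pose M := Num.max M0 0.
have Mge0 : 0 <= M by rewrite le_max lexx orbT.
(* V is bounded only almost everywhere; truncation makes the bound on the source valid at every
   point. *)
pose Fw x := - (k ^+ 2)%:C%C * (1 + truncate M (V x)) * w x.
pose Fv x := - (k ^+ 2)%:C%C * v x.
have toY f : cmeasurable Omega f -> cmeasurable Y f := cmeasurableS mOmega Ysub.
have mFw : cmeasurable Y Fw.
  apply: toY; apply: cmeasurableM => //; apply: cmeasurableM; first exact: cmeasurable_cst.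
  by apply: cmeasurableD; [exact: cmeasurable_cst|exact: cmeasurable_truncate].
have mFv : cmeasurable Y Fv.
  by apply: toY; apply: cmeasurableM => //; exact: cmeasurable_cst.
have mqw : cmeasurable Y (fun x => - (k ^+ 2)%:C%C * q x * w x).
  have mVw : cmeasurable Y (fun x => - (k ^+ 2)%:C%C * (1 + V x) * w x).
    apply: toY; apply: cmeasurableM => //; apply: cmeasurableM; first exact: cmeasurable_cst.
    by apply: cmeasurableD => //; exact: cmeasurable_cst.
  case: mVw => e1 e2; split.
    apply/(measurable_fun_eqP (fun x => complex.Re (- (k ^+ 2)%:C%C * (1 + V x) * w x))) => //.
    by move=> x /set_mem /Ysub Ox; rewrite hq.
  apply/(measurable_fun_eqP (fun x => complex.Im (- (k ^+ 2)%:C%C * (1 + V x) * w x))) => //.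
  by move=> x /set_mem /Ysub Ox; rewrite hq.
have aeF : {ae volume, forall x, Y x -> - (k ^+ 2)%:C%C * q x * w x = Fw x}.
  apply: filterS hM0 => x Vx Yx; rewrite /Fw /truncate (hq _ (Ysub _ Yx)).
  by rewrite ifT // le_max Vx //; exact: Ysub.
have aeFv : {ae volume, forall x, Y x -> - (k ^+ 2)%:C%C * v x = Fv x}.
  by apply: aeW.
have k2 : 0 <= k ^+ 2 by rewrite sqr_ge0.
have vle x : Y x -> Normc.normc (v x) <= Normc.normc (v 0) + 1.
  move=> Yx; rewrite -[v x](subrK (v 0)) addrC; apply: le_trans (normcD _ _) _.
  rewrite lerD2l; apply: le_trans kappa1; apply: hd2; first exact: Ydom.
  by have [] := Ysmall x Yx.
pose N := Normc.normc (v 0) + 1.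
have N0 : 0 <= N by rewrite addr_ge0 ?normc_ge0.
pose CF := k ^+ 2 * (1 + M + M * N).
have CF0 : 0 <= CF by rewrite mulr_ge0 // !addr_ge0 // mulr_ge0.
pose F x := part b (Fw x) - part b (Fv x).
have mF : measurable_fun Y F by apply: measurable_funB; exact: measurable_part.
have hF x : Y x -> `|F x| <= CF * (1 + `|vw true x| + `|vw false x|).
  move=> Yx; rewrite /F -partB; apply: le_trans (part_le _ _) _.
  by apply: source_bound => //; [exact: normc_truncate|exact: vle].
have [C hC] := bulk_bound m0 tau0 r0 r_tau CF0 D0 (mvw b) (mvw true) (mvw false) mF mdU
  (sq_lty w v L2w L2v) (fun i => sq_lty _ _ (L2dw i) (L2dv i)) weak hD hD1 hD2 hF.
(* The sign makes the boundary integrand positive near the apex, where it is close to s part b c = 2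
   c1. *)
pose s := Num.sg (part b c).
have s1 : `|s| = 1 by rewrite /s normr_sg cb.
have mB := measurable_boundary Omega.
have mprod : cmeasurable (boundary Omega) (fun x => eta x * tv x) := cmeasurableM heta.1 mtv.
pose G := patch m (2 * r).
have mG : measurable G := measurable_patch m (2 * r).
have Gsub : G `<=` boundary Omega.
  by move=> x /patch_tau[xb ->]; exact: graph_sub.
pose f0 x := s * part b (eta x * tv x).
have mf0 : measurable_fun G f0.
  apply: measurable_funM; first exact: measurable_cst.
  exact: (measurable_funS mB Gsub (measurable_part b mprod)).
pose T x := Normc.normc (tv x) ^+ 2.
have mTB : measurable_fun (boundary Omega) T := measurable_normc_sqr mB mtv.
have mT : measurable_fun G T := measurable_funS mB Gsub mTB.
have T0 x : 0 <= T x by exact: sqr_ge0.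
have Too : (\int[hausdorff2]_(x in G) (T x)%:E < +oo)%E.
  apply: le_lt_trans tv2; apply: (ge0_subset_integral hausdorff2 mG mB _ _ Gsub).
    exact/measurable_EFinP.
  by move=> x _; rewrite lee_fin.
have eta_near x : G x -> Normc.normc (eta x - eta 0) <= kappa.
  move=> /patch_tau[xb ->]; have [_ xh _ _ xd] := base_small _ xb.
  by apply: hd3 => //; exact: eta_dom.
have eta_le x : G x -> Normc.normc (eta x) <= Normc.normc (eta 0) + 1.
  move=> Gx; rewrite -[eta x](subrK (eta 0)) addrC; apply: le_trans (normcD _ _) _.
  by rewrite lerD2l (le_trans (eta_near x Gx)).
have K0 : 0 <= Normc.normc (eta 0) + 1 by rewrite addr_ge0 ?normc_ge0.
have fK x : G x -> `|f0 x| <= (Normc.normc (eta 0) + 1) * (1 + T x).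
  move=> Gx; rewrite /f0 normrM s1 mul1r; apply: le_trans (part_le _ _) _.
  by rewrite Normc.normcM; apply: ler_pM; rewrite ?normc_ge0 ?le_1_sqr ?eta_le.
(* Base points where a part of the trace of [v] differs from v(0) by more than [kappa]; null by
   [trace_value], since inside the solid [v] is within [kappa] of v(0). *)
pose bad b' : set (R2 R) := base (rho m) (2 * r) `&`
  [set a | kappa < `|part b' (tv (a, rho m a)) - part b' (v 0)|].
have bad0 b' : hausdorff2.-negligible (graph (rho m) `&` fst @^-1` bad b').
  apply: (graph_negligible_area m0); exists (bad b'); split => //.
    have msl : measurable_fun (base (rho m) (2 * r))
        (fun a => kappa < `|part b' (tv (a, rho m a)) - part b' (v 0)|).
      apply: measurable_fun_ltr; first exact: measurable_cst.
      apply: measurableT_comp => //; apply: measurable_funB; last exact: measurable_cst.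
      apply: (measurable_funS (measurable_base mrho tau)).
        by move=> a /lt_trans; apply.
      exact: (measurable_slice graph_sub (measurable_part b' mtv)).
    exact: (msl (measurable_base mrho (2 * r)) [set true]).
  apply: (trace_value m0 mOmega Ysub graph_sub (trace_vertical b' mOmega trv) r_tau (ltW kappa0)).
  move=> x Yx; rewrite -partB; apply: le_trans (part_le _ _) _.
  by apply: hd2; [exact: Ydom|have [] := Ysmall x Yx].
have null : hausdorff2.-negligible (G `&` [set x | f0 x < c1]).
  apply: negligibleS (negligibleU (bad0 true) (bad0 false)) => x [Gx /= fx].
  have [xb xE] := patch_tau x Gx; have [gx bx] := Gx.
  apply: contrapT => /not_orP[nt nf].
  have close b' : ~ (graph (rho m) `&` fst @^-1` bad b') x ->
      `|part b' (tv x) - part b' (v 0)| <= kappa.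
    move=> nb; rewrite leNgt; apply/negP => lt; apply: nb; split => //; split => //.
    by rewrite /= -xE.
  have tvx : Normc.normc (tv x - v 0) <= 2 * kappa.
    apply: le_trans (normc_le_parts _) _; rewrite !partB mulr_natl mulr2n.
    by apply: lerD; exact: close.
  have := product_close (ltW kappa0) kappa1 (eta_near x Gx) tvx; rewrite -/S -/c => pc.
  have pd : `|s * (part b (eta x * tv x) - part b c)| <= c1.
    rewrite normrM s1 mul1r -partB; apply: le_trans (part_le _ _) _.
    exact: le_trans pc kappaS.
  have sc : s * part b c = c1 + c1 by rewrite /s -normrEsg /c1 -splitr.
  move: fx; apply/negP; rewrite -leNgt /f0.
  move: pd; rewrite mulrBr sc ler_norml => /andP[pd _].
  by move: pd; rewrite lerBrDr addrA addNr add0r.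
(* [C] was obtained before [e], so [e] can be taken small enough for the boundary term to exceed
   it. *)
have [e [e0 e1 if0 ltC]] := boundary_unbounded m0 r0 c10 K0 mf0 mT T0 Too fK null C.
have := hC e e0 e1; set phi := corner_test r e; move=> hCe.
have sphi : sm phi by apply: sm_mul; [exact: sm_chi|exact: sm_psi].
have phi0 x : 2 * r < enorm x -> phi x = 0.
  by move=> xr; rewrite /phi /corner_test chi_eq0 ?mul0r // ltW.
have tau_eps : tau < eps.
  by rewrite /tau ltr_pdivrMr // mulrDr mulr1 ltrDr.
have [r_h r_d1] : 2 * r < h /\ 2 * r < d1.
  have := lt_trans r_tau tau_eps; rewrite {1}/eps => r_eps.
  have /andP[/andP[? ?] _] : ((2 * r < h) && (2 * r < d1)) &&
    ((2 * r < d2) && (2 * r < d3)) by rewrite -!lt_min.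
  by split.
have btf : boundary_test_function Omega Gamma phi.
  have [cs ss] := supp_compact phi0; split => //; first exact: sm_smooth.
  by move=> x [/ss xr bx]; rewrite GE; split => //; apply: hd1; exact: le_lt_trans r_d1.
(* In the ball of radius 2 r the domain coincides with the cone, and heights there are at most 2 r <
   tau. *)
have out x : Omega x -> ~ Y x -> phi x = 0 /\ forall i, partial i phi x = 0.
  move=> Ox nY; suff xr : 2 * r < enorm x.
    by split; [exact: phi0|move=> i; exact: (partial_outside i phi0)].
  rewrite ltNge; apply/negP => xr; apply: nY.
  have xh : enorm x < h by exact: le_lt_trans r_h.
  have [x1 _] : ([set x | rho m x.1 < x.2] `&` eball h) x by rewrite -corner.
  rewrite /Y /above /= x1 /=; apply: le_lt_trans r_tau; apply: le_trans xr.
  by apply: le_trans (coord3_le_enorm x); exact: ler_norm.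
have mphi A : measurable_fun A phi.
  by apply: measurable_funTS; apply: continuous_measurable3; exact: sm_continuous.
have [Bphi _ hBphi] := sm_bounded sphi phi0.
(* Each of the two normal derivatives has to be integrable by itself before their difference becomes
   a single integral over [Y]. *)
have isum (du : 'I_3 -> R3 R -> R[i]) (f g : R3 R -> R[i]) (K : R) :
    (forall i, L2 volume Omega (du i)) -> cmeasurable Y f -> L2 volume Omega g -> 0 <= K ->
    (forall x, Normc.normc (f x) <= K * Normc.normc (g x)) ->
    volume.-integrable Y
      (fun x => (\sum_(i < 3) part b (du i x) * partial i phi x + part b (f x) * phi x)%:E).
  move=> Ldu mf Lg Kge fg.
  have i1 := @integrable_gradient R m m0 tau (2 * r) (fun i x => part b (du i x)) phi tau0
    (fun i => L2_part_measurable mOmega Ysub b (Ldu i))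
    (fun i => L2_part_lty mOmega mY Ysub b (Ldu i)) sphi phi0.
  have mgO := measurable_normc_sqr mOmega Lg.1.
  have ig : volume.-integrable Y (fun x => (part b (f x))%:E).
    apply: (integrable_affine_bound (K := K) (q := fun x => Normc.normc (g x) ^+ 2)) => //.
    - exact: measurable_part.
    - exact: (measurable_funS mOmega Ysub mgO).
    - by move=> x; exact: sqr_ge0.
    - apply: le_lt_trans Lg.2; apply: (ge0_subset_integral volume mY mOmega _ _ Ysub).
        exact/measurable_EFinP.
      by move=> x _; rewrite lee_fin sqr_ge0.
    move=> x _; apply: le_trans (part_le _ _) _; apply: le_trans (fg x) _.
    by rewrite ler_wpM2l // le_1_sqr.
  have i2 : volume.-integrable Y (fun x => (part b (f x) * phi x)%:E).
    exact: (integrable_bounded_mul mY ig (mphi Y) (fun x _ => hBphi x)).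
  exact: (integrableD mY i1 i2).
have mdu (du : 'I_3 -> R3 R -> R[i]) : (forall i, L2 volume Omega (du i)) ->
    forall i, cmeasurable Y (du i) by move=> L i; apply: toY; exact: (L i).1.
have kM : 0 <= k ^+ 2 * (1 + M) by rewrite mulr_ge0 // addr_ge0.
have iW : volume.-integrable Y (fun x =>
    (\sum_(i < 3) part b (dw i x) * partial i phi x + part b (Fw x) * phi x)%:E).
  apply: (isum dw Fw w _ L2dw mFw L2w kM) => x; rewrite /Fw !Normc.normcM normc_opp normc_real //.
  apply: ler_wpM2r; first exact: normc_ge0.
  apply: ler_wpM2l => //; apply: le_trans (normcD _ _) _.
  by rewrite Normc.normc1 lerD2l normc_truncate.
have iV : volume.-integrable Y (fun x =>
    (\sum_(i < 3) part b (dv i x) * partial i phi x + part b (Fv x) * phi x)%:E).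
  by apply: (isum dv Fv v _ L2dv mFv L2v k2) => x; rewrite /Fv Normc.normcM normc_opp normc_real.
have := congr1 (part b) (green phi btf); rewrite partD part_cintegral.
rewrite (part_normal_derivative mY Ysub b (mdu dw L2dw) mqw mFw aeF sphi out).
rewrite (part_normal_derivative mY Ysub b (mdu dv L2dv) mFv mFv aeFv sphi out).
have GGamma : G `<=` Gamma by move=> x /patch_tau[xb ->]; exact: graph_Gamma.
(* [G] is cut by a strict inequality, so boundary points with |x| = 2 r may fall outside it; [chi]
   vanishes there as well. *)
rewrite (integral_restrict hausdorff2 GGamma); last first.
  move=> x Gx nG; suff xr : 2 * r <= enorm x.
    by rewrite partMr /phi /corner_test chi_eq0 // mul0r mulr0.
  rewrite leNgt; apply/negP => xr; apply: nG.
  have bx : boundary Omega x by move: Gx; rewrite GE => -[].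
  have xh : enorm x < h by exact: lt_trans r_h.
  have gx := boundary_graph corner oOmega xh bx.
  split => //; rewrite /base /= -gx; apply: le_lt_trans xr.
  by apply: le_trans (coord3_le_enorm x); exact: ler_norm.
have iE : (\int[hausdorff2]_(x in G) (part b (eta x * tv x * (phi x)%:C%C))%:E =
    s%:E * \int[hausdorff2]_(x in G) (f0 x * phi x)%:E)%E.
  rewrite -(integralZl mG if0); apply: eq_integral => x _.
  have ss : s * s = 1 by rewrite -expr2 -(real_normK (num_real s)) s1 expr1n.
  by rewrite partMr -EFinM /f0; congr (_%:E); rewrite !mulrA ss mul1r.
rewrite iE; move: ltC (integrable_fin_num mG if0).
have hE : (\int[volume]_(x in Y) (\sum_(i < 3) dU i x * partial i phi x + F x * phi x)%:E =
    \int[volume]_(x in Y) ((\sum_(i < 3) part b (dw i x) * partial i phi x + part b (Fw x) * phi x)%:E -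
     (\sum_(i < 3) part b (dv i x) * partial i phi x + part b (Fv x) * phi x)%:E))%E.
  apply: eq_integral => x _; rewrite -EFinB; congr (_%:E).
  have -> : \sum_(i < 3) dU i x * partial i phi x =
      \sum_(i < 3) part b (dw i x) * partial i phi x - \sum_(i < 3) part b (dv i x) * partial i phi x.
    by rewrite -sumrB; apply: eq_bigr => i _; rewrite /dU mulrBl.
  by rewrite /F; move: (\sum_(_ < _) _) (\sum_(_ < _) _) => p q'; ring.
move: hCe; rewrite hE (integralB mY iW iV).
move: (integrable_fin_num mY iW) (integrable_fin_num mY iV).
rewrite -/G -/phi.
(* The three integrals are finite by integrability, so only the case of real numbers remains: the
   boundary term is at most [C] in absolute value and yet exceeds [C]. *)
move: (\int[volume]_(_ in _) _)%E (\int[volume]_(_ in _) _)%E (\int[hausdorff2]_(_ in _) _)%E.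
move=> [IW||] [IV||] [I0||] //= _ _; rewrite lee_fin lte_fin => hCe ltC _ eqI.
move: hCe; rewrite eqI addrAC subrr add0r normrM s1 mul1r => /(le_trans (ler_norm _)).
by rewrite leNgt ltC.
Qed.
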